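(* Assume hypotheses (A1)–(A10) listed in the context hold. For $\epsilon>0$ let $(u^\epsilon,m^\epsilon)$ be a solution of the regularized system described in the context, and let $p>d$. Then \begin{align*} \|Du^\epsilon\|_{L^\infty(0,T;L^\infty(\mathbb{T}^d))}\le{}& C+C\|g_\epsilon(m^\epsilon)\|^{\frac1{1-\mu}}_{L^\infty(0,T;L^p(\mathbb{T}^d))}\\ &+C\|g_\epsilon(m^\epsilon)\|^{\frac1{1-\mu}}_{L^\infty(0,T;L^p(\mathbb{T}^d))}\|u^\epsilon\|^{\frac1{1-\mu}}_{L^\infty(0,T;L^\infty(\mathbb{T}^d))}, \end{align*} where $C$ is independent of $\epsilon$.
   Context: $\mathbb{T}^d$ is the $d$-dimensional flat torus, $T>0$ fixed. Data: $H:\mathbb{T}^d\times\mathbb{R}^d\to\mathbb{R}$, $g:[0,\infty)\to\mathbb{R}$, $u_T,m_0:\mathbb{T}^d\to\mathbb{R}$. Hypotheses: (A1) $H$ is $C^\infty$; $p\mapsto H(x,p)$ strictly convex; $\lim_{|p|\to\infty}H(x,p)/|p|=+\infty$; $H\ge1$. (A2) $g$ non-negative and increasing; $u_T,m_0\in C^\infty(\mathbb{T}^d)$, $m_0\ge0$, $\int m_0=1$. (A3) With $\hat L(x,p)=D_pH(x,p)\cdot p-H(x,p)$, there are $c,C>0$ with $\hat L\ge cH-C$. (A4) $g(z)=z^\alpha$, $\alpha>0$. (A5) $|D_xH|,|D^2_{xx}H|\le CH+C$, and for every symmetric matrix $M$ and $\delta>0$ there is $C_\delta$ with $\operatorname{tr}(D^2_{px}H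 M)\le\delta\operatorname{tr}(D^2_{pp}HM^2)+C_\delta H$. (A6) $m_0\ge\kappa_0>0$ for a constant $\kappa_0$. (A7) For some $0<\mu<1$ and non-negative constants: $c_1|p|^{2+\mu}+C_1\le H\le c_2|p|^{2+\mu}+C_2$. (A8) $|D_pH(x,p)|^2\le C|p|^\mu H(x,p)+C$. (A9) $|D^2_{xp}H|^2\le CH^{\frac{2+2\mu}{2+\mu}}$ and, for every symmetric $M$, $|D^2_{pp}HM|^2\le CH^{\frac{\mu}{2+\mu}}\operatorname{tr}(D^2_{pp}HMM)$. (A10) $\alpha<\frac{2}{d(1+\mu)-2}$. Regularized system: $\eta_\epsilon$ is a standard symmetric mollifying kernel and $g_\epsilon(m)=\eta_\epsilon*g(\eta_\epsilon*m)$. A solution is a pair of smooth functions $u^\epsilon,m^\epsilon$ on $\mathbb{T}^d\times[0,T]$ with $-u^\epsilon_t+H(x,Du^\epsilon)=\Delta u^\epsilon+g_\epsilon(m^\epsilon)$, $m^\epsilon_t-\operatorname{div}(D_pH(x,Du^\epsilon)m^\epsilon)=\Delta m^\epsilon$, $u^\epsilon(x,T)=u_T(x)$, $m^\epsilon(x,0)=m_0(x)$. *)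

(* Defs.v *)
From HB Require Import structures.
From mathcomp Require Import all_boot all_order all_algebra.
From mathcomp Require Import all_classical all_reals all_analysis.
Set Implicit Arguments. Unset Strict Implicit. Unset Printing Implicit Defensive.
Import Order.TTheory GRing.Theory Num.Theory.
Import numFieldNormedType.Exports.
Local Open Scope classical_set_scope.
Local Open Scope ring_scope.

Section Defs.
Variable R : realType.

Fixpoint Ck (V : normedModType R) (k : nat) (f : V -> R) : Prop :=
  continuous f /\
  (if k is k'.+1 then forall v : V, (forall x, derivable f x v) /\ Ck k' ('D_v f)
   else True).

Definition smooth (V : normedModType R) (f : V -> R) := forall k, Ck k f.

Definition ev (d : nat) (i : 'I_d) : 'rV[R]_d := delta_mx 0 i.

Definition enorm (d : nat) (v : 'rV[R]_d) : R := Num.sqrt (\sum_i v 0 i ^+ 2).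
Definition fnorm (d : nat) (M : 'M[R]_d) : R :=
  Num.sqrt (\sum_i \sum_j M i j ^+ 2).
Definition dotv (d : nat) (v w : 'rV[R]_d) : R := \sum_i v 0 i * w 0 i.

Fixpoint iint (A : set R) (n : nat) : ('rV[R]_n -> R) -> R :=
  match n with
  | 0 => fun f => f 0
  | n'.+1 => fun f =>
      Rintegral (@lebesgue_measure R) A
        (fun t => @iint A n' (fun y : 'rV[R]_n' =>
           f (\row_(i < n'.+1) match unlift ord0 i with Some j => y 0 j | None => t end)))
  end.

Definition unitI : set R := [set x | 0 <= x <= 1].

(* Z^d-periodicity, i.e. functions on the flat torus T^d = R^d / Z^d *)
Definition torus_periodic (d : nat) (f : 'rV[R]_d -> R) :=
  forall x i, f (x + ev i) = f x.
Definition periodic_x (d : nat) (f : 'rV[R]_d * R -> R) :=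
  forall x t i, f (x + ev i, t) = f (x, t).
Definition periodic_H (d : nat) (H : 'rV[R]_d * 'rV[R]_d -> R) :=
  forall x p i, H (x + ev i, p) = H (x, p).

Section HDer.
Variables (d : nat) (H : 'rV[R]_d * 'rV[R]_d -> R).
Definition dX (i : 'I_d) : 'rV[R]_d * 'rV[R]_d := (ev i, 0).
Definition dP (i : 'I_d) : 'rV[R]_d * 'rV[R]_d := (0, ev i).
Definition DpH (x p : 'rV[R]_d) : 'rV[R]_d := \row_i ('D_(dP i) H) (x, p).
Definition DxH (x p : 'rV[R]_d) : 'rV[R]_d := \row_i ('D_(dX i) H) (x, p).
Definition DppH (x p : 'rV[R]_d) : 'M[R]_d :=
  \matrix_(i, j) ('D_(dP i) ('D_(dP j) H)) (x, p).
Definition DxxH (x p : 'rV[R]_d) : 'M[R]_d :=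
  \matrix_(i, j) ('D_(dX i) ('D_(dX j) H)) (x, p).
Definition DpxH (x p : 'rV[R]_d) : 'M[R]_d :=
  \matrix_(i, j) ('D_(dP i) ('D_(dX j) H)) (x, p).
Definition DxpH (x p : 'rV[R]_d) : 'M[R]_d :=
  \matrix_(i, j) ('D_(dX i) ('D_(dP j) H)) (x, p).
Definition Lhat (x p : 'rV[R]_d) : R := dotv (DpH x p) p - H (x, p).
End HDer.

Section UDer.
Variables (d : nat).
Definition dx (i : 'I_d) : 'rV[R]_d * R := (ev i, 0).
Definition dt : 'rV[R]_d * R := (0, 1).
Definition Dx (u : 'rV[R]_d * R -> R) (z : 'rV[R]_d * R) : 'rV[R]_d :=
  \row_i ('D_(dx i) u) z.
Definition Lap (u : 'rV[R]_d * R -> R) (z : 'rV[R]_d * R) : R :=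
  \sum_i ('D_(dx i) ('D_(dx i) u)) z.
Definition divx (V : 'rV[R]_d * R -> 'rV[R]_d) (z : 'rV[R]_d * R) : R :=
  \sum_i ('D_(dx i) (fun w => V w 0 i)) z.
End UDer.

Definition mollifier (d : nat) (eta : 'rV[R]_d -> R) :=
  smooth eta /\ (forall x, 0 <= eta x) /\ (forall x, eta (- x) = eta x) /\
  (forall x, 1 < enorm x -> eta x = 0) /\ iint setT eta = 1.

Definition eta_eps (d : nat) (eta : 'rV[R]_d -> R) (eps : R) (y : 'rV[R]_d) : R :=
  eps ^- d * eta (eps^-1 *: y).

(* convolution with eta_eps (of a torus_periodic function: convolution on T^d) *)
Definition moll (d : nat) (eta : 'rV[R]_d -> R) (eps : R) (f : 'rV[R]_d -> R)
  (x : 'rV[R]_d) : R := iint setT (fun y => eta_eps eta eps y * f (x - y)).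

Definition gpow (alpha : R) (z : R) : R := z `^ alpha.

Definition geps (d : nat) (eta : 'rV[R]_d -> R) (alpha eps : R)
  (m : 'rV[R]_d * R -> R) (z : 'rV[R]_d * R) : R :=
  moll eta eps (fun y => gpow alpha (moll eta eps (fun w => m (w, z.2)) y)) z.1.

Definition reg_solution (d : nat) (H : 'rV[R]_d * 'rV[R]_d -> R)
  (eta : 'rV[R]_d -> R) (alpha eps T : R) (uT m0 : 'rV[R]_d -> R)
  (u m : 'rV[R]_d * R -> R) : Prop :=
  smooth u /\ smooth m /\ periodic_x u /\ periodic_x m /\
      (forall x t, 0 <= t <= T ->
         - ('D_(@dt d) u) (x, t) + H (x, Dx u (x, t))
         = Lap u (x, t) + geps eta alpha eps m (x, t)) /\
      (forall x t, 0 <= t <= T ->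
         ('D_(@dt d) m) (x, t) - divx (fun z => m z *: DpH H z.1 (Dx u z)) (x, t)
         = Lap m (x, t)) /\
      (forall x, u (x, T) = uT x) /\
      (forall x, m (x, 0) = m0 x).

Definition grad_sup (d : nat) (T : R) (u : 'rV[R]_d * R -> R) : R :=
  sup [set r | exists x t, 0 <= t <= T /\ r = enorm (Dx u (x, t))].
Definition sup_norm (d : nat) (T : R) (u : 'rV[R]_d * R -> R) : R :=
  sup [set r | exists x t, 0 <= t <= T /\ r = `|u (x, t)|].
Definition LinfLp (d : nat) (T p : R) (f : 'rV[R]_d * R -> R) : R :=
  sup [set r | exists t, 0 <= t <= T /\
         r = (iint unitI (fun x => `|f (x, t)| `^ p)) `^ p^-1].

End Defs.

(* Main.v *)
(** With [f = g_eps(m)] the value function solves [-u_t - Lap u + H(x, Du) = f], so for the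
    linearized operator [L = -d_t - Lap + b . D], [b = D_pH(x, Du)], one has
    [L u = f + Lhat >= c H - C] and, for a component [v] of [Du],
    [L v = D f - H_x <= D f + C H + C], where [|b|^2 <= C K^mu H + C] and [K = sup |Du|].
    The singular source [D f] is removed by a barrier [Psi = lam^-1 log Phi], where [Phi] solves
    [Phi_t + Lap Phi + lam (D f) Phi = 0] backwards from [1]. The heat kernel maps [L^p] to
    [L^oo] with norm [t^(-d/2p)] and a derivative costs [t^(-1/2)]; as [p > d], both
    [int P(D f)] and [int P(f^2)] are controlled by [G = |f|_(L^oo L^p)]. With [lam ~ 1/(1 + G)]
    and an energy identity this keeps [Phi] in [[1/2, 3/2]]. Comparing [v] with
    [Psi + A u + B (T - t)], [A ~ 1 + K^mu (1 + G)] being large enough to absorb every multiple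
    of [H], gives [K <= C (1 + G) (1 + |u|) (1 + K^mu)], and [mu < 1] allows [K^mu] to be absorbed.

    The comparison is carried out on a space-time grid, where [Lap] becomes a symmetric random
    walk, [-Lap + b . D] a walk with transition weights [(1 +- th) / 2], and the heat kernel a
    product of binomial distributions. The barrier bounds do not depend on the mesh, and the
    consistency error of a single step may be as large as [1] per unit of time, so only the
    uniform continuity of finitely many derivatives of [u] is used. *)

Require Import Defs.
From HB Require Import structures.
From mathcomp Require Import all_boot all_order all_algebra.
From mathcomp Require Import ring lra zify.
From mathcomp Require Import all_classical all_reals all_analysis.
Import Order.TTheory GRing.Theory Num.Theory.
Import numFieldNormedType.Exports.
Local Open Scope ring_scope.
Set Implicit Arguments. Unset Strict Implicit. Unset Printing Implicit Defensive.

(** * Markov operators and random walks *)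

(** The logarithm is what reconciles a barrier for [D f] with a drift of uncontrolled size. The
    equation of log Phi carries the extra term |D log Phi|^2; completing the square against b . D
    log Phi leaves only |b|^2, and |b|^2 / lam is a multiple of (1 + G) (1 + K^mu H). This dictates
    the size of A, and no pointwise bound on D Phi is ever used. The obstacle is that Phi multiplies
    D f in its own equation, so that a bound on the heat flow of D f alone says nothing. The Leibniz
    rule turns (D f) Phi into D (f Phi) - f D Phi: in the first term Phi is a bounded factor,
    harmless in L^p, and the second asks only for a space-time L^2 bound on D Phi, the gain in the
    identity for Phi^2. On a grid Phi exists by recursion and every maximum is attained; the
    variance of one step of the walk stands for |D Phi|^2. The mesh is chosen after the solution and
    the constants before it, so no rate of convergence is required. *)

Section Operators.
Variables (R : realFieldType) (V : zmodType).
Implicit Types (A B : (V -> R) -> V -> R) (g : V -> R).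

(** Convolution with a probability measure on the group [V], known only through its action.
    Translation invariance is what lets difference quotients and other averages pass through it. *)
Record markov A : Prop := Markov {
  markov_le : forall g1 g2, (forall x, g1 x <= g2 x) -> forall x, A g1 x <= A g2 x;
  markov_lin : forall a g1 g2 x, A (fun z => a * g1 z + g2 z) x = a * A g1 x + A g2 x;
  markov_cst : forall c x, A (fun=> c) x = c;
  markov_shift : forall y g x, A (fun z => g (z + y)) x = A g (x + y) }.

Section MarkovTheory.
Variables (A : (V -> R) -> V -> R) (mA : markov A).

Lemma markov_ext g1 g2 x : (forall x, g1 x = g2 x) -> A g1 x = A g2 x.
Proof. by move=> e; apply/le_anti/andP; split; apply: markov_le => // z; rewrite e. Qed.

Lemma markovD g1 g2 x : A (fun z => g1 z + g2 z) x = A g1 x + A g2 x.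
Proof.
by rewrite -[A g1 x]mul1r -markov_lin //; apply: markov_ext => z; rewrite mul1r.
Qed.

Lemma markovZ a g x : A (fun z => a * g z) x = a * A g x.
Proof.
rewrite (@markov_ext _ (fun z => a * g z + 0)); last by move=> z; rewrite addr0.
by rewrite markov_lin // markov_cst // addr0.
Qed.

Lemma markovB g1 g2 x : A (fun z => g1 z - g2 z) x = A g1 x - A g2 x.
Proof.
rewrite (@markov_ext _ (fun z => -1 * g2 z + g1 z)); last by move=> z; ring.
by rewrite markov_lin //; ring.
Qed.

Lemma markov_ub g c x : (forall x, g x <= c) -> A g x <= c.
Proof. by move=> gc; rewrite -(markov_cst mA c x); apply: markov_le. Qed.

Lemma markov_lb g c x : (forall x, c <= g x) -> c <= A g x.
Proof. by move=> gc; rewrite -[leLHS](markov_cst mA c x); apply: markov_le. Qed.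

Lemma markov_sum (J : Type) (r : seq J) (F : J -> V -> R) x :
  A (fun z => \sum_(j <- r) F j z) x = \sum_(j <- r) A (F j) x.
Proof.
elim: r => [|j r IH].
  by rewrite big_nil -[RHS](markov_cst mA 0 x); apply: markov_ext => z; rewrite big_nil.
rewrite big_cons -IH -markovD; apply: markov_ext => z.
by rewrite big_cons.
Qed.

Lemma markov_norm g x : `|A g x| <= A (fun z => `|g z|) x.
Proof.
rewrite ler_norml; apply/andP; split.
  rewrite lerNl -mulN1r -markovZ //; apply: markov_le => // z.
  by rewrite mulN1r -normrN ler_norm.
by apply: markov_le => // z; apply: ler_norm.
Qed.

Lemma markov_norm_ub g c x : (forall x, `|g x| <= c) -> `|A g x| <= c.
Proof. by move=> gc; apply: le_trans (markov_norm _ _) _; apply: markov_ub. Qed.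

Lemma markov_sqr g x : (A g x) ^+ 2 <= A (fun z => g z ^+ 2) x.
Proof.
have : 0 <= A (fun z => (g z - A g x) ^+ 2) x by apply: markov_lb => z; rewrite sqr_ge0.
rewrite (@markov_ext _ (fun z => (- 2 * A g x) * g z + (g z ^+ 2 + A g x ^+ 2))); last by move=>
  z; ring.
by rewrite markov_lin // markovD markov_cst //; lra.
Qed.

End MarkovTheory.

Lemma markov_id : markov id.
Proof. by []. Qed.

Lemma markov_comp A B : markov A -> markov B -> markov (fun g => A (B g)).
Proof.
move=> mA mB; split.
- by move=> g1 g2 h x; apply: markov_le => // z; apply: markov_le.
- move=> a g1 g2 x; rewrite -markov_lin //; apply: markov_ext => // z.
  exact: markov_lin.
- move=> c x; rewrite -[RHS](markov_cst mA c x); apply: markov_ext => // z.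
  exact: markov_cst.
- move=> y g x; rewrite -markov_shift //; apply: markov_ext => // z.
  exact: markov_shift.
Qed.

Lemma markov_iter A n : markov A -> markov (iter n A).
Proof.
by move=> mA; elim: n => [|n IH]; [exact: markov_id | exact: markov_comp].
Qed.

(* The steps [y], [- y] have probabilities [(1 + th) / 2], [(1 - th) / 2]. *)
Definition avg (th : R) (y : V) g x :=
  (1 + th) / 2 * g (x + y) + (1 - th) / 2 * g (x - y).

Lemma markov_avg th y : -1 <= th <= 1 -> markov (avg th y).
Proof.
move=> /andP[th1 th2]; rewrite /avg; split.
- by move=> g1 g2 h x; apply: lerD; apply: ler_wpM2l => //; lra.
- by move=> a g1 g2 x; ring.
- by move=> c x; field.
- by move=> z g x; rewrite (addrAC x z y) (addrAC x z (- y)).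
Qed.

Lemma markov_avgC A th y g x : markov A -> A (avg th y g) x = avg th y (A g) x.
Proof.
by move=> mA; rewrite /avg markov_lin // markovZ // !markov_shift.
Qed.

Definition dquo (y : V) (h : R) g x := (g (x + y) - g x) / h.

Lemma markov_dquo A y h g x : markov A -> A (dquo y h g) x = dquo y h (A g) x.
Proof.
move=> mA; rewrite /dquo -markov_shift // -markovB // mulrC -markovZ //.
by apply: markov_ext => // z; rewrite mulrC.
Qed.

Section Walk.
Variables (I : Type) (e : I -> V).

(** One time step moves once along every direction of [r], in turn, instead of along a random one.
    The symmetric law after [n] steps is then a product of one-dimensional binomial laws. *)
Fixpoint walk (th : I -> R) (r : seq I) g :=
  if r is i :: r' then walk th r' (avg (th i) (e i) g) else g.

Lemma markov_walk th r : (forall i, -1 <= th i <= 1) -> markov (walk th r).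
Proof.
move=> h; elim: r => [|i r IH] /=; first exact: markov_id.
exact: markov_comp IH (markov_avg _ (h i)).
Qed.

Lemma markov_walk0 r : markov (walk (fun=> 0) r).
Proof. by apply: markov_walk => _; rewrite lerN10 ler01. Qed.

(** Averages along different directions commute, so the [n] steps along [i] can all be made
    first. *)
Lemma iter_walk_cons (i : I) r n g x : let P := walk (fun=> 0) in
  iter n (P (i :: r)) g x = iter n (P r) (iter n (avg 0 (e i)) g) x.
Proof.
have mw := markov_walk0 r; have ma := markov_walk0 [:: i].
move=> P; elim: n x => // n IH x; rewrite !iterS [LHS]/=.
apply: (markov_ext mw) => {}x.
rewrite (markov_avgC _ _ _ _ (markov_iter n mw)).
exact: (markov_ext ma).
Qed.

End Walk.

Definition variance A g x := A (fun z => g z ^+ 2) x - A g x ^+ 2.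

(* Two grid steps apart, so that the difference is the gap between the two values averaged by
   the last step of the walk, which the variance controls. *)
Lemma sqr_diff_walk (I : Type) (e : I -> V) i r g x P :
  P = walk e (fun=> 0) (i :: r) ->
  (P g (x + (e i + e i)) - P g x) ^+ 2
    <= 2 * (variance P g x + variance P g (x + (e i + e i))).
Proof.
move=> PE.
have mw := markov_walk0 e r.
set Po := walk _ _ r in mw.
(* The mean of two squares is the square of the mean plus the square of half the gap; Jensen's
   inequality for [Po] compares the first part with [(P g)^2] and leaves the gap for the
   variance. *)
have W4 y : Po (fun z => (g (z + e i) - g (z - e i)) ^+ 2) y <= 4 * variance P g y.
  rewrite /variance PE /= -/Po.
  have := markov_sqr mw (avg 0 (e i) g) y.
  set a := Po _ y; set b := Po _ y => ab.
  have -> : Po (avg 0 (e i) (fun z => g z ^+ 2)) y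
     = Po (fun z => 4^-1 * (g (z + e i) - g (z - e i)) ^+ 2 + (avg 0 (e i) g z) ^+ 2) y.
    by apply: markov_ext => // z; rewrite /avg; field.
  rewrite markov_lin //; rewrite -/b; set c := Po _ y; lra.
(* The two averages share the value [g (z + e i)], which bridges them: their difference is half the
   sum of the gaps at [z + 2 e] and at [z]. *)
have -> : P g (x + (e i + e i)) - P g x = Po (fun z => 2^-1 * ((g (z + (e i + e i) + e i) - g (z
  + (e i + e i) - e i)) + (g (z + e i) - g (z - e i)))) x.
  rewrite PE /= -/Po -markov_shift // -markovB //; apply: markov_ext => // z.
  have zE : z + (e i + e i) - e i = z + e i by rewrite addrA addrK.
  by rewrite /avg zE; field.
apply: le_trans (markov_sqr mw _ _) _.
have := W4 x; have := W4 (x + (e i + e i)).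
rewrite -markov_shift //; set a := Po _ x; set b := Po _ x => ha hb.
apply: (@le_trans _ _ (2^-1 * a + 2^-1 * b)); last lra.
rewrite -!markovZ // -markovD //; apply: markov_le => // z.
set c := g _ - _; set c' := g _ - _; have := sqr_ge0 (c - c'); nra.
Qed.

Section Duhamel.
Variables (P : (V -> R) -> V -> R) (mP : markov P) (tau : R).

(** The discrete Duhamel integral from zero data. The newest source is added without being averaged,
    so [q 0] never enters and [n] steps see the sources [1] to [n]. *)
Fixpoint duh (q : nat -> V -> R) n x : R :=
  if n is n'.+1 then P (duh q n') x + tau * q n x else 0.

Lemma duhS q n x : duh q n.+1 x = P (duh q n) x + tau * q n.+1 x.
Proof. by []. Qed.

Lemma duh_sum q n x : duh q n x = \sum_(j < n) tau * iter j P (q (n - j)%N) x.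
Proof.
elim: n x => [|n IH] x /=; first by rewrite big_ord0.
rewrite big_ord_recl /= addrC subn0; congr (_ + _).
rewrite (markov_ext mP _ IH) markov_sum //; apply: eq_bigr => j _.
by rewrite markovZ.
Qed.
End Duhamel.
End Operators.

(** * Binomial distributions on a cycle *)

Section Binomial.

Lemma leq_bin_half n j : (j < n./2)%N -> ('C(n, j) <= 'C(n, j.+1))%N.
Proof.
move=> h; have := mul_bin_left n j.
have : (j.+1 <= n - j)%N by lia.
move: ('C(n, j)) ('C(n, j.+1)) => a b h1 h2.
by rewrite -(@leq_pmul2l j.+1) // h2 leq_mul2r h1 orbT.
Qed.

(** A sharp enough substitute for Stirling's formula: the induction step amounts to (2m + 1)(2m + 3)
    <= (2m + 2)^2. *)
Lemma leq_central_bin m : ('C(m.*2, m) ^ 2 * m.*2.+1 <= 4 ^ m.*2)%N.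
Proof.
elim: m => // m IH.
have h1 := mul_bin_diag m.*2.+1 m.
have h2 : ('C(m.+1.*2, m.+1) = 2 * 'C(m.*2.+1, m.+1))%N.
  rewrite doubleS binS -(@bin_sub m.*2.+1 m); last by lia.
  have -> : (m.*2.+1 - m = m.+1)%N by lia.
  by lia.
rewrite h2; move: h1 IH; rewrite /=; set a := 'C(m.*2, m); set b := 'C(m.*2.+1, m.+1) => h1 IH.
rewrite doubleS (expnS 4 m.*2.+1) (expnS 4 m.*2) -(@leq_pmul2l (m.+1 ^ 2)) ?expn_gt0 //.
have -> : (m.+1 ^ 2 * ((2 * b) ^ 2 * m.*2.+3) = 4 * ((m.+1 * b)^2) * m.*2.+3)%N by rewrite
  !expnMn; lia.
rewrite -h1 expnMn.
have e : (4 * (m.*2.+1 ^ 2 * a ^ 2) * m.*2.+3 = (a ^ 2 * m.*2.+1) * (4 * m.*2.+1 * m.*2.+3))%N by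
  lia.
rewrite e.
have -> : (m.+1 ^ 2 * (4 * (4 * 4 ^ m.*2)) = 4 ^ m.*2 * (16 * m.+1 ^ 2))%N by lia.
by apply: leq_mul => //; nia.
Qed.

Lemma leq_bin_central n : ('C(n, n./2) ^ 2 * n.+1 <= 4 ^ n)%N.
Proof.
have := odd_double_half n; case: (odd n) => /= [|]; last first.
  by rewrite add0n => <-; rewrite doubleK leq_central_bin.
move: (n./2) => m; rewrite add1n => <-.
have := leq_central_bin m.+1.
have h2 : ('C(m.+1.*2, m.+1) = 2 * 'C(m.*2.+1, m))%N.
  rewrite doubleS binS -(@bin_sub m.*2.+1 m); last by lia.
  have -> : (m.*2.+1 - m = m.+1)%N by lia.
  by lia.
rewrite h2 doubleS (expnS 4 m.*2.+1) expnMn; move: ('C(_, _)) => b; lia.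
Qed.

End Binomial.

(** * Monotone weights against periodic and bounded sequences *)

Section Sequences.
Variable (R : realFieldType).
Implicit Types (s : nat -> R).

Lemma pascal_sum s n :
  \sum_(j < n.+2) 'C(n.+1, j)%:R * s j
    = \sum_(j < n.+1) 'C(n, j)%:R * s j + \sum_(j < n.+1) 'C(n, j)%:R * s j.+1.
Proof.
rewrite big_ord_recl bin0 [in RHS]big_ord_recl bin0 -addrA; congr (_ + _).
rewrite (eq_bigr (fun j : 'I_n.+1 => 'C(n, j.+1)%:R * s j.+1 + 'C(n, j)%:R * s j.+1)); last first.
  by move=> j _; rewrite /= binS natrD mulrDl.
rewrite big_split /=; congr (_ + _).
by rewrite big_ord_recr /= bin_small // mul0r addr0.
Qed.

Section Window.
Variables (N : nat) (s : nat -> R).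
Hypotheses (N0 : (0 < N)%N) (s0 : forall j, 0 <= s j)
  (sN : forall j, s (j + N)%N = s j).

Let S := \sum_(j < N) s j.

Lemma sum_period a : \sum_(j < N) s (a + j)%N = S.
Proof.
elim: a => [|a IH]; first by [].
rewrite -IH; case: N N0 sN => // N' _ sN'.
rewrite big_ord_recr big_ord_recl /= addrC addSnnS sN' addn0; congr (_ + _).
by apply: eq_bigr => j _; rewrite addSnnS.
Qed.

(** A window is covered by whole periods; the [1] pays for rounding their number up. *)
Lemma sum_window a l : \sum_(j < l) s (a + j)%N <= (l%:R / N%:R + 1) * S.
Proof.
have S0 : 0 <= S by apply: sumr_ge0.
have hk k b : \sum_(j < k * N) s (b + j)%N = k%:R * S.
  elim: k b => [|k IH] b; first by rewrite mul0n big_ord0 mul0r.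
  rewrite mulSn big_split_ord /= sum_period.
  under eq_bigr do rewrite addnA.
  by rewrite IH -nat1r mulrDl mul1r.
apply: (@le_trans _ _ (\sum_(j < (l %/ N).+1 * N) s (a + j)%N)).
  have hl : (l <= (l %/ N).+1 * N)%N by rewrite ltnW // ltn_ceil.
  rewrite -(subnKC hl) big_split_ord /= lerDl; exact: sumr_ge0.
rewrite hk ler_wpM2r // -nat1r addrC lerD2r ler_pdivlMr ?ltr0n //.
by rewrite -natrM ler_nat leq_divM.
Qed.

End Window.

Section Unimodal.
Variables (N : nat) (s : nat -> R) (S : R).
Hypotheses (N0 : (0 < N)%N)
  (W : forall a l, \sum_(j < l) s (a + j)%N <= (l%:R / N%:R + 1) * S).

(** An increasing weight is a positive combination of indicators of final windows. In the costs
    [l / N + 1] of these windows the lengths add up to the sum of [b] and the ones to its maximum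
    [b m]. *)
Lemma sum_incr (b : nat -> R) m a : (forall j, (j < m)%N -> b j <= b j.+1) -> 0 <= b 0%N ->
  \sum_(j < m.+1) b j * s (a + j)%N <= ((\sum_(j < m.+1) b j) / N%:R + b m) * S.
Proof.
elim: m b a => [|m IH] b a bi b0.
  have := ler_wpM2l b0 (W a 1); rewrite !big_ord_recr !big_ord0 /= !add0r.
  by move: (b 0%N) (s _) (N%:R) => x y z; lra.
have -> : \sum_(j < m.+2) b j * s (a + j)%N
   = b 0%N * (\sum_(j < m.+2) s (a + j)%N)
     + \sum_(j < m.+1) (b j.+1 - b 0%N) * s (a.+1 + j)%N.
  have -> : \sum_(j < m.+1) (b j.+1 - b 0%N) * s (a.+1 + j)%N
     = \sum_(j < m.+2) (b j - b 0%N) * s (a + j)%N.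
    rewrite [RHS]big_ord_recl subrr mul0r add0r.
    by apply: eq_bigr => j _; rewrite /= /bump /= add1n addSnnS.
  by rewrite mulr_sumr -big_split /=; apply: eq_bigr => j _; ring.
have IH1 : \sum_(j < m.+1) (b j.+1 - b 0%N) * s (a.+1 + j)%N
    <= ((\sum_(j < m.+1) (b j.+1 - b 0%N)) / N%:R + (b m.+1 - b 0%N)) * S.
  apply: (IH (fun j => b j.+1 - b 0%N)) => [j jm|]; first by rewrite lerB // bi.
  by rewrite subr_ge0 bi.
have := ler_wpM2l b0 (W a m.+2).
have -> : ((\sum_(j < m.+2) b j) / N%:R + b m.+1) * S = b 0%N * ((m.+2%:R / N%:R + 1) * S) +
  ((\sum_(j < m.+1) (b j.+1 - b 0%N)) / N%:R + (b m.+1 - b 0%N)) * S.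
  rewrite big_ord_recl /= sumrB sumr_const card_ord -mulr_natl -natr1.
  by rewrite /bump /=; ring.
by lra.
Qed.

Lemma sum_decr (b : nat -> R) m a : (forall j, (j < m)%N -> b j.+1 <= b j) -> 0 <= b m ->
  \sum_(j < m.+1) b j * s (a + j)%N <= ((\sum_(j < m.+1) b j) / N%:R + b 0%N) * S.
Proof.
elim: m b => [|m IH] b bi b0.
  have := ler_wpM2l b0 (W a 1); rewrite !big_ord_recr !big_ord0 /= !add0r.
  by move: (b 0%N) (s _) (N%:R) => x y z; lra.
have -> : \sum_(j < m.+2) b j * s (a + j)%N
   = b m.+1 * (\sum_(j < m.+2) s (a + j)%N)
     + \sum_(j < m.+1) (b j - b m.+1) * s (a + j)%N.
  have -> : \sum_(j < m.+1) (b j - b m.+1) * s (a + j)%N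
     = \sum_(j < m.+2) (b j - b m.+1) * s (a + j)%N.
    by rewrite [RHS]big_ord_recr /= subrr mul0r addr0.
  by rewrite mulr_sumr -big_split /=; apply: eq_bigr => j _; ring.
have IH1 : \sum_(j < m.+1) (b j - b m.+1) * s (a + j)%N <= ((\sum_(j < m.+1) (b j - b m.+1)) /
  N%:R + (b 0%N - b m.+1)) * S.
  apply: (IH (fun j => b j - b m.+1)) => [j jm|].
    by rewrite lerB // bi // (ltn_trans jm).
  by rewrite subr_ge0 bi.
have := ler_wpM2l b0 (W a m.+2).
have -> : ((\sum_(j < m.+2) b j) / N%:R + b 0%N) * S = b m.+1 * ((m.+2%:R / N%:R + 1) * S) +
  ((\sum_(j < m.+1) (b j - b m.+1)) / N%:R + (b 0%N - b m.+1)) * S.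
  rewrite big_ord_recr /= sumrB sumr_const card_ord -mulr_natl -natr1.
  by ring.
by lra.
Qed.

End Unimodal.

End Sequences.

Section BinomialSums.
Variable (R : realFieldType).
Implicit Types (s : nat -> R).

(** Summation by parts moves the difference onto [b], whose total variation is at most its maximum;
    the boundary term costs another [b m * Y]. *)
Lemma tv_incr (b : nat -> R) s (Y : R) m a : (forall j, (j < m)%N -> b j <= b j.+1) ->
  0 <= b 0%N -> (forall j, `|s j| <= Y) ->
  `|\sum_(j < m.+1) b j * (s (a + j).+1 - s (a + j)%N)| <= 2 * b m * Y.
Proof.
move=> bi b0 sY.
have bm k : (k <= m)%N -> 0 <= b k.
  by elim: k => // k IH km; apply: le_trans (IH (ltnW km)) (bi _ km).
suff h k : (k <= m)%N ->
    `|\sum_(j < k.+1) b j * (s (a + j).+1 - s (a + j)%N) - b k * s (a + k).+1| <= b k * Y.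
  have := h m (leqnn m); have := sY (a + m).+1; have := bm m (leqnn m).
  set X := \sum_(j < _) _; move: (s _) (b m) => u v v0; rewrite !ler_norml.
  move=> /andP[u1 u2] /andP[X1 X2]; apply/andP; split; nra.
elim: k => [|k IH] km.
  rewrite big_ord_recr big_ord0 /= add0r addn0 mulrBr addrAC subrr sub0r normrN normrM.
  by rewrite ger0_norm // ler_wpM2l.
rewrite big_ord_recr /=; have := IH (ltnW km).
set X := \sum_(j < _) _; rewrite addnS => hX.
have -> : X + b k.+1 * (s (a + k).+2 - s (a + k).+1) - b k.+1 * s (a + k).+2
  = (X - b k * s (a + k).+1) + (b k - b k.+1) * s (a + k).+1 by ring.
apply: le_trans (ler_normD _ _) _; rewrite normrM (distrC (b k)) (@ger0_norm _ (b k.+1 - b k))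
  ?subr_ge0 ?bi //.
have : (b k.+1 - b k) * `|s (a + k).+1| <= (b k.+1 - b k) * Y.
  by rewrite ler_wpM2l // subr_ge0 bi.
have -> : b k.+1 * Y = b k * Y + (b k.+1 - b k) * Y by ring.
by move=> h; apply: (lerD hX h).
Qed.

Lemma tv_decr (b : nat -> R) s (Y : R) m a : (forall j, (j < m)%N -> b j.+1 <= b j) ->
  0 <= b m -> (forall j, `|s j| <= Y) ->
  `|\sum_(j < m.+1) b j * (s (a + j).+1 - s (a + j)%N)| <= 2 * b 0%N * Y.
Proof.
move=> bi b0 sY.
have b00 : 0 <= b 0%N.
  apply: (le_trans b0); move: bi; clear b0; elim: m => // m IH bi.
  by apply: le_trans (bi _ (ltnSn m)) (IH _) => j jm; apply: bi; rewrite (ltn_trans jm).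
suff h k : (k <= m)%N ->
    `|\sum_(j < k.+1) b j * (s (a + j).+1 - s (a + j)%N) - b k * s (a + k).+1|
      <= (2 * b 0%N - b k) * Y.
  have := h m (leqnn m); have := sY (a + m).+1; move: b0.
  set X := \sum_(j < _) _; move: (s _) (b m) => u v v0; rewrite !ler_norml.
  move=> /andP[u1 u2] /andP[X1 X2]; apply/andP; split; nra.
elim: k => [|k IH] km.
  rewrite big_ord_recr big_ord0 /= add0r addn0 mulrBr addrAC subrr sub0r normrN normrM.
  rewrite ger0_norm // (_ : 2 * b 0%N - b 0%N = b 0%N); last by ring.
  by rewrite ler_wpM2l.
rewrite big_ord_recr /=; have := IH (ltnW km).
set X := \sum_(j < _) _; rewrite addnS => hX.
have -> : X + b k.+1 * (s (a + k).+2 - s (a + k).+1) - b k.+1 * s (a + k).+2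
  = (X - b k * s (a + k).+1) + (b k - b k.+1) * s (a + k).+1 by ring.
apply: le_trans (ler_normD _ _) _; rewrite normrM (@ger0_norm _ (b k - b k.+1)) ?subr_ge0 ?bi //.
have : (b k - b k.+1) * `|s (a + k).+1| <= (b k - b k.+1) * Y.
  by rewrite ler_wpM2l // subr_ge0 bi.
have -> : (2 * b 0%N - b k.+1) * Y = (2 * b 0%N - b k) * Y + (b k - b k.+1) * Y by ring.
by move=> h; apply: (lerD hX h).
Qed.

Lemma geq_bin_half n j : (n./2 <= j)%N -> (j < n)%N -> ('C(n, j.+1) <= 'C(n, j))%N.
Proof.
move=> h jn; rewrite -(@bin_sub n j) ?(ltnW jn) // -(@bin_sub n j.+1) //.
have -> : (n - j = (n - j.+1).+1)%N by lia.
have [h2|h2] := ltnP (n - j.+1) n./2; first exact: leq_bin_half.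
have e : (n - j.+1 = n./2)%N by lia.
have e2 : ((n - j.+1).+1 = n - n./2)%N by lia.
by rewrite e2 e bin_sub //; lia.
Qed.

Section Split.
Variable n : nat.
Let m := n./2.
Let b j : R := 'C(n, j)%:R.

(** Binomial coefficients rise up to [n./2] and fall afterwards; each half contributes its own peak,
    hence the factor 2. *)
Lemma bin_sum_window N s (S : R) : (0 < N)%N ->
  (forall a l, \sum_(j < l) s (a + j)%N <= (l%:R / N%:R + 1) * S) ->
  \sum_(j < n.+1) b j * s j <= (2 ^+ n / N%:R + 2 * b m) * S.
Proof.
move=> N0 W; have S0 : 0 <= S by have := W 0%N 0%N; rewrite big_ord0 mul0r add0r mul1r.
have b0 j : 0 <= b j by exact: ler0n.
have h1 := @sum_incr _ N s S W b m 0 (fun j jm => _) (b0 0%N).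
have {}h1 : \sum_(j < m.+1) b j * s (0 + j)%N <= ((\sum_(j < m.+1) b j) / N%:R + b m) * S.
  by apply: sum_incr => // j jm; rewrite ler_nat leq_bin_half.
have bS : \sum_(j < n.+1) b j = 2 ^+ n.
  rewrite -natr_sum -natrX; congr _%:R.
  by rewrite -[2%N]/(1 + 1)%N expnDn; apply: eq_bigr => j _; rewrite !exp1n !muln1.
have [k nk] : exists k, n.+1 = (m.+1 + k)%N by exists (n - m)%N; rewrite /m; lia.
have sp (F : nat -> R) : \sum_(j < n.+1) F j = \sum_(j < m.+1) F j + \sum_(j < k) F (m.+1 + j)%N.
  by rewrite nk big_split_ord.
rewrite (sp (fun j => b j * s j)) -bS (sp b); case: k nk sp => [|k] nk _.
  rewrite !big_ord0 !addr0; apply: le_trans h1 _; rewrite ler_wpM2r // lerD2l.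
  by rewrite ler_peMl // ler1n.
have h2 : \sum_(j < k.+1) b (m.+1 + j)%N * s (m.+1 + j)%N
    <= ((\sum_(j < k.+1) b (m.+1 + j)%N) / N%:R + b (m.+1 + 0)%N) * S.
  apply: (@sum_decr _ N s S W (fun j => b (m.+1 + j)%N)) => // j jm.
  by rewrite ler_nat addnS geq_bin_half //; rewrite /m; lia.
have h3 : b (m.+1 + 0)%N <= b m.
  by rewrite addn0 ler_nat geq_bin_half // /m; lia.
apply: le_trans (lerD h1 h2) _; rewrite -mulrDl ler_wpM2r // mulrDl.
by move: h3; set x := b (_ + _)%N; lra.
Qed.

Lemma bin_sum_tv s (Y : R) : (forall j, `|s j| <= Y) ->
  `|\sum_(j < n.+1) b j * (s j.+1 - s j)| <= 4 * b m * Y.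
Proof.
move=> sY; have Y0 : 0 <= Y by apply: le_trans (sY 0%N).
have b0 j : 0 <= b j by exact: ler0n.
have h1 : `|\sum_(j < m.+1) b j * (s (0 + j).+1 - s (0 + j)%N)| <= 2 * b m * Y.
  by apply: tv_incr => // j jm; rewrite ler_nat leq_bin_half.
have [k nk] : exists k, n.+1 = (m.+1 + k)%N by exists (n - m)%N; rewrite /m; lia.
rewrite nk big_split_ord /=; apply: le_trans (ler_normD _ _) _.
case: k nk => [|k] nk.
  rewrite big_ord0 normr0 addr0; apply: le_trans h1 _; rewrite ler_wpM2r // ler_wpM2r //.
  by rewrite ler_nat.
have h2 : `|\sum_(j < k.+1) b (m.+1 + j)%N * (s (m.+1 + j).+1 - s (m.+1 + j)%N)|
    <= 2 * b (m.+1 + 0)%N * Y.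
  apply: (@tv_decr (fun j => b (m.+1 + j)%N)) => // j jm.
  by rewrite ler_nat addnS geq_bin_half //; rewrite /m; lia.
have h3 : b (m.+1 + 0)%N <= b m.
  by rewrite addn0 ler_nat geq_bin_half // /m; lia.
apply: le_trans (lerD h1 h2) _; rewrite -mulrDl ler_wpM2r //.
by move: h3; set x := b (_ + _)%N; lra.
Qed.

End Split.
End BinomialSums.

(** * The law of a symmetric walk on a line or a cycle *)

Section WalkKernel.
Variable (R : realFieldType).

(** The largest point probability after [n] symmetric steps, of order n^(-1/2). *)
Definition cbin n : R := 'C(n, n./2)%:R / 2 ^+ n.

Lemma cbin_ge0 n : 0 <= cbin n.
Proof. by rewrite divr_ge0 ?ler0n ?exprn_ge0. Qed.

Lemma cbin_sqr n : cbin n ^+ 2 * n.+1%:R <= 1.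
Proof.
rewrite /cbin expr_div_n mulrAC ler_pdivrMr ?exprn_gt0 // mul1r.
rewrite -exprM mulnC exprM -!natrX -natrM ler_nat; exact: leq_bin_central.
Qed.

Variable (V : zmodType).
Implicit Types (g : V -> R) (y x : V).

Lemma iter_avg0 n y g x : iter n (avg 0 y) g x =
  (\sum_(j < n.+1) 'C(n, j)%:R * g (x - y *+ n + (y + y) *+ j)) / 2 ^+ n.
Proof.
elim: n x => [|n IH] x.
  by rewrite big_ord_recr big_ord0 /= bin0 mulr0n subr0 mulr0n addr0 expr0; lra.
rewrite iterS /avg !IH (pascal_sum (fun j => g (x - y *+ n.+1 + (y + y) *+ j))).
have -> : \sum_(j < n.+1) 'C(n, j)%:R * g (x + y - y *+ n + (y + y) *+ j)
  = \sum_(j < n.+1) 'C(n, j)%:R * g (x - y *+ n.+1 + (y + y) *+ j.+1).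
  apply: eq_bigr => j _; congr (_ * g _); rewrite !mulrS opprD -!addrA; congr (x + _).
  by rewrite (addrCA (- (y *+ n)) y) addKr (addrCA (- (y *+ n)) y).
have -> : \sum_(j < n.+1) 'C(n, j)%:R * g (x - y - y *+ n + (y + y) *+ j)
  = \sum_(j < n.+1) 'C(n, j)%:R * g (x - y *+ n.+1 + (y + y) *+ j).
  by apply: eq_bigr => j _; rewrite mulrS opprD !addrA.
have : (2 ^+ n : R) != 0 by rewrite expf_neq0 // pnatr_eq0.
by rewrite exprS; move: (2 ^+ n) => z z0; field.
Qed.

(** Parity confines the walk to a lattice of spacing [y + y]. Wrapping the binomial law around the
    cycle gives each point at most a uniform share [1 / N] plus a multiple of the peak. *)
Lemma iter_avg0_le n y g x N : (0 < N)%N -> (y + y) *+ N = 0 -> (forall z, 0 <= g z) ->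
  iter n (avg 0 y) g x
    <= (N%:R^-1 + 2 * cbin n) * \sum_(t < N) g (x - y *+ n + (y + y) *+ t).
Proof.
move=> N0 yN g0; rewrite iter_avg0 ler_pdivrMr ?exprn_gt0 //.
set s := fun j : nat => g (x - y *+ n + (y + y) *+ j).
have sN j : s (j + N)%N = s j by rewrite /s mulrnDr yN addr0.
have W := sum_window N0 (fun j => g0 _) sN.
apply: le_trans (@bin_sum_window _ n N s (\sum_(t < N) s t) N0 W) _.
rewrite mulrAC ler_wpM2r //; first by apply: sumr_ge0 => j _; exact: g0.
have : (2 ^+ n : R) != 0 by rewrite expf_neq0 // pnatr_eq0.
have : (N%:R : R) != 0 by rewrite pnatr_eq0 -lt0n.
rewrite /cbin; move: (2 ^+ n) (N%:R) => z w w0 z0.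
by rewrite le_eqVlt; apply/orP; left; apply/eqP; field; rewrite ?z0 ?w0.
Qed.

(** The quotient is taken over the spacing [y + y] of the lattice that the walk visits, so it
    becomes a difference of consecutive terms and meets the total variation of a unimodal law. *)
Lemma iter_avg0_dquo n y g x (h Y : R) : 0 < h -> (forall z, `|g z| <= Y) ->
  `|iter n (avg 0 y) (dquo (y + y) h g) x| <= 4 * cbin n / h * Y.
Proof.
move=> h0 gY; rewrite iter_avg0.
set s := fun j : nat => g (x - y *+ n + (y + y) *+ j).
have -> : \sum_(j < n.+1) 'C(n, j)%:R * dquo (y + y) h g (x - y *+ n + (y + y) *+ j)
   = (\sum_(j < n.+1) 'C(n, j)%:R * (s j.+1 - s j)) / h.
  by rewrite mulr_suml; apply: eq_bigr => j _; rewrite /dquo /s mulrSr mulrA !addrA.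
rewrite !normrM !normfV (gtr0_norm h0) (ger0_norm (exprn_ge0 _ _)) //.
have := @bin_sum_tv R n s Y (fun j => gY _); set X := `| _ | => hX.
rewrite ler_pdivrMr ?exprn_gt0 // ler_pdivrMr //; apply: le_trans hX _.
have : (2 ^+ n : R) != 0 by rewrite expf_neq0 // pnatr_eq0.
rewrite /cbin; move: (2 ^+ n) => z z0.
by rewrite le_eqVlt; apply/orP; left; apply/eqP; field; rewrite ?z0 ?gt_eqF.
Qed.

End WalkKernel.

(** * The walk on the discrete torus *)

Section Torus.
Variables (R : realFieldType) (d k : nat).
Let N := k.*2.+3.

(* An odd number of points per direction: doubling is injective, so [n] steps of a symmetric
   walk spread over the whole cycle. *)
Definition grid := 'rV['I_(k.*2.+3)]_d.
Definition unit_vec (i : 'I_d) : grid := delta_mx 0 i.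

Lemma unit_vecE i j : unit_vec i 0 j = (j == i)%:R.
Proof. by rewrite mxE eqxx eq_sym. Qed.

Lemma unit_vec_order i : unit_vec i *+ N = 0.
Proof.
have N0 : (N%:R : 'I_(k.*2.+3)) = 0 by rewrite Zp_nat; apply/val_inj; rewrite /= modnn.
by apply/rowP => j; rewrite mulmxnE -mulr_natl N0 mul0r mxE.
Qed.

Lemma double_inj (s t : 'I_N) : (s + s)%N = (t + t)%N %[mod N] -> s = t.
Proof.
move=> h; apply/val_inj/eqP => /=.
have e : (2 * s == 2 * t %[mod N])%N by rewrite !mul2n -!addnn h.
have c : coprime N 2 by rewrite coprimen2 /N /= odd_double.
move: e; wlog st : s t {h} / (t <= s)%N => [W|].
  by case/orP: (leq_total s t) => st e; [rewrite eq_sym; apply: W => //; rewrite eq_sym | apply: W].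
rewrite eqn_mod_dvd ?leq_mul2l // -mulnBr Gauss_dvdr // -eqn_mod_dvd // !modn_small //.
Qed.

(** Directions are treated one at a time. The coordinates outside [r] have not moved, so the sum
    runs over the points that agree with [x] there. *)
Lemma iter_walk_le n (r : seq 'I_d) (G : grid -> R) x : uniq r ->
  (forall z, 0 <= G z) ->
  iter n (walk unit_vec (fun=> 0) r) G x
    <= (N%:R^-1 + 2 * cbin R n) ^+ size r
       * \sum_(z : grid | [forall i, (i \notin r) ==> (z 0 i == x 0 i)]) G z.
Proof.
set c := N%:R^-1 + _.
have c0 : 0 <= c by apply: addr_ge0; [rewrite invr_ge0 ler0n | rewrite mulr_ge0 ?ler0n ?cbin_ge0].
elim: r G x => [|i r IH] G x /=.
  move=> _ G0; have -> : iter n (walk unit_vec (fun=> 0) [::]) G = G by exact: iter_fix.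
  rewrite expr0 mul1r (bigD1 x) /=; first by rewrite lerDl sumr_ge0.
  by apply/forallP => j.
move=> /andP[ir ur] G0; rewrite (iter_walk_cons unit_vec i r).
have ma : markov (avg 0 (unit_vec i)) := markov_walk0 R unit_vec [:: i].
apply: le_trans (IH _ _ ur _) _.
  by move=> z; apply: markov_lb => //; exact: markov_iter.
rewrite exprSr -mulrA ler_wpM2l ?exprn_ge0 //.
set A := [pred z : grid | [forall j, (j \notin r) ==> (z 0 j == x 0 j)]].
pose phi (p : grid * 'I_N) := p.1 - unit_vec i *+ n + (unit_vec i + unit_vec i) *+ p.2.
have phiE p j : phi p 0 j = p.1 0 j + (if j == i then - n%:R + (p.2 + p.2)%:R else 0).
  rewrite !mxE !mulmxnE !mxE !eqxx /= eq_sym; case: eqP => _.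
    by rewrite addrA mulrnDl -mulrnDr.
  by rewrite mulr0n addr0 !mul0rn subr0 !addr0.
apply: (@le_trans _ _ (\sum_(z in A) c * \sum_(t : 'I_N) G (phi (z, t)))).
  apply: ler_sum => z _; apply: iter_avg0_le => //.
  by rewrite mulrnDl unit_vec_order addr0.
rewrite -mulr_sumr ler_wpM2l // pair_big_dep /=.
(* No point may be counted twice. Since [i] is not in [r], the starting points agree with [x] in
   coordinate [i], and the index of the position on the cycle is recovered from its double. *)
have inj : {in [set p : grid * 'I_N | p.1 \in A] &, injective phi}.
  move=> [z s] [w t]; rewrite !inE /= => /forallP hz /forallP hw e.
  have ej j : phi (z, s) 0 j = phi (w, t) 0 j by rewrite e.
  have zw : z = w.
    apply/rowP => j; have := ej j; rewrite !phiE /=.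
    case: eqP => [->|_ ]; last by rewrite !addr0.
    by have := hz i; have := hw i; rewrite ir /= => /eqP -> /eqP ->.
  congr (_, _) => //; have := ej i; rewrite !phiE /= zw eqxx => /addrI/addrI.
  move=> /(congr1 val); rewrite !Zp_nat /= => h; exact: double_inj.
rewrite (eq_bigl (fun p => p \in [set p : grid * 'I_N | p.1 \in A])); last first.
  by move=> p; rewrite !inE andbT.
rewrite -(big_imset (fun z => G z) inj) /=.
rewrite [leRHS](bigID (mem (phi @: [set p : grid * 'I_N | p.1 \in A]))) /=.
rewrite -[leLHS]addr0 lerD ?sumr_ge0 // le_eqVlt; apply/orP; left; apply/eqP.
apply: eq_bigl => z; case: imsetP => [[p]|]; last by rewrite andbF.
rewrite inE => /forallP hp ->; rewrite andbT; apply/esym/forallP => j.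
rewrite inE negb_or; apply/implyP => /andP[ji jr].
by rewrite phiE (negbTE ji) addr0; have := hp j; rewrite jr.
Qed.

Lemma iter_walk_le_sum n (r : seq 'I_d) (G : grid -> R) x : perm_eq r (enum 'I_d) ->
  (forall z, 0 <= G z) ->
  iter n (walk unit_vec (fun=> 0) r) G x
    <= (N%:R^-1 + 2 * cbin R n) ^+ d * \sum_z G z.
Proof.
move=> rP G0; have ur : uniq r by rewrite (perm_uniq rP) enum_uniq.
apply: le_trans (iter_walk_le n x ur G0) _.
rewrite (perm_size rP) size_enum_ord (eq_bigl xpredT) // => z.
by apply/forallP => j; rewrite (perm_mem rP) mem_enum.
Qed.

End Torus.

(** * Inequalities for real powers *)

Section RealPowers.
Variable R : realType.
Implicit Types (a b g p s t x y : R).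

Lemma powR_bernoulli s a : 0 <= s -> 0 < a < 1 -> s `^ a <= 1 - a + a * s.
Proof.
move=> s0 /andP[a0 a1].
have := @conjugate_powR R (s `^ a) 1 a^-1 (1 - a)^-1.
rewrite !invrK -powRrM divff ?gt_eqF // powRr1 // powR1 mulr1 mul1r => h.
have b0 : 0 < 1 - a by lra.
have := h (powR_ge0 _ _) ler01 _ _; rewrite !invr_gt0 => /(_ a0 b0).
by rewrite addrC subrK => /(_ erefl); rewrite addrC mulrC.
Qed.

Lemma powR_concave a x y : 0 < a < 1 -> 0 < x -> 0 <= y ->
  a * (x - y) * x `^ (a - 1) <= x `^ a - y `^ a.
Proof.
move=> a01 x0 y0.
have xa : 0 < x `^ a by exact: powR_gt0.
have xV : x^-1 `^ a = (x `^ a)^-1.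
  by rewrite -[x^-1]powR_inv1 ?(ltW x0) // -powRrM mulN1r powRN.
have := powR_bernoulli (divr_ge0 y0 (ltW x0)) a01.
rewrite powRM ?invr_ge0 ?(ltW x0) // xV ler_pdivrMr // => h.
rewrite powRB ?(gt_eqF x0) ?implybT // (powRr1 (ltW x0)).
have -> : a * (x - y) * (x `^ a / x) = (a - a * (y / x)) * x `^ a by field; rewrite gt_eqF.
by move: h; move: (x `^ a) (y `^ a) (y / x) => u v w; lra.
Qed.

(** A Riemann sum of the decreasing function t^(-a) at right end points stays below its integral;
    concavity of t^(1 - a) compares the two term by term. *)
Lemma sum_powR_le (tau T a : R) n : 0 < a < 1 -> 0 < tau -> n%:R * tau <= T ->
  \sum_(j < n) tau * (j.+1%:R * tau) `^ (- a) <= T `^ (1 - a) / (1 - a).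
Proof.
move=> /andP[a0 a1] tau0 nT.
have b01 : 0 < 1 - a < 1 by apply/andP; split; lra.
have b0 : 0 < 1 - a by lra.
apply: (@le_trans _ _ ((n%:R * tau) `^ (1 - a) / (1 - a))); last first.
  rewrite ler_pM2r ?invr_gt0 // ge0_ler_powR ?nnegrE ?(ltW b0) //.
    by rewrite mulr_ge0 ?ler0n ?ltW.
  by apply: le_trans nT; rewrite mulr_ge0 ?ler0n ?ltW.
rewrite ler_pdivlMr //; elim: n {nT} => [|n IH].
  by rewrite big_ord0 mul0r powR_ge0.
rewrite big_ord_recr /= mulrDl.
have x0 : 0 < n.+1%:R * tau by rewrite mulr_gt0 ?ltr0n.
have y0 : 0 <= n%:R * tau by rewrite mulr_ge0 ?ler0n ?ltW.
have := powR_concave b01 x0 y0.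
have -> : n.+1%:R * tau - n%:R * tau = tau by rewrite -natr1; ring.
have -> : 1 - a - 1 = - a by ring.
move: IH; move: (\sum_(_ < _) _) (_ `^ (1 - a)) (_ `^ (1 - a)) (_ `^ (- a)) => u v w z h1 h2.
by lra.
Qed.

Lemma le_add_powR s x p : 0 < s -> 0 <= x -> 1 <= p -> x <= s + s `^ (1 - p) * x `^ p.
Proof.
move=> s0 x0 p1; have [xs|sx] := leP x s.
  by rewrite (le_trans xs) // lerDl mulr_ge0 ?powR_ge0.
have {}x0 : 0 < x by apply: lt_trans sx.
apply: (@le_trans _ _ (s `^ (1 - p) * x `^ p)); last by rewrite lerDr ltW.
have -> : 1 - p = - (p - 1) by ring.
rewrite powRN ler_pdivlMl ?powR_gt0 //.
rewrite -(@mulr_powRB1 _ x p) ?(ltW x0) //; last by lra.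
rewrite mulrC ler_wpM2l ?(ltW x0) // ge0_ler_powR ?nnegrE ?subr_ge0 //; exact: ltW.
Qed.

End RealPowers.

(** * Heat kernel estimates uniform in the mesh *)

Section KernelBounds.
Variables (R : realType) (d : nat) (T : R).
Hypothesis T0 : 0 < T.

Definition step (k : nat) : R := (k.*2.+3%:R)^-1.
(* One symmetric step of length [h] in each direction adds [h ^+ 2 / 2] times the Laplacian. *)
Definition dtime k : R := step k ^+ 2 / 2.

Lemma step_gt0 k : 0 < step k.
Proof. by rewrite invr_gt0 ltr0n. Qed.

Lemma dtime_gt0 k : 0 < dtime k.
Proof. by rewrite divr_gt0 // exprn_gt0 // step_gt0. Qed.

Lemma cbin_le n k : cbin R n <= step k * (n.+1%:R * dtime k) `^ (- 2^-1).
Proof.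
set t := n.+1%:R * _.
have t0 : 0 < t by rewrite mulr_gt0 ?ltr0n ?dtime_gt0.
rewrite powRN powR12_sqrt ?(ltW t0) // ler_pdivlMr ?sqrtr_gt0 //.
rewrite -(@ler_pXn2r _ 2) ?nnegrE ?mulr_ge0 ?cbin_ge0 ?sqrtr_ge0 ?(ltW (step_gt0 _)) //.
rewrite exprMn sqr_sqrtr ?(ltW t0) // /t mulrA /dtime.
have := cbin_sqr R n; have := step_gt0 k.
have : 0 <= step k ^+ 2 by rewrite sqr_ge0.
move: (cbin R n ^+ 2 * _) (step k ^+ 2) => u v v0 _ u1; nra.
Qed.

Let kap : R := T `^ (2^-1) + 2.

(** The share [step k] of the wrapped law does not decay. Up to time [T] it is at most
    [T^(1/2) * t^(-1/2)] times the mesh, hence the constant [kap]. *)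
Lemma kernel_const_le n k : n.+1%:R * dtime k <= T ->
  step k + 2 * cbin R n <= kap * step k * (n.+1%:R * dtime k) `^ (- 2^-1).
Proof.
have := cbin_le n k; set t := n.+1%:R * _ => c1 tT.
have t0 : 0 < t by rewrite mulr_gt0 ?ltr0n ?dtime_gt0.
have : 1 <= T `^ (2^-1) * t `^ (- 2^-1).
  rewrite powRN ler_pdivlMr ?powR_gt0 // mul1r.
  by apply: ge0_ler_powR => //; rewrite ?nnegrE ?invr_ge0 //; exact: ltW.
rewrite /kap; have := step_gt0 k; move: c1.
move: (t `^ _) (T `^ _) (step k) (cbin R n) => u v s c; nra.
Qed.

Variables (p : R).
Hypothesis p1 : 1 <= p.

(* [G <= s + s^(1-p) G^p] for every [s > 0]; the choice of [s] balances the two terms. *)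
Lemma iter_walk_powR k n (r : seq 'I_d) (G : grid d k -> R) (gam : R) (x : grid d k) :
  perm_eq r (enum 'I_d) -> n.+1%:R * dtime k <= T -> 0 < gam ->
  (forall z, 0 <= G z) -> \sum_z G z `^ p <= k.*2.+3%:R ^+ d * gam `^ p ->
  iter n (walk (@unit_vec d k) (fun=> 0) r) G x
    <= (1 + kap ^+ d) * gam * (n.+1%:R * dtime k) `^ (- (d%:R / (2 * p))).
Proof.
move=> rP; set t := n.+1%:R * _ => tT gam0 G0 Gp.
have t0 : 0 < t by rewrite mulr_gt0 ?ltr0n ?dtime_gt0.
have p0 : 0 < p by exact: lt_le_trans ltr01 p1.
set s := gam * t `^ (- (d%:R / (2 * p))).
have s0 : 0 < s by rewrite mulr_gt0 ?powR_gt0.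
have mP := markov_iter n (markov_walk0 R (@unit_vec d k) r).
apply: (@le_trans _ _ (iter n (walk (@unit_vec d k) (fun=> 0) r)
   (fun z => s `^ (1 - p) * G z `^ p + s) x)).
  by apply: markov_le => // z; rewrite addrC le_add_powR.
rewrite markov_lin // markov_cst //.
have := iter_walk_le_sum n x rP (fun z => powR_ge0 (G z) p).
have := kernel_const_le tT; rewrite -/t -/(step k) => hk h1.
have kap0 : 0 <= kap by rewrite addr_ge0 ?powR_ge0.
have c0 : 0 <= step k + 2 * cbin R n.
  by rewrite addr_ge0 ?(ltW (step_gt0 _)) // mulr_ge0 ?cbin_ge0.
have {hk} hk : (step k + 2 * cbin R n) ^+ d <= (kap * step k * t `^ (- 2^-1)) ^+ d.
  by rewrite lerXn2r ?nnegrE // !mulr_ge0 ?powR_ge0 ?(ltW (step_gt0 _)).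
have N0 : (k.*2.+3%:R : R) != 0 by rewrite pnatr_eq0.
have {h1 hk} h1 : iter n (walk (@unit_vec d k) (fun=> 0) r) (fun z => G z `^ p) x
   <= kap ^+ d * t `^ (- (d%:R / 2)) * gam `^ p.
  apply: le_trans h1 _.
  apply: (@le_trans _ _ ((kap * step k * t `^ (- 2^-1)) ^+ d * (k.*2.+3%:R ^+ d * gam `^ p))).
    by apply: ler_pM => //; rewrite ?exprn_ge0 // sumr_ge0 // => z _; exact: powR_ge0.
  have e1 : step k ^+ d * k.*2.+3%:R ^+ d = 1 by rewrite -exprMn mulVf // expr1n.
  have e2 : (t `^ (- 2^-1)) ^+ d = t `^ (- (d%:R / 2)).
    by rewrite -powR_mulrn ?powR_ge0 // -powRrM mulNr mulrC.
  rewrite !exprMn e2.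
  have -> : kap ^+ d * step k ^+ d * t `^ (- (d%:R / 2)) * (k.*2.+3%:R ^+ d * gam `^ p)
    = (step k ^+ d * k.*2.+3%:R ^+ d) * (kap ^+ d * t `^ (- (d%:R / 2)) * gam `^ p) by ring.
  by rewrite e1 mul1r.
have -> : (1 + kap ^+ d) * gam * t `^ (- (d%:R / (2 * p))) = s + kap ^+ d * s.
  by rewrite /s; ring.
rewrite addrC lerD2l.
apply: (@le_trans _ _ (s `^ (1 - p) * (kap ^+ d * t `^ (- (d%:R / 2)) * gam `^ p))).
  by rewrite ler_wpM2l ?powR_ge0.
have sE : s `^ (1 - p) * s `^ p = s.
  by rewrite -powRD ?(gt_eqF s0) ?implybT // subrK (powRr1 (ltW s0)).
have wE : t `^ (- (d%:R / 2)) * gam `^ p = s `^ p.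
  rewrite /s powRM ?powR_ge0 ?(ltW gam0) // -powRrM mulrC; congr (_ * _ `^ _).
  by field; rewrite gt_eqF.
by rewrite -mulrA wE mulrCA sE.
Qed.

Lemma iter_walk_norm_powR k n (r : seq 'I_d) (G : grid d k -> R) (gam : R) (x : grid d k) :
  perm_eq r (enum 'I_d) -> n.+1%:R * dtime k <= T -> 0 < gam ->
  \sum_z `|G z| `^ p <= k.*2.+3%:R ^+ d * gam `^ p ->
  `|iter n (walk (@unit_vec d k) (fun=> 0) r) G x|
    <= (1 + kap ^+ d) * gam * (n.+1%:R * dtime k) `^ (- (d%:R / (2 * p))).
Proof.
move=> rP tT gam0 Gp.
have mP := markov_iter n (markov_walk0 R (@unit_vec d k) r).
by apply: le_trans (markov_norm mP _ _) _; apply: iter_walk_powR.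
Qed.

(* Half of the steps smooth [G], the other half absorb the difference quotient. *)
Lemma iter_walk_dquo_powR k n i (r : seq 'I_d) (G : grid d k -> R) (gam : R) (x : grid d k) :
  let th := 2^-1 + d%:R / (2 * p) in th <= 1 ->
  perm_eq (i :: r) (enum 'I_d) -> n.+1%:R * dtime k <= T -> 0 < gam ->
  \sum_z `|G z| `^ p <= k.*2.+3%:R ^+ d * gam `^ p ->
  `|iter n (walk (@unit_vec d k) (fun=> 0) (i :: r))
     (dquo (unit_vec k i + unit_vec k i) (2 * step k) G) x|
    <= 4 * (1 + kap ^+ d) * gam * (n.+1%:R * dtime k) `^ (- th).
Proof.
move=> th th1 rP tT gam0 Gp.
set P := walk _ _ _; set D := dquo _ _.
have mP : markov P := markov_walk0 R (@unit_vec d k) (i :: r).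
pose n1 := n./2; pose n2 := (n - n1)%N.
have nE : n = (n1 + n2)%N by rewrite /n2 subnKC // /n1 -divn2 leq_div.
have tau0 := dtime_gt0 k.
set t := n.+1%:R * _.
have t0 : 0 < t by rewrite mulr_gt0 ?ltr0n.
have ht m : (n <= m.*2.+1)%N -> t / 2 <= m.+1%:R * dtime k.
  move=> nm; rewrite ler_pdivrMr // -mulrA [_ * 2]mulrC mulrA ler_wpM2r ?(ltW tau0) //.
  by rewrite -natrM ler_nat muln2 doubleS.
have hn1 : (n <= n1.*2.+1)%N by clear -n1; rewrite /n1; lia.
have hn2 : (n <= n2.*2.+1)%N by clear -n2; rewrite /n2 /n1; lia.
set a := d%:R / (2 * p).
have a0 : 0 <= a by rewrite divr_ge0 ?ler0n // mulr_ge0 // ltW // (lt_le_trans ltr01).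
set Y := (1 + kap ^+ d) * gam * (t / 2) `^ (- a).
have kap0 : 0 <= kap by rewrite addr_ge0 ?powR_ge0.
have K0 : 0 <= (1 + kap ^+ d) * gam by rewrite mulr_ge0 ?addr_ge0 ?exprn_ge0 // ltW.
have t20 : 0 < t / 2 by rewrite divr_gt0.
have anti b x1 x2 : 0 <= b -> 0 < x1 -> x1 <= x2 -> x2 `^ (- b) <= x1 `^ (- b).
  move=> b0 x10 x12; have x20 : 0 < x2 by apply: lt_le_trans x12.
  rewrite !powRN lef_pV2 ?posrE ?powR_gt0 //.
  by apply: ge0_ler_powR; rewrite ?nnegrE // ltW.
have hY z : `|iter n2 P G z| <= Y.
  apply: le_trans (iter_walk_norm_powR z rP _ gam0 Gp) _.
    apply: le_trans tT; rewrite ler_wpM2r ?(ltW tau0) // ler_nat ltnS /n2; exact: leq_subr.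
  by rewrite ler_wpM2l // anti // ht.
have -> : iter n P (D G) x = iter n1 P (D (iter n2 P G)) x.
  rewrite {1}nE iterD; apply: markov_ext; first exact: markov_iter.
  by move=> z; rewrite markov_dquo //; exact: markov_iter.
rewrite (iter_walk_cons (@unit_vec d k) i r).
apply: le_trans (markov_norm_ub (markov_iter _ (markov_walk0 R (@unit_vec d k) r)) _ (c := 4 *
  cbin R n1 / (2 * step k) * Y) _) _.
  by move=> z; apply: iter_avg0_dquo => //; rewrite mulr_gt0 ?step_gt0.
have Y0 : 0 <= Y by rewrite mulr_ge0 ?powR_ge0.
apply: (@le_trans _ _ (2 * (t / 2) `^ (- 2^-1) * Y)).
  rewrite ler_wpM2r // ler_pdivrMr ?mulr_gt0 ?step_gt0 //.
  have := cbin_le n1 k; have : (n1.+1%:R * dtime k) `^ (- 2^-1) <= (t / 2) `^ (- 2^-1).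
    by rewrite anti ?invr_ge0 // ht.
  have := step_gt0 k; move: (cbin R n1) (_ `^ _) (_ `^ _) (step k) => u v w s; nra.
have e : (t / 2) `^ (- 2^-1) * (t / 2) `^ (- a) = (t / 2) `^ (- th).
  by rewrite -powRD ?(gt_eqF t20) ?implybT // /th; congr (_ `^ _); rewrite /a; ring.
have -> : 2 * (t / 2) `^ (- 2^-1) * Y = 2 * ((1 + kap ^+ d) * gam) * (t / 2) `^ (- th).
  by rewrite -e /Y; ring.
have -> : 4 * (1 + kap ^+ d) * gam * t `^ (- th) = 2 * ((1 + kap ^+ d) * gam) * (2 * t `^ (- th)).
  by ring.
(* Returning from [t / 2] to [t] costs 2^th, which is at most 2 because [th <= 1]. *)
rewrite ler_wpM2l ?(mulr_ge0 _ K0) //.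
rewrite powRM ?(ltW t0) ?invr_ge0 // mulrC ler_wpM2r ?powR_ge0 //.
rewrite -[2^-1]powR_inv1 // -powRrM mulN1r opprK -[leRHS](@powRr1 _ 2) //.
by rewrite ler_powR // ler1n.
Qed.

End KernelBounds.

Section DuhamelBounds.
Variables (R : realType) (d : nat) (T p : R).

(** The singularities in time are t^(-1/2 - d/(2p)) for the derivative of a source in L^p and
    t^(-d/p) for its square, a source in L^(p/2) with p/2 >= 1. Both exponents are below 1 because
    [d < p]. [K] precedes the mesh. *)
Theorem duhamel_bounds : 0 < T -> 2 <= p -> (0 < d)%N -> d%:R < p ->
  exists2 K : R, 0 < K & forall k n i (r : seq 'I_d) (g : nat -> grid d k -> R) (gam : R),
  perm_eq (i :: r) (enum 'I_d) -> n%:R * dtime R k <= T -> 0 < gam ->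
  (forall j, (0 < j <= n)%N -> \sum_z `|g j z| `^ p <= k.*2.+3%:R ^+ d * gam `^ p) ->
  let P := walk (@unit_vec d k) (fun=> 0) (i :: r) in
  forall x,
   `|duh P (dtime R k) (fun j => dquo (unit_vec k i + unit_vec k i) (2 * step R k) (g j)) n x| <=
     K * gam
   /\ duh P (dtime R k) (fun j z => g j z ^+ 2) n x <= K * gam ^+ 2.
Proof.
move=> T0 p2 d0 dp.
have p0 : 0 < p by apply: lt_le_trans p2.
have p1 : 1 <= p by apply: le_trans p2; rewrite ler1n.
have d0' : 0 < d%:R :> R by rewrite ltr0n.
pose th1 := 2^-1 + d%:R / (2 * p).
pose th2 := d%:R / p.
have th201 : 0 < th2 < 1 by rewrite divr_gt0 //= ltr_pdivrMr // mul1r.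
have th1E : th1 = 2^-1 + th2 / 2 by rewrite /th1 /th2; field; rewrite gt_eqF.
have th101 : 0 < th1 < 1 by move: th201; rewrite th1E => /andP[u v]; apply/andP; split; lra.
pose kap := T `^ (2^-1) + 2.
have kap0 : 0 <= kap by rewrite addr_ge0 ?powR_ge0.
have C0 : 0 < 1 + kap ^+ d by rewrite ltr_wpDr ?exprn_ge0.
pose K1 := 4 * (1 + kap ^+ d) * (T `^ (1 - th1) / (1 - th1)).
pose K2 := (1 + kap ^+ d) * (T `^ (1 - th2) / (1 - th2)).
have K10 : 0 < K1.
  by rewrite !mulr_gt0 ?powR_gt0 ?invr_gt0 ?subr_gt0 //; case/andP: th101.
have K20 : 0 < K2.
  by rewrite !mulr_gt0 ?powR_gt0 ?invr_gt0 ?subr_gt0 //; case/andP: th201.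
exists (K1 + K2); first exact: addr_gt0.
move=> k n i r g gam rP nT gam0 gp P x.
have mP : markov P := markov_walk0 R (@unit_vec d k) (i :: r).
have tau0 := dtime_gt0 R k.
have jT (j : 'I_n) : j.+1%:R * dtime R k <= T.
  by apply: le_trans nT; rewrite ler_wpM2r ?(ltW tau0) // ler_nat.
have gj (j : 'I_n) : \sum_z `|g (n - j)%N z| `^ p <= k.*2.+3%:R ^+ d * gam `^ p.
  by apply: gp; rewrite subn_gt0 ltn_ord leq_subr.
rewrite !duh_sum //; split.
  apply: (@le_trans _ _ (K1 * gam)); last by rewrite ler_wpM2r ?(ltW gam0) // lerDl ltW.
  apply: le_trans (ler_norm_sum _ _ _) _.
  apply: (@le_trans _ _ (\sum_(j < n) 4 * (1 + kap ^+ d) * gam * (dtime R k * (j.+1%:R * dtime R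
    k) `^ (- th1)))).
    apply: ler_sum => j _; rewrite normrM (gtr0_norm tau0) [leRHS]mulrCA.
    rewrite ler_wpM2l ?(ltW tau0) //.
    apply: iter_walk_dquo_powR => //; by case/andP: th101 => _ /ltW.
  rewrite -mulr_sumr; have := sum_powR_le th101 tau0 nT.
  rewrite /K1; set A := \sum_(_ < _) _; set B := _ / _ => AB.
  rewrite [leRHS]mulrAC ler_wpM2l //; apply: mulr_ge0; last exact: ltW.
  by apply: mulr_ge0; last exact: ltW.
apply: (@le_trans _ _ (K2 * gam ^+ 2)); last by rewrite ler_wpM2r ?exprn_ge0 ?(ltW gam0) // lerDr
  ltW.
apply: (@le_trans _ _ (\sum_(j < n) (1 + kap ^+ d) * gam ^+ 2 * (dtime R k * (j.+1%:R * dtime R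
  k) `^ (- th2)))).
  apply: ler_sum => j _; rewrite [leRHS]mulrCA ler_wpM2l ?(ltW tau0) //.
  have -> : th2 = d%:R / (2 * (p / 2)) by rewrite /th2; field; rewrite gt_eqF.
  apply: iter_walk_powR => //.
  - by rewrite ler_pdivlMr // mul1r.
  - by rewrite exprn_gt0.
  - by move=> z; rewrite sqr_ge0.
  - have sqp (y : R) : 0 <= y -> (y ^+ 2) `^ (p / 2) = y `^ p.
      by move=> y0; rewrite -powR_mulrn // -powRrM mulrC divfK.
    rewrite sqp ?(ltW gam0) //; under eq_bigr do rewrite -real_normK ?num_real // sqp //.
    exact: gj.
rewrite -mulr_sumr; have := sum_powR_le th201 tau0 nT.
rewrite /K2; set A := \sum_(_ < _) _; set B := _ / _ => AB.
by rewrite [leRHS]mulrAC ler_wpM2l // mulr_ge0 ?exprn_ge0 ?(ltW C0) ?(ltW gam0).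
Qed.

End DuhamelBounds.

(** * The exponential barrier *)

Section DuhamelTheory.
Variables (R : realFieldType) (V : zmodType).
Variables (P : (V -> R) -> V -> R) (mP : markov P) (tau : R) (tau0 : 0 <= tau).
Implicit Types g : nat -> V -> R.
Local Notation duh := (duh P tau).

Lemma duh_le g1 g2 n x : (forall j z, (0 < j <= n)%N -> g1 j z <= g2 j z) ->
  duh g1 n x <= duh g2 n x.
Proof.
elim: n x => //= n IH x h; apply: lerD; last by rewrite ler_wpM2l // h /=.
apply: markov_le => // z; apply: IH => j y /andP[j0 jn]; apply: h.
by rewrite j0 ltnW.
Qed.

Lemma duh_ext g1 g2 n x : (forall j z, (0 < j <= n)%N -> g1 j z = g2 j z) ->
  duh g1 n x = duh g2 n x.
Proof. by move=> h; apply/le_anti/andP; split; apply: duh_le => j z /h ->. Qed.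

Lemma duh_lin a g1 g2 n x :
  duh (fun j z => a * g1 j z + g2 j z) n x = a * duh g1 n x + duh g2 n x.
Proof.
elim: n x => /= [|n IH] x; first by rewrite mulr0 addr0.
rewrite (markov_ext mP _ IH) markov_lin //; ring.
Qed.

Lemma duh0 n x : duh (fun _ _ => 0) n x = 0.
Proof.
elim: n x => //= n IH x.
by rewrite (markov_ext mP _ IH) markov_cst // mulr0 addr0.
Qed.

Lemma duhZ a g n x : duh (fun j z => a * g j z) n x = a * duh g n x.
Proof.
rewrite -[RHS]addr0 -(duh0 n x) -duh_lin.
by apply: duh_ext => j z _; rewrite addr0.
Qed.

Lemma duh_ub g c n x : (forall j z, (0 < j <= n)%N -> g j z <= c) ->
  duh g n x <= n%:R * tau * c.
Proof.
elim: n x => /= [|n IH] x h; first by rewrite !mul0r.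
rewrite -natr1 !mulrDl mul1r; apply: lerD; last by rewrite ler_wpM2l // h /=.
apply: markov_ub => // z; apply: IH => j y /andP[j0 jn]; apply: h.
by rewrite j0 ltnW.
Qed.

Lemma duh_shift g y n x : duh (fun j z => g j (z + y)) n x = duh g n (x + y).
Proof.
elim: n x => //= n IH x; congr (_ + _).
by rewrite (markov_ext mP _ IH) markov_shift.
Qed.

Lemma duh_norm_mul (g1 g2 : nat -> V -> R) s n x : 0 < s ->
  `|duh (fun j z => g1 j z * g2 j z) n x|
    <= s / 2 * duh (fun j z => g1 j z ^+ 2) n x + (s^-1 / 2) * duh (fun j z => g2 j z ^+ 2) n x.
Proof.
move=> s0; have key (u v : R) : `|u * v| <= s / 2 * u ^+ 2 + s^-1 / 2 * v ^+ 2.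
  have h1 : 0 <= s^-1 / 2 * (s * u - v) ^+ 2.
    by rewrite mulr_ge0 ?sqr_ge0 // divr_ge0 // invr_ge0 ltW.
  have h2 : 0 <= s^-1 / 2 * (s * u + v) ^+ 2.
    by rewrite mulr_ge0 ?sqr_ge0 // divr_ge0 // invr_ge0 ltW.
  have e1 : s^-1 / 2 * (s * u - v) ^+ 2 = s / 2 * u ^+ 2 + s^-1 / 2 * v ^+ 2 - u * v.
    by field; rewrite gt_eqF.
  have e2 : s^-1 / 2 * (s * u + v) ^+ 2 = s / 2 * u ^+ 2 + s^-1 / 2 * v ^+ 2 + u * v.
    by field; rewrite gt_eqF.
  rewrite e1 in h1; rewrite e2 in h2; move: h1 h2.
  rewrite ler_norml; move: (s / 2 * _ + _) (u * v) => A B h1 h2; lra.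
rewrite -(duhZ (s^-1 / 2)) -duh_lin ler_norml; apply/andP; split.
  rewrite lerNl -mulN1r -duhZ; apply: duh_le => j z _; rewrite mulN1r.
  by apply: le_trans (key (g1 j z) (g2 j z)); rewrite -normrN ler_norm.
by apply: duh_le => j z _; apply: le_trans (key (g1 j z) (g2 j z)); rewrite ler_norm.
Qed.

End DuhamelTheory.

Section Barrier.
Variables (R : realType) (d k : nat) (i : 'I_d) (r : seq 'I_d).
Local Notation P := (walk (@unit_vec d k) (fun=> 0 : R) (i :: r)).
Local Notation tau := (dtime R k).
Local Notation E := (unit_vec k i + unit_vec k i).
Local Notation D := (dquo E (2 * step R k)).

Let mP : markov P := markov_walk0 R (@unit_vec d k) (i :: r).
Let tau0 : 0 <= tau := ltW (dtime_gt0 R k).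

Variable f : nat -> grid d k -> R.

(** The function Phi, with [n] counting steps back from the final time. The zeroth-order term is a
    factor rather than a summand, so that the logarithm splits it off. *)
Fixpoint barrier n x : R :=
  if n is n'.+1 then (1 + tau * D (f n) x) * P (barrier n') x else 1.

Let Pi j : grid d k -> R := P (barrier j.-1).
Let W j : grid d k -> R := variance P (barrier j.-1).

Lemma barrier_duh n x : barrier n x = 1 + duh P tau (fun j z => D (f j) z * Pi j z) n x.
Proof.
elim: n x => [|n IH] x; first by rewrite addr0.
have e : Pi n.+1 x = 1 + P (duh P tau (fun j z => D (f j) z * Pi j z) n) x.
  by rewrite /Pi -pred_Sn (markov_ext mP _ IH) markovD // markov_cst.
have -> : barrier n.+1 x = Pi n.+1 x + tau * (D (f n.+1) x * Pi n.+1 x).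
  by rewrite mulrA -[X in X + _]mul1r -mulrDl.
by rewrite {1}e -addrA.
Qed.

(** The energy identity: squaring doubles the potential, and each average loses its variance. The
    variance is already of order [tau], so it is summed with weight 1. *)
Lemma barrier_sqr n x : barrier n x ^+ 2 = 1
  + duh P tau (fun j z => (2 * D (f j) z + tau * D (f j) z ^+ 2) * Pi j z ^+ 2) n x
  - duh P 1 W n x.
Proof.
elim: n x => [|n IH] x; first by rewrite /= subr0 addr0 expr1n.
have e : Pi n.+1 x ^+ 2 = 1 + P (duh P tau (fun j z => (2 * D (f j) z + tau * D (f j) z ^+ 2) *
  Pi j z ^+ 2) n) x - P (duh P 1 W n) x - W n.+1 x.
  rewrite /W /variance /Pi -pred_Sn (markov_ext mP x IH) markovB // markovD // markov_cst //.
  by ring.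
have -> : barrier n.+1 x = (1 + tau * D (f n.+1) x) * Pi n.+1 x by [].
rewrite exprMn.
have -> : (1 + tau * D (f n.+1) x) ^+ 2 * Pi n.+1 x ^+ 2 = Pi n.+1 x ^+ 2 + tau * ((2 * D (f
  n.+1) x + tau * D (f n.+1) x ^+ 2) * Pi n.+1 x ^+ 2) by ring.
set F := fun (j : nat) z => _ in e *.
have -> : duh P tau F n.+1 x = P (duh P tau F n) x + tau * F n.+1 x by [].
have -> : duh P 1 W n.+1 x = P (duh P 1 W n) x + 1 * W n.+1 x by [].
rewrite {1}e -/(F n.+1 x); move: (P _ x) (P _ x) (W _ _) (F _ _) => a b c u.
by ring.
Qed.

(** Since [tau / (2 * step)^2 = 1/8] on every mesh, variances summed with weight 1 control squared
    quotients summed with weight [tau]. *)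
Lemma dquo_barrier n x :
  duh P tau (fun j z => D (Pi j) z ^+ 2) n x
    <= 4^-1 * (duh P 1 W n x + duh P 1 W n (x + E)).
Proof.
rewrite -duh_shift //.
have -> : duh P 1 W n x + duh P 1 (fun j z => W j (z + E)) n x
   = duh P 1 (fun j z => 1 * W j z + W j (z + E)) n x by rewrite duh_lin // mul1r.
rewrite -duhZ //.
have -> : duh P tau (fun j z => D (Pi j) z ^+ 2) n x
  = duh P 1 (fun j z => tau * D (Pi j) z ^+ 2) n x.
  elim: n x => //= n IH x; rewrite mul1r; congr (_ + _).
  exact: (markov_ext mP x IH).
apply: duh_le => // j z _; rewrite mul1r /D /dquo expr_div_n.
have := sqr_diff_walk (barrier j.-1) z (erefl P).
rewrite -/(Pi j) -/(W j); have h0 := step_gt0 R k.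
have -> : tau * ((Pi j (z + E) - Pi j z) ^+ 2 / (2 * step R k) ^+ 2) = 8^-1 * (Pi j (z + E) - Pi
  j z) ^+ 2.
  by rewrite /dtime; field; rewrite gt_eqF.
by move: (_ ^+ 2) (W j z) (W j _) => u v w; lra.
Qed.

Lemma dquoM (g1 g2 : grid d k -> R) z :
  D g1 z * g2 z = D (fun y => g1 y * g2 y) z - g1 (z + E) * D g2 z.
Proof. by rewrite /dquo; ring. Qed.

(** [HD] allows every factor [w] bounded by 1 because the barrier itself will be that factor: a
    bound in L^p does not see it. [Q] is not uniform in the data and occurs only in [QT], which
    makes the terms quadratic in [tau * D f] small. *)
Variables (n : nat) (del Q T : R).
Hypotheses (del0 : 0 < del) (del1 : del <= 20^-1)
  (HD : forall w : nat -> grid d k -> R, (forall j z, (0 < j <= n)%N -> `|w j z| <= 1) ->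
     forall x, `|duh P tau (fun j => D (fun z => f j z * w j z)) n x| <= del)
  (HS : forall x, duh P tau (fun j z => f j (z + E) ^+ 2) n x <= del ^+ 2)
  (fQ : forall j z, (0 < j <= n)%N -> `|D (f j) z| <= Q)
  (nT : n%:R * tau <= T) (QT : 9 * T * (tau * Q ^+ 2) <= 1).

(* Summing the identity for [Phi^2] shows that the total variance of the walk along [Phi] is at
   most [3]; since [(D f) Pi = D (f Pi) - f(. + E) D Pi] with [Pi = P Phi], the variance then
   bounds [D Pi] in the Duhamel formula for [Phi - 1]. *)
Lemma barrier_step : (forall j x, (j < n)%N -> `|barrier j x| <= 3 / 2) ->
  forall x, `|barrier n x - 1| <= 2^-1.
Proof.
move=> hb.
have T0 : 0 <= T by apply: le_trans nT; rewrite mulr_ge0.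
have Pi32 j z : (0 < j <= n)%N -> `|Pi j z| <= 3 / 2.
  move=> /andP[j0 jn]; apply: markov_norm_ub => // y; apply: hb.
  by rewrite -(prednK j0) in jn.
have HD' (c : R) (w : nat -> grid d k -> R) : 0 < c -> (forall j z, (0 < j <= n)%N -> `|w j z| <=
  c) ->
     forall x, `|duh P tau (fun j => D (fun z => f j z * w j z)) n x| <= c * del.
  move=> c0 wc x; have := HD (w := fun j z => w j z / c) _ x.
  have -> : duh P tau (fun j => D (fun z => f j z * (w j z / c))) n x = c^-1 * duh P tau (fun j
    => D (fun z => f j z * w j z)) n x.
    rewrite -duhZ //; apply: duh_ext => // j z _; rewrite /dquo; ring.
  rewrite normrM gtr0_norm ?invr_gt0 // ler_pdivrMl // => h; apply: h => j z /wc jz.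
  by rewrite normrM normfV (gtr0_norm c0) ler_pdivrMr // mul1r.
pose sf j z := f j (z + E).
(* The bound on [D Pi] at [x] involves the variances at [x] and at [x + E], so it closes only at a
   point where their sum over time is largest. *)
have [x1 hx1] : exists x1, forall x, duh P 1 W n x <= duh P 1 W n x1.
  by case: (@arg_maxP _ _ _ (0 : grid d k) xpredT (duh P 1 W n) isT) => y _ hy; exists y => x;
    apply: hy.
set B := duh P 1 W n x1 in hx1.
have B0 : 0 <= B.
  rewrite -[leLHS](@duh0 _ _ P mP 1 n x1); apply: duh_le => // j z _.
  by rewrite subr_ge0 markov_sqr.
have DPi x : duh P tau (fun j z => D (Pi j) z ^+ 2) n x <= B / 2.
  apply: le_trans (dquo_barrier n x) _; have := hx1 x; have := hx1 (x + E); lra.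
have cross (s : R) x : 0 < s -> `|duh P tau (fun j z => sf j z * D (Pi j) z) n x| <= s / 2 * del
  ^+ 2 + s^-1 / 2 * (B / 2).
  move=> s0; apply: le_trans (duh_norm_mul mP tau0 sf (fun j => D (Pi j)) n x s0) _.
  apply: lerD; rewrite ler_wpM2l //; first by rewrite divr_ge0 // ltW.
  by rewrite divr_ge0 // invr_ge0 ltW.
have B3 : B <= 3.
  have := barrier_sqr n x1; rewrite -/B => e.
  have h1 : B <= 1 + duh P tau (fun j z => (2 * D (f j) z + tau * D (f j) z ^+ 2) * Pi j z ^+ 2)
    n x1.
    by have := sqr_ge0 (barrier n x1); lra.
  have h3 : `|duh P tau (fun j => D (fun z => f j z * Pi j z ^+ 2)) n x1| <= (9 / 4) * del.
    apply: (HD' (9 / 4) (fun j z => Pi j z ^+ 2)) => // j z /(Pi32 _ z) h.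
    by rewrite normrX; move: h (normr_ge0 (Pi j z)); move: (`|_|) => u; nra.
  (* The sum of two values of [Pi] has square at most 9. Young's inequality with weight 9 then
     leaves [B / 4]; doubled in the energy identity it is [B / 2], which the left side absorbs. *)
  have h4 : `|duh P tau (fun j z => sf j z * D (Pi j) z * (Pi j z + Pi j (z + E))) n x1|
      <= 9 / 2 * del ^+ 2 + 4^-1 * B.
    rewrite (_ : duh _ _ _ _ _ = duh P tau (fun j z => sf j z * (D (Pi j) z * (Pi j z + Pi j (z +
      E)))) n x1); last first.
      by apply: (duh_ext mP tau0) => j z _; rewrite -[LHS]mulrA.
    apply: le_trans (duh_norm_mul mP tau0 sf _ n x1 (s := 9) _) _ => //.
    have hs := HS x1.
    have hq : duh P tau (fun j z => (D (Pi j) z * (Pi j z + Pi j (z + E))) ^+ 2) n x1 <= 9 * (B /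
      2).
      apply: (@le_trans _ _ (9 * duh P tau (fun j z => D (Pi j) z ^+ 2) n x1)); last by rewrite
        ler_wpM2l.
      rewrite -duhZ //; apply: duh_le => // j z jn; rewrite exprMn mulrC ler_wpM2r ?sqr_ge0 //.
      have := Pi32 j z jn; have := Pi32 j (z + E) jn; rewrite !ler_norml => /andP[u1 u2] /andP[v1
        v2].
      nra.
    have := hs; rewrite -/(sf _ _); move: hq; move: (duh _ _ _ _ _) (duh _ _ _ _ _) => u v; lra.
  have h5 : duh P tau (fun j z => tau * D (f j) z ^+ 2 * Pi j z ^+ 2) n x1 <= 4^-1.
    apply: (@le_trans _ _ (n%:R * tau * (tau * Q ^+ 2 * (9 / 4)))).
      apply: duh_ub => // j z jn; apply: ler_pM; [exact: mulr_ge0 (sqr_ge0 _) | exact: sqr_ge0 |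
        | ].
        rewrite ler_wpM2l // -[leLHS]real_normK ?num_real //.
        by rewrite ler_pXn2r ?nnegrE ?fQ // (le_trans _ (fQ z jn)).
      have := Pi32 j z jn; rewrite ler_norml => /andP[u1 u2]; nra.
    apply: (@le_trans _ _ (T * (tau * Q ^+ 2 * (9 / 4)))).
      rewrite ler_wpM2r //; apply: mulr_ge0; last lra.
      exact: mulr_ge0 (sqr_ge0 _).
    move: QT; set X := tau * _ => hX; lra.
  set X := duh P tau (fun j => D (fun z => f j z * Pi j z ^+ 2)) n x1 in h3.
  set Y := duh P tau (fun j z => sf j z * D (Pi j) z * (Pi j z + Pi j (z + E))) n x1 in h4.
  set Z := duh P tau (fun j z => tau * D (f j) z ^+ 2 * Pi j z ^+ 2) n x1 in h5.
  have h2 : duh P tau (fun j z => (2 * D (f j) z + tau * D (f j) z ^+ 2) * Pi j z ^+ 2) n x1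
     = 2 * (duh P tau (fun j => D (fun z => f j z * Pi j z ^+ 2)) n x1
          - duh P tau (fun j z => sf j z * D (Pi j) z * (Pi j z + Pi j (z + E))) n x1)
       + duh P tau (fun j z => tau * D (f j) z ^+ 2 * Pi j z ^+ 2) n x1.
    have -> (a b : R) : a - b = -1 * b + a by ring.
    rewrite -duh_lin // -duh_lin //; apply: duh_ext => // j z _.
    by rewrite /sf /dquo; ring.
  have d2 : del ^+ 2 <= 20^-1 * 20^-1.
    by rewrite expr2; apply: ler_pM => //; exact: ltW.
  (* For [del] at most 1/20 this reads B/2 <= 1 + 9/40 + 9/400 + 1/4 < 3/2. *)
  have arith (b a e2 X' Y' Z' : R) : b <= 1 + (2 * (X' - Y') + Z') -> a <= 20^-1 ->
      e2 <= 20^-1 * 20^-1 -> X' <= 9 / 4 * a -> - (9 / 2 * e2 + 4^-1 * b) <= Y' ->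
      Z' <= 4^-1 -> b <= 3 by lra.
  rewrite h2 in h1; move: h3 h4; rewrite !ler_norml => /andP[_ h3] /andP[h4 _].
  exact: arith h1 del1 d2 h3 h4 h5.
move=> x; rewrite barrier_duh addrAC subrr add0r.
have -> : duh P tau (fun j z => D (f j) z * Pi j z) n x =
  -1 * duh P tau (fun j z => sf j z * D (Pi j) z) n x + duh P tau (fun j => D (fun z => f j z *
    Pi j z)) n x.
  by rewrite -duh_lin //; apply: duh_ext => // j z _; rewrite dquoM /sf; ring.
have c0 : 0 < 3 / 2 :> R by lra.
have h1 := HD' (3 / 2) Pi c0 Pi32 x.
(* The weight [del^-1] makes both terms of order [del]. With [B <= 3] the total is (3/2 + 1/2 + 3/4)
   del, well below 1/2. *)
have h2 := cross del^-1 x; rewrite invr_gt0 del0 invrK in h2; have {}h2 := h2 isT.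
move: h1 h2; have -> : del^-1 / 2 * del ^+ 2 = del / 2 by field; rewrite gt_eqF.
rewrite !ler_norml => /andP[h1 h1'] /andP[h2 h2'].
have : del / 2 * (B / 2) <= del / 2 * (3 / 2) by rewrite ler_wpM2l ?divr_ge0 ?(ltW del0) //
  ler_wpM2r.
move=> h3.
have arith (e w u v : R) : e <= 20^-1 -> w <= e / 2 * (3 / 2) -> - (3 / 2 * e) <= v -> v <= 3 / 2
  * e ->
  - (e / 2 + w) <= u -> u <= e / 2 + w -> - 2^-1 <= -1 * u + v <= 2^-1.
  by move=> *; apply/andP; split; lra.
exact: arith del1 h3 h1 h1' h2 h2'.
Qed.

End Barrier.

Section Gibbs.
Variables (R : realType) (V : zmodType).

Lemma ln_leB1 (z : R) : 0 < z -> ln z <= z - 1.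
Proof.
by move=> z0; rewrite -[z in leLHS](addrNK 1) addrC le_ln1Dx // ltrBrDr addrC subrr.
Qed.

(* Gibbs' variational inequality: the relative entropy of the biased step is at most [th ^+ 2]. *)
Lemma avg_ln (th : R) y (g : V -> R) x : -1 < th < 1 -> (forall z, 0 < g z) ->
  avg th y (fun z => ln (g z)) x <= ln (avg 0 y g x) + th ^+ 2.
Proof.
move=> /andP[th1 th2] g0; rewrite /avg addr0 subr0 /=.
set a := g (x + y); set b := g (x - y).
have a0 : 0 < a := g0 _; have b0 : 0 < b := g0 _.
set m := 1 / 2 * a + 1 / 2 * b.
have m0 : 0 < m by rewrite /m; lra.
have t1 : 0 < 1 + th by lra.
have t2 : 0 < 1 - th by lra.
(* [s] is [1 + th] or [1 - th], the density of the biased step against the symmetric one. The bound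
   [ln z <= z - 1] is applied to [c / (s * m)], whose biased mean is 1, and to [s], for which that
   of [s - 1] is [th^2]. *)
have key c s : 0 < c -> 0 < s -> ln c <= c / (s * m) - 1 + (s - 1) + ln m.
  move=> c0 s0; have sm0 : 0 < s * m by exact: mulr_gt0.
  have -> : ln c = ln (c / (s * m)) + (ln s + ln m).
    by rewrite -lnM ?posrE // -lnM ?posrE ?divr_gt0 // divfK // gt_eqF.
  have := ln_leB1 (divr_gt0 c0 sm0); have := ln_leB1 s0; lra.
have := key a _ a0 t1; have := key b _ b0 t2 => kb ka.
have e : (1 + th) / 2 * (a / ((1 + th) * m)) + (1 - th) / 2 * (b / ((1 - th) * m)) = 1.
  rewrite /m; field; rewrite !gt_eqF //=; lra.
have ha : 0 < (1 + th) / 2 by lra.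
have hb : 0 < (1 - th) / 2 by lra.
have arith (t u v w A B : R) : (1 + t) / 2 * A + (1 - t) / 2 * B = 1 ->
    (1 + t) / 2 * u <= (1 + t) / 2 * (A - 1 + (1 + t - 1) + w) ->
    (1 - t) / 2 * v <= (1 - t) / 2 * (B - 1 + (1 - t - 1) + w) ->
    (1 + t) / 2 * u + (1 - t) / 2 * v <= w + t ^+ 2.
  by move=> *; lra.
exact: arith e (ler_wpM2l (ltW ha) ka) (ler_wpM2l (ltW hb) kb).
Qed.

(** The discrete completion of the square: on logarithms the drift can be removed at a price
    quadratic in the bias, whatever the gradient of [g]. *)
Lemma walk_ln (I : Type) (e : I -> V) (th : I -> R) (r : seq I) (g : V -> R) x :
  (forall j, -1 < th j < 1) -> (forall z, 0 < g z) ->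
  walk e th r (fun z => ln (g z)) x
    <= ln (walk e (fun=> 0) r g x) + \sum_(j <- r) th j ^+ 2.
Proof.
move=> th1; elim: r g => [|j r IH] g g0 /=; first by rewrite big_nil addr0.
have mw : markov (walk e th r).
  by apply: markov_walk => l; have /andP[u v] := th1 l; rewrite !ltW.
have ma : markov (avg 0 (e j)) := markov_walk0 R e [:: j].
have a0 z : 0 < avg 0 (e j) g z.
  by rewrite /avg addr0 subr0 addr_gt0 // mulr_gt0 // divr_gt0.
have h : walk e th r (avg (th j) (e j) (fun z => ln (g z))) x <= walk e th r (fun z => ln (avg 0
  (e j) g z) + th j ^+ 2) x.
  by apply: markov_le => // z; apply: avg_ln.
apply: le_trans h _; rewrite markovD // markov_cst // big_cons.
by have := IH _ a0; move: (walk _ _ _ _ _) (ln _) (\sum_(_ <- _) _) => u v w; lra.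
Qed.

End Gibbs.

(** The quotient [Dz], of unknown sign and size, enters the steps of the derivative and of the
    barrier alike and cancels. *)
Lemma combine_steps (R : realFieldType) (A t v1 s1 u1 b1 b2 b3 Dz Y X G H : R) :
  v1 <= b1 + t * (Dz + Y + 1) -> b2 <= s1 - t * Dz + t * X ->
  A * (b3 + H) <= A * u1 -> b1 - b2 - A * b3 <= G ->
  v1 - s1 - A * u1 <= G + (t * (Y + 1) + t * X - A * H).
Proof. by move=> *; lra. Qed.

(** * Discrete comparison *)

Section Comparison.
Variables (R : realType) (d : nat) (T p : R).
Hypotheses (T0 : 0 < T) (p2 : 2 <= p) (d0 : (0 < d)%N) (dp : d%:R < p).

Definition kernel_spec (K : R) := forall k n i (r : seq 'I_d) (g : nat -> grid d k -> R) (gam : R),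
  perm_eq (i :: r) (enum 'I_d) -> n%:R * dtime R k <= T -> 0 < gam ->
  (forall j, (0 < j <= n)%N -> \sum_z `|g j z| `^ p <= k.*2.+3%:R ^+ d * gam `^ p) ->
  let P := walk (@unit_vec d k) (fun=> 0) (i :: r) in
  forall x,
   `|duh P (dtime R k) (fun j => dquo (unit_vec k i + unit_vec k i) (2 * step R k) (g j)) n x| <=
     K * gam
   /\ duh P (dtime R k) (fun j z => g j z ^+ 2) n x <= K * gam ^+ 2.

(** [1 <= K] gives [K <= K^2], so that one choice of [lam] makes the bound on squares at most the
    square of the bound on quotients. *)
Lemma kernel_specP : exists2 K, 1 <= K & kernel_spec K.
Proof.
have [K K0 hK] := duhamel_bounds T0 p2 d0 dp.
exists (1 + K); first by rewrite lerDl ltW.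
move=> k n i r g gam rP nT gam0 gp P x.
have [h1 h2] := hK k n i r g gam rP nT gam0 gp x; split.
  by apply: le_trans h1 _; rewrite mulrDl lerDr mul1r ltW.
by apply: le_trans h2 _; rewrite mulrDl lerDr mul1r exprn_ge0 // ltW.
Qed.

Variables (K : R).
Hypotheses (K1 : 1 <= K) (HK : kernel_spec K).
Variables (k M : nat) (i : 'I_d) (r : seq 'I_d).
Hypotheses (rP : perm_eq (i :: r) (enum 'I_d)) (MT : M%:R * dtime R k <= T).
Local Notation P := (walk (@unit_vec d k) (fun=> 0 : R) (i :: r)).
Local Notation tau := (dtime R k).
Local Notation E := (unit_vec k i + unit_vec k i).
Local Notation D := (dquo E (2 * step R k)).
Let mP : markov P := markov_walk0 R (@unit_vec d k) (i :: r).
Let tau0 : 0 < tau := dtime_gt0 R k.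

Variables (f : nat -> grid d k -> R) (gam : R).
Hypotheses (gam0 : 0 < gam)
  (fp : forall j, (0 < j <= M)%N -> \sum_z `|f j z| `^ p <= k.*2.+3%:R ^+ d * gam `^ p).

Let lam := (20 * K * gam)^-1.
Let K0 : 0 < K := lt_le_trans ltr01 K1.
Let lam0 : 0 < lam. Proof. by rewrite invr_gt0 !mulr_gt0. Qed.
Let ilam0 : 0 <= lam^-1. Proof. by apply: ltW; rewrite invr_gt0. Qed.
Let lf j z := lam * f j z.

Variable Q : R.
Hypotheses (fQ : forall j z, (0 < j <= M)%N -> `|D (lf j) z| <= Q)
  (QT : 9 * T * (tau * Q ^+ 2) <= 1) (Qh : tau * Q <= 2^-1).

Let nT n : (n <= M)%N -> n%:R * tau <= T.
Proof. by move=> nM; apply: le_trans MT; rewrite ler_wpM2r ?(ltW tau0) // ler_nat. Qed.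

(** A bootstrap: distance 1/2 from 1 at the earlier steps gives the bound 3/2 there, and
    [barrier_step] returns the distance 1/2 at the current one. *)
Lemma barrier_bound n x : (n <= M)%N -> `|barrier i r lf n x - 1| <= 2^-1.
Proof.
elim/ltn_ind: n x => n IH x nM.
have p0 : 0 < p by apply: lt_le_trans p2.
have fpn j : (0 < j <= n)%N -> \sum_z `|f j z| `^ p <= k.*2.+3%:R ^+ d * gam `^ p.
  by move=> /andP[j0 jn]; apply: fp; rewrite j0 (leq_trans jn).
have lK : lam * (K * gam) = 20^-1 by rewrite /lam; field; rewrite !gt_eqF.
apply: (@barrier_step R d k i r lf n 20^-1 Q T) => //.
- move=> w w1 z.
  have fw j : (0 < j <= n)%N -> \sum_z `|f j z * w j z| `^ p <= k.*2.+3%:R ^+ d * gam `^ p.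
    move=> jn; apply: le_trans (fpn j jn); apply: ler_sum => y _.
    apply: ge0_ler_powR; rewrite ?nnegrE ?(ltW p0) //.
    by rewrite normrM ler_piMr // w1.
  have [h _] := HK rP (nT nM) gam0 fw z.
  rewrite (duh_ext mP (ltW tau0) (g2 := fun j y => lam * D (fun z => f j z * w j z) y)); last first.
    by move=> j y _; rewrite /lf /dquo; ring.
  by rewrite duhZ ?(ltW tau0) // normrM (gtr0_norm lam0) -lK ler_wpM2l ?(ltW lam0).
- move=> z; rewrite (duh_shift mP _ (fun j y => lf j y ^+ 2)).
  have [_ h] := HK rP (nT nM) gam0 fpn (z + E).
  rewrite (duh_ext mP (ltW tau0) (g2 := fun j y => lam ^+ 2 * f j y ^+ 2)); last first.
    by move=> j y _; rewrite /lf exprMn.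
  rewrite duhZ ?(ltW tau0) //.
  apply: (@le_trans _ _ (lam ^+ 2 * (K * gam ^+ 2))); first by rewrite ler_wpM2l ?exprn_ge0 ?(ltW
    lam0).
  rewrite -lK exprMn ler_wpM2l ?exprn_ge0 ?(ltW lam0) // exprMn ler_wpM2r ?exprn_ge0 ?(ltW gam0) //.
  by rewrite expr2 ler_peMl ?(ltW K0).
- by move=> j z /andP[j0 jn]; apply: fQ; rewrite j0 (leq_trans jn).
- exact: nT.
- move=> j z jn; have := IH j jn z (ltnW (leq_trans jn nM)).
  by rewrite !ler_norml => /andP[h1 h2]; apply/andP; split; lra.
Qed.

(** Young's inequality [f <= gam^-1 * f^2 + gam] reduces the source to its square, for which the
    kernel bound is at hand. *)
Lemma upper_value (u : nat -> grid d k -> R) (u0 : R) :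
  (forall z, u 0%N z <= u0) ->
  (forall n z, (0 < n <= M)%N -> u n z <= P (u n.-1) z + tau * (f n z + 1)) ->
  forall n z, (n <= M)%N -> u n z <= u0 + (T + K) * gam + T.
Proof.
move=> hu0 hu n z nM.
have h : u n z <= u0 + duh P tau (fun j z => f j z + 1) n z.
  elim: n z nM => [|n IH] z nM; first by rewrite addr0.
  apply: le_trans (hu n.+1 z _) _; first by [].
  rewrite duhS -pred_Sn addrA lerD2r -[u0 in leRHS](markov_cst mP u0 z) -markovD //.
  by apply: markov_le => // y; apply: IH; exact: ltnW.
apply: le_trans h _; rewrite -addrA lerD2l.
have fpn j : (0 < j <= n)%N -> \sum_z `|f j z| `^ p <= k.*2.+3%:R ^+ d * gam `^ p.
  by move=> /andP[j0 jn]; apply: fp; rewrite j0 (leq_trans jn).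
have [_ h2] := HK rP (nT nM) gam0 fpn z.
have h3 : duh P tau (fun j z => f j z + 1) n z
   <= duh P tau (fun j y => gam^-1 * f j y ^+ 2 + (gam + 1)) n z.
  apply: duh_le => // [|j y _]; first exact: ltW.
  rewrite addrA lerD2r.
  have : 0 <= gam^-1 * ((f j y - gam) ^+ 2 + f j y ^+ 2 + gam ^+ 2).
    by rewrite mulr_ge0 ?invr_ge0 ?(ltW gam0) // !addr_ge0 ?sqr_ge0.
  have -> : gam^-1 * ((f j y - gam) ^+ 2 + f j y ^+ 2 + gam ^+ 2) = 2 * (gam^-1 * f j y ^+ 2 +
    gam - f j y).
    by field; rewrite gt_eqF.
  by lra.
apply: le_trans h3 _; rewrite duh_lin ?(ltW tau0) //.
have h4 : duh P tau (fun _ _ => gam + 1) n z <= n%:R * tau * (gam + 1).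
  by apply: duh_ub => //; exact: ltW.
have h5 : gam^-1 * duh P tau (fun j z => f j z ^+ 2) n z <= K * gam.
  by rewrite ler_pdivrMl // mulrCA -expr2.
apply: le_trans (lerD h5 h4) _.
have : n%:R * tau * (gam + 1) <= T * (gam + 1).
  by rewrite ler_wpM2r ?nT // addr_ge0 // ltW.
lra.
Qed.

Variables (b : nat -> grid d k -> 'I_d -> R) (Hv : nat -> grid d k -> R).
(** The mean displacement of a step is [th * step = - tau * b]. The weights are frozen at the
    starting point: [Pth n x] is a translation-invariant operator for each [x], and only its value
    at [x] is used. *)
Let th n x j : R := - (step R k / 2) * b n x j.
Hypothesis (th1 : forall n x j, (0 < n <= M)%N -> -1 < th n x j < 1).
Local Notation Pth n x := (walk (@unit_vec d k) (th n x) (i :: r)).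

Let mPth n x : (0 < n <= M)%N -> markov (Pth n x).
Proof.
move=> nM; apply: markov_walk => j.
by have /andP[u v] := th1 x j nM; rewrite !ltW.
Qed.

Variables (u : nat -> grid d k -> R) (c Cl : R).
Hypotheses (c0 : 0 < c) (Cl0 : 0 <= Cl)
  (hu : forall n x, (0 < n <= M)%N ->
     Pth n x (u n.-1) x + tau * (c * Hv n x - Cl - 1) <= u n x).

Lemma lower_value (u0 : R) : (forall n z, 0 <= Hv n z) ->
  (forall z, u0 <= u 0%N z) ->
  forall n z, (n <= M)%N -> u0 - T * (Cl + 1) <= u n z.
Proof.
move=> H0 hu0 n z nM.
have : u0 - n%:R * tau * (Cl + 1) <= u n z.
  elim: n z nM => [|n IH] z nM; first by rewrite !mul0r subr0.
  apply: le_trans (hu z (n := n.+1) _) => //.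
  have h := markov_lb (mPth z (n := n.+1) nM) z (fun y => IH y (ltnW nM)).
  have : 0 <= tau * (c * Hv n.+1 z) by apply: mulr_ge0; [exact: ltW | apply: mulr_ge0; [exact:
    ltW | exact: H0]].
  move: h; rewrite -natr1 -pred_Sn; move: (walk _ _ _ _ _) (Hv _ _) => A B; lra.
have : n%:R * tau * (Cl + 1) <= T * (Cl + 1).
  by rewrite ler_wpM2r ?nT // addr_ge0.
lra.
Qed.

Variables (v : nat -> grid d k -> R) (Ch B1 B2 v0 U : R).
Hypotheses (Ch0 : 0 <= Ch) (B10 : 0 <= B1) (B20 : 0 <= B2)
  (hv : forall n x, (0 < n <= M)%N ->
     v n x <= Pth n x (v n.-1) x + tau * (D (f n) x + (Ch * Hv n x + Ch) + 1))
  (hb : forall n x, (0 < n <= M)%N -> \sum_j b n x j ^+ 2 <= B1 * Hv n x + B2)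
  (hv0 : forall x, v 0%N x <= v0)
  (hU : forall n x, (n <= M)%N -> `|u n x| <= U).

(** [A * c] is the whole coefficient of [Hv] produced by the other two terms: [Ch] by the step of
    [v] and [B1 / (2 * lam)] by the squared drift in the step of [Psi]. [BB] collects what carries
    no [Hv]. *)
Let A := (Ch + B1 / (2 * lam)) / c.
Let BB := Ch + 1 + lam^-1 * (2 / (9 * T) + B2 / 2) + A * (Cl + 1).
Let Psi n x := lam^-1 * ln (barrier i r lf n x).

Let barrier_pos n x : (n <= M)%N -> 0 < barrier i r lf n x.
Proof.
by move=> nM; have := barrier_bound x nM; rewrite ler_norml => /andP[h1 h2]; lra.
Qed.

(** The logarithm of the product recursion reproduces the source up to a quadratic error, and the
    entropy inequality trades the symmetric step for the biased one at the price
    [tau / 2 * |b|^2]. *)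
Lemma psi_step n x : (0 < n <= M)%N ->
  Pth n x (Psi n.-1) x <= Psi n x - tau * D (f n) x
     + tau * (lam^-1 * (2 / (9 * T) + (B1 * Hv n x + B2) / 2)).
Proof.
move=> nM; have /andP[n0 nM'] := nM.
have nM1 : (n.-1 <= M)%N by rewrite (leq_trans (leq_pred _)).
have pos z := barrier_pos z nM1.
have PP0 : 0 < P (barrier i r lf n.-1) x.
  apply: (@lt_le_trans _ _ (2^-1)); first by rewrite invr_gt0.
  apply: markov_lb => // z; have := barrier_bound z nM1; rewrite ler_norml => /andP[h1 h2]; lra.
rewrite markovZ; last exact: mPth.
have h1 := walk_ln (@unit_vec d k) (i :: r) x (fun j => th1 x j nM) pos.
set q := D (lf n) x.
have qQ : `|q| <= Q by apply: fQ.
have tq : `|tau * q| <= 2^-1.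
  rewrite normrM (gtr0_norm tau0); apply: le_trans Qh; by rewrite ler_wpM2l // ltW.
have q1 : 0 < 1 + tau * q by move: tq; rewrite ler_norml => /andP[]; lra.
have bE : barrier i r lf n x = (1 + tau * q) * P (barrier i r lf n.-1) x.
  by rewrite /q; case: (n) n0.
(* From [ln (1 + y) >= y / (1 + y)]; the coefficient 2 is enough because [y >= -1/2]. *)
have h2 : tau * q - 2 * (tau * q) ^+ 2 <= ln (1 + tau * q).
  set y := tau * q in tq q1 *.
  have : ln ((1 + y)^-1) <= (1 + y)^-1 - 1.
    by rewrite ln_leB1 ?invr_gt0.
  rewrite lnV ?posrE // => h; have : y - 2 * y ^+ 2 <= 1 - (1 + y)^-1; last by lra.
  have -> : 1 - (1 + y)^-1 = y / (1 + y) by field; rewrite gt_eqF.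
  rewrite ler_pdivlMr //; move: tq; rewrite ler_norml => /andP[a1 a2]; nra.
have h3 : \sum_(j <- i :: r) th n x j ^+ 2 = tau / 2 * \sum_j b n x j ^+ 2.
  rewrite -(big_enum _ _ xpredT) -(perm_big _ rP) mulr_sumr /=; apply: eq_bigr => j _.
  by rewrite /th /dtime; field.
have h4 := ler_wpM2l (ltW (divr_gt0 tau0 (ltr0Sn R 1))) (hb x nM).
have h5 : (tau * q) ^+ 2 <= tau / (9 * T).
  have T9 : 0 < 9 * T by rewrite mulr_gt0.
  rewrite ler_pdivlMr //; have -> : (tau * q) ^+ 2 * (9 * T) = tau * (9 * T * (tau * q ^+ 2)) by
    ring.
  rewrite -[leRHS]mulr1 ler_wpM2l ?(ltW tau0) //; apply: le_trans QT.
  rewrite ler_wpM2l ?(ltW T9) // ler_wpM2l ?(ltW tau0) // -[leLHS]real_normK ?num_real //.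
  by rewrite ler_pXn2r ?nnegrE // (le_trans _ qQ).
have qE : D (f n) x = lam^-1 * q.
  by rewrite /q /lf /dquo; field; rewrite ?gt_eqF ?step_gt0.
have lnE : ln (barrier i r lf n x) = ln (1 + tau * q) + ln (P (barrier i r lf n.-1) x).
  by rewrite bE lnM ?posrE.
rewrite /Psi lnE qE; set L := ln (P _ _) in h1 *.
have -> : lam^-1 * (ln (1 + tau * q) + L) - tau * (lam^-1 * q)
     + tau * (lam^-1 * (2 / (9 * T) + (B1 * Hv n x + B2) / 2))
  = lam^-1 * (ln (1 + tau * q) + L - tau * q + (2 * (tau / (9 * T)) + tau / 2 * (B1 * Hv n x +
    B2))).
  by field; rewrite ?gt_eqF.
rewrite ler_wpM2l //.
apply: le_trans h1 _; rewrite h3.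
move: h2 h4 h5; set a1 := tau / (9 * T); set a2 := tau / 2 * _; set a3 := tau / 2 * _.
set a4 := ln _; set a5 := (tau * q) ^+ 2; set a6 := tau * q => h2 h4 h5.
lra.
Qed.

Theorem discrete_comparison n x : (n <= M)%N ->
  v n x <= v0 + lam^-1 + 2 * A * U + T * BB.
Proof.
move=> nM.
have A0 : 0 <= A by rewrite divr_ge0 ?(ltW c0) // addr_ge0 // divr_ge0 // mulr_ge0 // ltW.
have BB0 : 0 <= BB.
  have T9 : 0 <= 2 / (9 * T) by rewrite divr_ge0 // mulr_ge0 // ltW.
  rewrite /BB; apply: addr_ge0; last by rewrite mulr_ge0 // addr_ge0.
  apply: addr_ge0; first exact: addr_ge0.
  by rewrite mulr_ge0 // addr_ge0 // divr_ge0.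
have U0 : 0 <= U by apply: le_trans (hU x (leq0n M)).
(* [Psi] starts from [ln 1 = 0]. Half of [2 * A * U] is spent on [- A * u] at the initial step, the
   other half on returning from this quantity to [v]. *)
have h m z : (m <= M)%N ->
    v m z - Psi m z - A * u m z <= m%:R * tau * BB + (v0 + A * U).
  elim: m z => [|m IH] z mM.
    rewrite /Psi /= ln1 mulr0 subr0 !mul0r add0r.
    have := hv0 z; have := hU z mM; rewrite ler_norml => /andP[u1 _] v1.
    have : A * (- U) <= A * u 0%N z by rewrite ler_wpM2l.
    by lra.
  have nM1 : (0 < m.+1 <= M)%N by rewrite mM.
  have mP1 := mPth z nM1.
  have := markov_ub mP1 z (fun y => IH y (ltnW mM)).
  rewrite !markovB // (markovZ mP1 A) -[m in Psi m]/(m.+1.-1) -[m in v m]/(m.+1.-1) -[m in u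
    m]/(m.+1.-1).
  have h1 := hv z nM1; have h2 := psi_step z nM1.
  have h3 := ler_wpM2l A0 (hu z nM1).
  set X := lam^-1 * _ in h2.
  have key : tau * BB = tau * (Ch * Hv m.+1 z + Ch + 1) + tau * X - A * (tau * (c * Hv m.+1 z -
    Cl - 1)).
    have Ac : A * c = Ch + lam^-1 * (B1 / 2).
      by rewrite /A divfK ?gt_eqF //; field; rewrite gt_eqF.
    have -> : A * (tau * (c * Hv m.+1 z - Cl - 1)) = tau * ((A * c) * Hv m.+1 z - A * (Cl + 1))
      by ring.
    by rewrite Ac /BB /X; field; rewrite !gt_eqF.
  have -> : m.+1%:R * tau * BB = m%:R * tau * BB + tau * BB by rewrite -natr1; ring.
  rewrite key; move: h1 h2 h3 {key}.
  move: (Pth m.+1 z _ z) (Pth m.+1 z _ z) (Pth m.+1 z _ z) => a1 a2 a3 h1 h2 h3 h4.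
  apply: le_trans (combine_steps h1 h2 h3 h4) _.
  by rewrite addrAC addrA.
have := h n x nM; have := hU x nM; rewrite ler_norml => /andP[_ u1].
have : A * u n x <= A * U by rewrite ler_wpM2l.
have : n%:R * tau * BB <= T * BB by rewrite ler_wpM2r ?nT.
have : Psi n x <= lam^-1.
  rewrite /Psi -[leRHS]mulr1 ler_wpM2l //; apply: le_trans (ln_leB1 (barrier_pos x nM)) _.
  by have := barrier_bound x nM; rewrite ler_norml => /andP[_]; lra.
lra.
Qed.

End Comparison.

Local Open Scope classical_set_scope.
Local Open Scope ring_scope.

(** * Consistency of the discretization *)

Section DirectionalDerivatives.
Variables (R : realType) (V : normedModType R).
Implicit Types (F G : V -> R) (a b z y : V).

Lemma is_deriveP F z a l : is_derive z a F l <->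
  (fun s : R => s^-1 * (F (z + s *: a) - F z)) @ 0^' --> l.
Proof.
have e : (fun s : R => s^-1 * (F (z + s *: a) - F z)) = (fun h => h^-1 *: ((F \o shift z) (h *:
  a) - F z)).
  by apply/funext => s /=; rewrite (addrC z).
rewrite e; split=> [[dF <-] //|cF].
by split; [apply/cvg_ex; exists l | exact: cvg_lim].
Qed.

End DirectionalDerivatives.

Section DirectionalMVT.
Variables (R : realType) (V : normedModType R).
Implicit Types (F G : V -> R) (a b z y : V).

Lemma is_derive_translate F w z a l :
  is_derive (z + w) a F l -> is_derive z a (fun y => F (y + w)) l.
Proof.
move=> /is_deriveP h; apply/is_deriveP.
by rewrite (_ : (fun s => _) = (fun s : R => s^-1 * (F (z + w + s *: a) - F (z + w)))) //;
  apply/funext => s; rewrite addrAC.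
Qed.

Lemma is_derive_line F z a r l :
  is_derive (z + r *: a) a F l -> is_derive r (1 : R) (fun s : R => F (z + s *: a)) l.
Proof.
move=> /is_deriveP h.
have e : (fun s : R => s^-1 * (F (z + r *: a + s *: a) - F (z + r *: a)))
   = (fun h => h^-1 *: (((fun s : R => F (z + s *: a)) \o shift r) (h *: (1 : R)) - F (z + r *:
     a))).
  by apply/funext => s /=; rewrite [s *: (1 : R)]mulr1 [s + r]addrC scalerDl addrA.
rewrite e in h.
by split; [apply/cvg_ex; exists l | exact: cvg_lim].
Qed.

Lemma mvt_dir F a z (s : R) : (forall y, derivable F y a) ->
  exists2 xi : R, `|xi| <= `|s| & F (z + s *: a) - F z = s * 'D_a F (z + xi *: a).
Proof.
move=> dF.
pose phi (r : R) := F (z + r *: a).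
have dphi r : is_derive r (1 : R) phi ('D_a F (z + r *: a)).
  by apply: is_derive_line; apply: DeriveDef.
have cphi : continuous phi.
  move=> r; apply: differentiable_continuous; apply/derivable1_diffP.
  by case: (dphi r).
have cw u v : {within `[u, v], continuous phi} by apply: continuous_subspaceT.
have -> : F z = phi 0 by rewrite /phi scale0r addr0.
rewrite -/(phi s).
have [s0|s0] := leP 0 s.
  have [c c01 h] := MVT_segment s0 (fun r _ => dphi r) (cw 0 s).
  move: c01; rewrite in_itv /= => /andP[c0 cs]; exists c; first by rewrite !ger0_norm.
  by rewrite h subr0 mulrC.
have [c c01 h] := MVT_segment (ltW s0) (fun r _ => dphi r) (cw s 0).
move: c01; rewrite in_itv /= => /andP[c0 cs]; exists c.
  by rewrite !ler0_norm ?(ltW s0) // lerN2.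
by rewrite -opprB h sub0r mulrN opprK mulrC.
Qed.

Lemma continuous_eps F z (e : R) : continuous F -> 0 < e ->
  exists2 del : R, 0 < del & forall y, `|y - z| < del -> `|F y - F z| <= e.
Proof.
move=> cF e0; have := cF z; move=> /cvgrPdist_le /(_ _ e0) /nbhs_ballP[del del0 h].
exists del => // y yz; rewrite distrC; apply: h; rewrite -ball_normE /= distrC //.
Qed.

Lemma second_difference F (c d : V) z (s : R) :
  (forall y, derivable F y c) -> (forall y, derivable ('D_c F) y d) ->
  exists xi zeta : R, [/\ `|xi| <= `|s|, `|zeta| <= `|s| &
    F (z + s *: c + s *: d) - F (z + s *: c) - F (z + s *: d) + F z
      = s ^+ 2 * 'D_d ('D_c F) (z + xi *: c + zeta *: d)].
Proof.
move=> dc dcd; pose g y := F (y + s *: d) - F y.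
have dg y : is_derive y c g ('D_c F (y + s *: d) - 'D_c F y).
  apply: is_deriveB; first by apply: is_derive_translate; apply: DeriveDef.
  by apply: DeriveDef.
have [xi xis h1] := @mvt_dir g c z s (fun y => @ex_derive _ _ _ _ _ _ _ (dg y)).
have [zeta zs h2] := @mvt_dir ('D_c F) d (z + xi *: c) s dcd.
exists xi, zeta; split=> //.
by rewrite expr2 -mulrA -h2 -(@derive_val _ _ _ _ _ _ _ (dg _)) -h1 /g; ring.
Qed.

(** The second difference along [a] and [b] is symmetric, and it equals either mixed derivative at
    some point close to [z], times [s ^+ 2]. *)
Lemma schwarz F a b : (forall y, derivable F y a) -> (forall y, derivable F y b) ->
  (forall y, derivable ('D_a F) y b) -> (forall y, derivable ('D_b F) y a) ->
  continuous ('D_b ('D_a F)) -> continuous ('D_a ('D_b F)) ->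
  'D_b ('D_a F) = 'D_a ('D_b F).
Proof.
move=> da db dab dba cab cba; apply/funext => z; apply/eqP; rewrite -subr_eq0 -normr_le0.
apply/ler_addgt0Pr => e e0; rewrite add0r.
have e2 : 0 < e / 2 by rewrite divr_gt0.
have [d1 d10 h1] := continuous_eps z cab e2.
have [d2 d20 h2] := continuous_eps z cba e2.
pose C := `|a| + `|b| + 1.
have C0 : 0 < C by rewrite ltr_wpDl // addr_ge0.
pose s := Num.min d1 d2 / 2 / C.
have m0 : 0 < Num.min d1 d2 by rewrite lt_min d10.
have s0 : 0 < s by rewrite !divr_gt0.
have near_z (x1 x2 : R) (c d : V) : `|c| + `|d| <= C -> `|x1| <= `|s| -> `|x2| <= `|s| ->
    `|z + x1 *: c + x2 *: d - z| < Num.min d1 d2.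
  move=> cC x1s x2s; rewrite addrAC (addrAC z) subrr add0r.
  apply: le_lt_trans (ler_normD _ _) _; rewrite !normrZ.
  apply: (@le_lt_trans _ _ (s * C)).
    rewrite (gtr0_norm s0) in x1s x2s.
    apply: (@le_trans _ _ (s * (`|c| + `|d|))); last by rewrite ler_wpM2l // ltW.
    by rewrite mulrDr lerD // ler_wpM2r.
  by rewrite /s divfK ?gt_eqF // ltr_pdivrMr // ltr_pMr // ltr1n.
have [x1 [x2 [x1s x2s E1]]] := second_difference z s da dab.
have [x3 [x4 [x3s x4s E2]]] := second_difference z s db dba.
have abC : `|a| + `|b| <= C by rewrite lerDl.
have baC : `|b| + `|a| <= C by rewrite [X in X <= _]addrC.
have {}h1 := h1 _ (lt_le_trans (near_z _ _ _ _ abC x1s x2s) _).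
have {}h2 := h2 _ (lt_le_trans (near_z _ _ _ _ baC x3s x4s) _).
have {h1}h1 := h1 (_ : _ <= d1); have {h2}h2 := h2 (_ : _ <= d2).
rewrite ge_min lexx in h1; rewrite ge_min lexx orbT in h2.
have E : 'D_b ('D_a F) (z + x1 *: a + x2 *: b) = 'D_a ('D_b F) (z + x3 *: b + x4 *: a).
  have s20 : s ^+ 2 != 0 by rewrite expf_neq0 ?gt_eqF.
  have E12 : s ^+ 2 * 'D_b ('D_a F) (z + x1 *: a + x2 *: b)
      = s ^+ 2 * 'D_a ('D_b F) (z + x3 *: b + x4 *: a).
    refine (etrans (esym E1) (etrans _ E2)); rewrite (addrAC z (s *: b)); congr (_ + _).
    exact: addrAC.
  exact: mulfI E12.
move: (h1 isT) (h2 isT); rewrite E; move: ('D_b ('D_a F) z) ('D_a ('D_b F) z) ('D_a _ _) => u v w.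
clear; rewrite !ler_norml => /andP[? ?] /andP[? ?]; apply/andP; split; lra.
Qed.

(** A chain rule from continuous directional derivatives, the only ones [Ck] speaks of: the
    directions are switched on one after the other, and the mean value theorem is applied to each
    increment. *)
Lemma is_derive_path_sum (J : Type) (r : seq J) F (a : J -> V) (c : J -> R -> R) (c' : J -> R) z :
  (forall j y, derivable F y (a j)) -> (forall j, continuous ('D_(a j) F)) ->
  (forall j, c j 0 = 0) -> (forall j, is_derive (0 : R) (1 : R) (c j) (c' j)) ->
  is_derive (0 : R) (1 : R) (fun s => F (z + \sum_(j <- r) c j s *: a j))
    (\sum_(j <- r) c' j * 'D_(a j) F z).
Proof.
move=> dF cF c0 dc.
have cc j : c j s @[s --> (0 : R)] --> (0 : R).
  rewrite -[X in _ --> X](c0 j).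
  by apply: differentiable_continuous; apply/derivable1_diffP; case: (dc j).
have cy (q : seq J) : (z + \sum_(i <- q) c i s *: a i) @[s --> (0 : R)] --> z.
  rewrite -[X in _ --> X]addr0; apply: cvgD; first exact: cvg_cst.
  elim: q => [|i q IH].
    rewrite (_ : (fun s => _) = cst 0); first exact: cvg_cst.
    by apply/funext => s; rewrite big_nil.
  rewrite (_ : (fun s => _) = (fun s => c i s *: a i + \sum_(k <- q) c k s *: a k)); last first.
    by apply/funext => s; rewrite big_cons.
  rewrite -[X in _ --> X]addr0; apply: cvgD => //.
  by rewrite -(scale0r (a i)); apply: cvgZr_tmp.
elim: r => [|j r IH].
  rewrite big_nil (_ : (fun s => _) = cst (F z)); first exact: is_derive_cst.
  by apply/funext => s; rewrite big_nil addr0.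
pose y s := z + \sum_(i <- r) c i s *: a i.
have y0 : y 0 = z.
  by rewrite /y big1 ?addr0 // => i _; rewrite c0 scale0r.
pose Ef s := F (y s + c j s *: a j) - F (y s).
have dE : is_derive (0 : R) (1 : R) Ef (c' j * 'D_(a j) F z).
  have hxi s : exists t, `|t| <= `|c j s| /\ Ef s = c j s * 'D_(a j) F (y s + t *: a j).
    by have [t ? ?] := @mvt_dir F (a j) (y s) (c j s) (dF j); exists t.
  have [xi xiP] := choice hxi.
  apply/is_deriveP; have Ef0 : Ef 0 = 0 by rewrite /Ef c0 scale0r addr0 subrr.
  have -> : (fun s : R => s^-1 * (Ef (0 + s *: (1 : R)) - Ef 0))
     = (fun s : R => (s^-1 * (c j (0 + s *: (1 : R)) - c j 0)) * 'D_(a j) F (y s + xi s *: a j)).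
    apply/funext => s; rewrite add0r [s *: (1 : R)]mulr1 Ef0 c0 !subr0.
    by have [_ ->] := xiP s; rewrite mulrA.
  apply: cvgM; first by apply/is_deriveP.
  have xi0 : xi s @[s --> (0 : R)] --> (0 : R).
    apply/cvgrPdist_le => e e0.
    have := cc j; move=> /cvgrPdist_le /(_ _ e0).
    apply: filterS => s; rewrite !sub0r !normrN; apply: le_trans.
    by have [] := xiP s.
  have hy : (y s + xi s *: a j) @[s --> (0 : R)] --> z.
    rewrite -[X in _ --> X]addr0; apply: cvgD; first exact: cy.
    by rewrite -(scale0r (a j)); apply: cvgZr_tmp.
  apply: cvg_within_filter; exact: (cvg_comp _ _ hy (cF j z)).
have -> : (fun s => F (z + \sum_(i <- j :: r) c i s *: a i)) = (fun s => F (y s)) + Ef.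
  apply/funext => s; transitivity (F (y s) + Ef s); last by [].
  by rewrite /Ef [RHS]addrC subrK /y big_cons [c j s *: _ + _]addrC addrA.
by rewrite big_cons addrC; apply: is_deriveD.
Qed.

End DirectionalMVT.

(** * Compactness for functions on the torus *)

Section Periodic.
Variables (R : realType) (d : nat).
Implicit Types (F : 'rV[R]_d * R -> R) (x : 'rV[R]_d) (t : R).

Lemma evE (i j : 'I_d) : ev R i 0 j = (j == i)%:R.
Proof. by rewrite mxE eqxx eq_sym. Qed.

Lemma periodic_x_int F x t (n : 'I_d -> int) : periodic_x F ->
  F (x + \sum_i (n i)%:~R *: ev R i, t) = F (x, t).
Proof.
move=> pF.
have pN y (i : 'I_d) (m : nat) : F (y + m%:R *: ev R i, t) = F (y, t).
  elim: m => [|m IH]; first by rewrite scale0r addr0.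
  by rewrite -natr1 scalerDl scale1r addrA pF.
have pZ y (i : 'I_d) (m : int) : F (y + m%:~R *: ev R i, t) = F (y, t).
  case: m => m; first exact: pN.
  by rewrite NegzE rmorphN /= -(pN _ i m.+1) -addrA -scalerDl addNr scale0r addr0.
elim: (index_enum _) x => [|i r IH] x; first by rewrite big_nil addr0.
by rewrite big_cons addrA IH pZ.
Qed.

Lemma cube_repr x : exists n : 'I_d -> int,
  forall j, 0 <= (x + \sum_i (n i)%:~R *: ev R i) 0 j <= 1.
Proof.
exists (fun i => - Num.floor (x 0 i)) => j.
have -> : (x + \sum_i (- Num.floor (x 0 i))%:~R *: ev R i) 0 j = x 0 j - (Num.floor (x 0 j))%:~R.
  rewrite mxE summxE (bigD1 j) //= big1 => [|i ij].
    by rewrite mxE evE eqxx mulr1 addr0 rmorphN.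
  by rewrite mxE evE eq_sym (negbTE ij) mulr0.
rewrite subr_ge0 Num.Theory.floor_le_tmp lerBlDr addrC.
by have := Num.Theory.floorD1_gt (x 0 j); rewrite rmorphD /= => /ltW.
Qed.

Definition cube : set 'rV[R]_d := [set x | forall j, 0 <= x 0 j <= 1].

Lemma compact_cube : compact cube.
Proof.
have -> : cube = [set x : 'rV[R]_d | forall i, `[(0 : R), 1]%classic (x ord0 i)].
  by apply/seteqP; split => x h i; have := h i; rewrite /= in_itv.
by apply: (@rV_compact _ _ (fun=> `[(0 : R), 1]%classic)) => i; exact: segment_compact.
Qed.

Definition slab (T : R) : set ('rV[R]_d * R) := cube `*` [set t | 0 <= t <= T].

Lemma compact_slab (T : R) : compact (slab T).
Proof.
apply: compact_setX; first exact: compact_cube.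
rewrite (_ : [set t | _] = `[0, T]%classic); first exact: segment_compact.
by apply/seteqP; split => x /=; rewrite in_itv.
Qed.

Lemma periodic_bounded F T : continuous F -> periodic_x F ->
  exists2 B : R, 0 <= B & forall x t, 0 <= t <= T -> `|F (x, t)| <= B.
Proof.
move=> cF pF.
have : compact (F @` slab T).
  by apply: continuous_compact; [exact: continuous_subspaceT | exact: compact_slab].
move=> /compact_bounded [M [_ hM]].
exists (`|M| + 1) => [|x t tT]; first by rewrite addr_ge0.
have [n hn] := cube_repr x; rewrite -(periodic_x_int x t n pF).
apply: (hM (`|M| + 1)); last by exists (x + \sum_i (n i)%:~R *: ev R i, t).
by apply: le_lt_trans (ler_norm M) _; rewrite ltrDl.
Qed.

(** Only the base point is reduced to the compact slab: the neighbour is moved by the same period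
    and may leave the cube and the time interval. *)
Lemma periodic_unif F T (e : R) : continuous F -> periodic_x F -> 0 < e ->
  exists2 del : R, 0 < del & forall x t y s, 0 <= t <= T ->
    `|y - x| <= del -> `|s - t| <= del -> `|F (y, s) - F (x, t)| <= e.
Proof.
move=> cF pF e0.
have e2 : 0 < e / 2 by rewrite divr_gt0.
pose P (del : R) (z : 'rV[R]_d * R) := forall z', `|z' - z| <= del -> `|F z' - F z| <= e.
have /compact_near_coveringP ncov := @compact_slab T.
have cov : forall z : 'rV[R]_d * R, slab T z -> \forall z' \near z & del \near 0^'+, P del z'.
  move=> z _; have [r r0 hr] := continuous_eps z cF e2.
  exists (ball z (r / 2), [set del : R | del < r / 2]) => /=.
    split; first by apply: nbhsx_ballx; rewrite divr_gt0.
    by apply: nbhs_right_lt; rewrite divr_gt0.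
  move=> [z' del] /= []; rewrite -ball_normE /= => zz' dr z'' z''z'.
  have h1 := hr z' _; have h2 := hr z'' _.
  have {}h1 : `|F z' - F z| <= e / 2.
    by apply: h1; rewrite distrC; apply: lt_le_trans zz' _; rewrite ler_pdivrMr // ler_peMr
      ?ler1n // ltW.
  have {}h2 : `|F z'' - F z| <= e / 2.
    apply: h2; rewrite -(subrK z' z'') -addrA; apply: le_lt_trans (ler_normD _ _) _.
    rewrite [r]splitr; apply: le_lt_trans (lerD z''z' (lexx _)) _.
    by rewrite ltrD // distrC.
  rewrite -(subrK (F z) (F z'')) -addrA; apply: le_trans (ler_normD _ _) _.
  by rewrite [e]splitr lerD // distrC.
have H := ncov R (0 : R)^'+ P _ cov.
have [del [del0 hd]] : exists del : R, 0 < del /\ slab T `<=` P del.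
  have : \forall del \near (0 : R)^'+, 0 < del /\ slab T `<=` P del.
    near=> del; split; first by near: del; exact: nbhs_right_gt.
    by near: del; exact: H.
  by move=> /filter_ex [del hdel]; exists del.
exists del => // x t y s tT yx st.
have [n hn] := cube_repr x.
rewrite -(periodic_x_int x t n pF) -(periodic_x_int y s n pF).
apply: (hd (_, t)) => //.
by rewrite prod_normE /= ge_max st andbT opprD addrACA subrr addr0.
Unshelve. all: by end_near.
Qed.
End Periodic.

Section Smooth.
Variables (R : realType) (V : normedModType R).
Implicit Types (f : V -> R).

Lemma smooth_continuous f : smooth f -> continuous f.
Proof. by move=> /(_ 0%N) []. Qed.

Lemma smooth_derivable f v x : smooth f -> derivable f x v.
Proof. by move=> /(_ 1%N) [_ /(_ v) []]. Qed.

Lemma smooth_derive f v : smooth f -> smooth ('D_v f).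
Proof. by move=> sf k; have [_ /(_ v) []] := sf k.+1. Qed.

Lemma smooth_is_derive f v x : smooth f -> is_derive x v f ('D_v f x).
Proof. by move=> sf; apply: DeriveDef => //; exact: smooth_derivable. Qed.

End Smooth.

Section Consistency.
Variables (R : realType) (d : nat).
Implicit Types (w : 'rV[R]_d * R -> R) (y : 'rV[R]_d).
Local Notation dx := (@dx R d).

Lemma add_dx y s (r : R) i : (y, s) + r *: dx i = (y + r *: ev R i, s).
Proof. by rewrite /dx; congr (_, _); rewrite /= scaler0 addr0. Qed.

Lemma add_dt y s (r : R) : (y, s) + r *: dt R d = (y, s + r).
Proof. by rewrite /dt; congr (_, _); rewrite /= ?scaler0 ?addr0 // [r *: _]mulr1. Qed.

Lemma norm_ev (r : R) i : `|r *: ev R i : 'rV[R]_d| <= `|r|.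
Proof.
rewrite normrZ ler_piMr //.
rewrite [leLHS]/Num.norm /= mx_normrE; apply/bigmax_leP; split => // -[a b] _ /=.
by rewrite mxE; case: (_ && _); rewrite ?normr1 ?normr0.
Qed.

Lemma periodic_x_derive w v : periodic_x w -> periodic_x ('D_v w).
Proof.
move=> pw x t i; rewrite /derive.
rewrite (_ : (fun h : R => _) = (fun h => h^-1 *: ((w \o shift (x, t)) (h *: v) - w (x, t)))) //.
apply/funext => h /=; rewrite pw; congr (_ *: (_ - _)).
rewrite /shift /=; case: (h *: v) => a b.
by rewrite -[RHS](pw _ _ i); congr (w (_, _)); rewrite /= addrA.
Qed.

(** The error is measured by the oscillation of first and second derivatives through mean value
    points, with no bound on third derivatives. *)
Lemma avg_taylor w i y (s h b eta : R) : 0 <= h -> smooth w ->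
  (forall r, `|r| <= 3 * h ->
     `|'D_(dx i) w (y + r *: ev R i, s) - 'D_(dx i) w (y, s)| <= eta) ->
  (forall r, `|r| <= 3 * h ->
     `|'D_(dx i) ('D_(dx i) w) (y + r *: ev R i, s) - 'D_(dx i) ('D_(dx i) w) (y, s)| <= eta) ->
  `|avg (- (h / 2) * b) (h *: ev R i) (fun x => w (x, s)) y - w (y, s)
     - h ^+ 2 / 2 * ('D_(dx i) ('D_(dx i) w) (y, s) - b * 'D_(dx i) w (y, s))|
    <= h ^+ 2 / 2 * ((1 + `|b|) * eta).
Proof.
move=> h0 sw m1 m2; have sw1 := smooth_derive (dx i) sw.
have dw z : derivable w z (dx i) by exact: smooth_derivable.
have dw1 z : derivable ('D_(dx i) w) z (dx i) by exact: smooth_derivable.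
have [x1 x1h e1] := mvt_dir (y, s) h dw.
have [x2 x2h e2] := mvt_dir (y, s) (- h) dw.
have [x3 [x4 [x3h x4h e3]]] := second_difference ((y, s) + (- h) *: dx i) h dw dw1.
rewrite normrN in x2h; rewrite (ger0_norm h0) in x1h x2h x3h x4h.
rewrite !add_dx in e1 e2; rewrite !(add_dx y s) !(add_dx (y + _) s) in e3.
rewrite !(add_dx (y + _ + _) s) in e3.
have E3 : y + - h *: ev R i + h *: ev R i = y by rewrite scaleNr addrNK.
rewrite !E3 in e3.
(* The second difference is based at [y - h], and two mean value points are added to it, hence the
   radius [3 * h]. *)
have m3 : `|x3 - h + x4| <= 3 * h by move: x3h x4h; rewrite !ler_norml => /andP[? ?] /andP[? ?];
  apply/andP; split; lra.
have E4 : y + - h *: ev R i + x3 *: ev R i + x4 *: ev R i = y + (x3 - h + x4) *: ev R i.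
  by rewrite -!addrA -!scalerDl; congr (y + _ *: _); ring.
rewrite E4 in e3.
have h3 (t : R) : `|t| <= h -> `|t| <= 3 * h by lra.
have := m1 _ (h3 _ x1h); have := m1 _ (h3 _ x2h); have := m2 _ m3.
move: e1 e2 e3; rewrite /avg /= !scaleNr.
move: ('D_(dx i) ('D_(dx i) w) (y + (x3 - h + x4) *: ev R i, s)) ('D_(dx i) w (y + x1 *: ev R i,
  s)) => A3 A1.
move: ('D_(dx i) w (y + x2 *: ev R i, s)) => A2.
move: ('D_(dx i) ('D_(dx i) w) (y, s)) ('D_(dx i) w (y, s)) => B2 B1.
move: (w (y + h *: ev R i, s)) (w (y - h *: ev R i, s)) (w (y, s)) => wp wm w0 e1 e2 e3 n3 n2 n1.
have -> : (1 + - (h / 2) * b) / 2 * wp + (1 - - (h / 2) * b) / 2 * wm - w0 - h ^+ 2 / 2 * (B2 - b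
  * B1)
   = h ^+ 2 / 2 * ((A3 - B2) - b * (((A1 - B1) + (A2 - B1)) / 2)).
  have S : wp + wm - 2 * w0 = h ^+ 2 * A3 by rewrite -e3; ring.
  have D : wp - wm = h * (A1 + A2).
    have -> : wp - wm = (wp - w0) - (wm - w0) by ring.
    by rewrite e1 e2; ring.
  transitivity ((wp + wm - 2 * w0) / 2 - h * b / 4 * (wp - wm) - h ^+ 2 / 2 * (B2 - b * B1)).
    by field.
  by rewrite S D; field.
rewrite normrM (ger0_norm (divr_ge0 (exprn_ge0 2 h0) (ler0n R 2))).
rewrite ler_wpM2l ?divr_ge0 ?exprn_ge0 //.
apply: le_trans (ler_normB _ _) _; rewrite [leRHS]mulrDl mul1r lerD // normrM ler_wpM2l //.
rewrite normrM (@ger0_norm _ 2^-1) ?invr_ge0 // ler_pdivrMr //.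
by apply: le_trans (ler_normD _ _) _; rewrite mulr_natr mulr2n lerD.
Qed.

Lemma walk_local (th : 'I_d -> R) (e : 'I_d -> 'rV[R]_d) r (g : 'rV[R]_d -> R) (k : R) y :
  (forall j, -1 <= th j <= 1) ->
  (forall z i, `|g (z + e i) - g z| <= k /\ `|g (z - e i) - g z| <= k) ->
  `|walk e th r g y - g y| <= (size r)%:R * k.
Proof.
move=> th1 gk; elim: r => [|i r IH] /=; first by rewrite subrr normr0 mul0r.
have mw := markov_walk e r th1.
have -> : walk e th r (avg (th i) (e i) g) y - g y
   = walk e th r (fun z => avg (th i) (e i) g z - g z) y + (walk e th r g y - g y).
  by rewrite markovB //; ring.
apply: le_trans (ler_normD _ _) _; rewrite -nat1r mulrDl mul1r lerD //.
apply: markov_norm_ub => // z; have [h1 h2] := gk z i; have /andP[t1 t2] := th1 i.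
have -> : avg (th i) (e i) g z - g z = (1 + th i) / 2 * (g (z + e i) - g z) + (1 - th i) / 2 * (g
  (z - e i) - g z).
  by rewrite /avg; field.
apply: le_trans (ler_normD _ _) _; rewrite (normrM ((1 + th i) / 2)) (normrM ((1 - th i) / 2)).
have p1 : 0 <= (1 + th i) / 2 by lra.
have p2 : 0 <= (1 - th i) / 2 by lra.
rewrite (ger0_norm p1) (ger0_norm p2).
apply: le_trans (lerD (ler_wpM2l p1 h1) (ler_wpM2l p2 h2)) _.
by rewrite le_eqVlt; apply/orP; left; apply/eqP; field.
Qed.

Definition generator w (b : 'I_d -> R) (s : R) j x :=
  'D_(dx j) ('D_(dx j) w) (x, s) - b j * 'D_(dx j) w (x, s).

(** The generator of each direction is seen from where the remaining directions of the step lead.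
    Its oscillation over at most [size r] moves is what makes the error quadratic in [size r]. *)
Lemma walk_taylor w (s : R) (b : 'I_d -> R) (r : seq 'I_d) (h B eta : R) y :
  0 <= h -> 0 <= B -> 0 <= eta -> smooth w -> (forall j, `|b j| <= B) -> h / 2 * B <= 1 ->
  (forall i j x t, `|t| <= 3 * h ->
     `|'D_(dx i) w (x + t *: ev R j, s) - 'D_(dx i) w (x, s)| <= eta) ->
  (forall i j x t, `|t| <= 3 * h ->
     `|'D_(dx i) ('D_(dx i) w) (x + t *: ev R j, s) - 'D_(dx i) ('D_(dx i) w) (x, s)| <= eta) ->
  `|walk (fun j => h *: ev R j) (fun j => - (h / 2) * b j) r (fun x => w (x, s)) y - w (y, s)
     - h ^+ 2 / 2 * \sum_(j <- r) generator w b s j y|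
    <= h ^+ 2 / 2 * ((size r)%:R ^+ 2 * ((1 + B) * eta)).
Proof.
move=> h0 B0 eta0 sw bB hB m1 m2; set th := fun j => - (h / 2) * b j.
set L := generator w b s.
have th1 j : -1 <= th j <= 1.
  rewrite -ler_norml /th mulNr normrN normrM ger0_norm ?divr_ge0 //.
  by apply: le_trans hB; rewrite ler_wpM2l ?divr_ge0.
have tau0 : 0 <= h ^+ 2 / 2 by rewrite divr_ge0 ?exprn_ge0.
have k0 : 0 <= (1 + B) * eta by rewrite mulr_ge0 ?addr_ge0.
elim: r => [|i r IH] /=.
  by rewrite big_nil mulr0 subr0 subrr normr0 expr0n mul0r mulr0.
have mw := markov_walk (fun j => h *: ev R j) r th1.
rewrite big_cons; set W := walk _ _ r in IH mw *.
pose E x := avg (th i) (h *: ev R i) (fun x => w (x, s)) x - w (x, s) - h ^+ 2 / 2 * L i x.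
have hE x : `|E x| <= h ^+ 2 / 2 * ((1 + B) * eta).
  apply: (@le_trans _ _ (h ^+ 2 / 2 * ((1 + `|b i|) * eta))).
    by apply: avg_taylor => //; auto.
  by rewrite ler_wpM2l // ler_wpM2r // lerD2l.
have hL : `|W (L i) y - L i y| <= (size r)%:R * ((1 + B) * eta).
  apply: walk_local => // z j.
  have key t : `|t| <= 3 * h -> `|L i (z + t *: ev R j) - L i z| <= (1 + B) * eta.
    move=> th3; have n1 := m1 i j z t th3; have n2 := m2 i j z t th3.
    rewrite /L /generator.
    move: ('D_(dx i) ('D_(dx i) w) (z + t *: ev R j, s)) ('D_(dx i) ('D_(dx i) w) (z, s)) n2 =>
      u1 u2 n2.
    move: ('D_(dx i) w (z + t *: ev R j, s)) ('D_(dx i) w (z, s)) n1 => v1 v2 n1.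
    have -> : u1 - b i * v1 - (u2 - b i * v2) = (u1 - u2) - b i * (v1 - v2) by ring.
    apply: le_trans (ler_normB _ _) _; rewrite [leRHS]mulrDl mul1r lerD // normrM.
    by apply: ler_pM.
  split; first by apply: key; rewrite ger0_norm //; lra.
  by rewrite -scaleNr; apply: key; rewrite normrN ger0_norm //; lra.
have -> : W (avg (th i) (h *: ev R i) (fun x => w (x, s))) y - w (y, s) - h ^+ 2 / 2 * (L i y +
  \sum_(j <- r) L j y)
  = W E y + h ^+ 2 / 2 * (W (L i) y - L i y) + (W (fun x => w (x, s)) y - w (y, s) - h ^+ 2 / 2 *
    \sum_(j <- r) L j y).
  have -> : W (avg (th i) (h *: ev R i) (fun x => w (x, s))) y = W (fun x => E x + (h ^+ 2 / 2 *
    L i x + w (x, s))) y.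
    by apply: markov_ext => // x; rewrite /E; ring.
  by rewrite markovD // markov_lin //; ring.
apply: le_trans (ler_normD _ _) _.
apply: le_trans (lerD (ler_normD _ _) IH) _.
have h3 : `|W E y| <= h ^+ 2 / 2 * ((1 + B) * eta) by apply: markov_norm_ub.
have h4 : `|h ^+ 2 / 2 * (W (L i) y - L i y)| <= h ^+ 2 / 2 * ((size r)%:R * ((1 + B) * eta)).
  by rewrite normrM (ger0_norm tau0) ler_wpM2l.
apply: le_trans (lerD (lerD h3 h4) (lexx _)) _.
rewrite -!mulrDr ler_wpM2l // -nat1r.
rewrite -[X in X + _ + _ <= _]mul1r -!mulrDl ler_wpM2r //.
have : 0 <= (size r)%:R :> R by exact: ler0n.
move: ((size r)%:R : R) => n n0; rewrite sqrrD; lra.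
Qed.

Lemma finite_threshold (n : nat) (P : 'I_n -> R -> Prop) :
  (forall j, exists2 del : R, 0 < del & forall h, 0 < h <= del -> P j h) ->
  exists2 del : R, 0 < del & forall j h, 0 < h <= del -> P j h.
Proof.
move=> hP.
have hP' j : exists del : R, 0 < del /\ forall h, 0 < h <= del -> P j h.
  by have [del ? ?] := hP j; exists del.
have [del hdel] := choice hP'.
exists (\big[Num.min/1]_j del j).
  by apply/bigmin_gtP; split=> // j _; have [] := hdel j.
move=> j h /andP[h0 hh]; have [_] := hdel j; apply; rewrite h0 /=.
by apply: le_trans hh _; apply: bigmin_le_cond.
Qed.

Lemma walk_consistency w (T B e : R) : smooth w -> periodic_x w -> 0 <= B -> 0 < e ->
  exists2 h0 : R, 0 < h0 & forall h, 0 < h <= h0 ->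
    h / 2 * B < 1 /\ forall y t (b : 'I_d -> R) (r : seq 'I_d),
    0 <= t -> t + h ^+ 2 / 2 <= T -> (forall j, `|b j| <= B) -> perm_eq r (enum 'I_d) ->
    `|walk (fun j => h *: ev R j) (fun j => - (h / 2) * b j) r (fun x => w (x, t + h ^+ 2 / 2)) y
       - w (y, t) - h ^+ 2 / 2 * ('D_(dt R d) w (y, t) + \sum_j generator w b t j y)|
     <= h ^+ 2 / 2 * e.
Proof.
move=> sw pw B0 e0.
(* Three errors: [d^2] from the walk, [d] from moving the generators from time [t + tau] to [t], and
   1 from the time derivative. *)
pose Cd : R := (d%:R ^+ 2 + d%:R) * (1 + B) + 1.
have Cd0 : 0 < Cd by rewrite ltr_wpDl // mulr_ge0 ?addr_ge0 ?exprn_ge0.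
pose eta := e / Cd.
have eta0 : 0 < eta by rewrite divr_gt0.
have s1 i := smooth_derive (dx i) sw.
have s2 i := smooth_derive (dx i) (s1 i).
have st := smooth_derive (dt R d) sw.
have p1 i := @periodic_x_derive w (dx i) pw.
have p2 i := @periodic_x_derive _ (dx i) (p1 i).
have pt := @periodic_x_derive w (dt R d) pw.
pose unifP (F : 'rV[R]_d * R -> R) (h : R) := forall x t y s, 0 <= t <= T ->
    `|y - x| <= 3 * h -> `|s - t| <= 3 * h -> `|F (y, s) - F (x, t)| <= eta.
have uF F : smooth F -> periodic_x F -> exists2 del : R, 0 < del & forall h, 0 < h <= del ->
  unifP F h.
  move=> sF pF; have [del del0 hd] := periodic_unif T (smooth_continuous sF) pF eta0.
  exists (del / 3) => [|h /andP[h0 hd3] x t y s tT yx st']; first by rewrite divr_gt0.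
  by rewrite ler_pdivlMr // mulrC in hd3; apply: hd => //; apply: le_trans hd3.
have [d1 d10 m1] := finite_threshold (fun j => uF _ (s1 j) (p1 j)).
have [d2 d20 m2] := finite_threshold (fun j => uF _ (s2 j) (p2 j)).
have [d3 d30 m3] := uF _ st pt.
exists (Num.min (Num.min d1 d2) (Num.min d3 (1 + B)^-1)).
  by rewrite !lt_min d10 d20 d30 invr_gt0 ltr_wpDr.
move=> h /andP[h0]; rewrite !le_min => /andP[/andP[hd1 hd2] /andP[hd3 hB]].
have B10 : 0 < 1 + B by rewrite ltr_wpDr.
have hB1 : h * (1 + B) <= 1 by rewrite -ler_pdivlMr // mul1r.
have hhB : h / 2 * B < 1.
  have : 0 <= h * B by rewrite mulr_ge0 // ltW.
  have -> : h / 2 * B = h * B / 2 by field.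
  by move: hB1 h0; rewrite mulrDr mulr1; move: (h * B) => z; lra.
split => // y t b r t0 tT bB rP.
have tau0 : 0 <= h ^+ 2 / 2 by rewrite divr_ge0 ?exprn_ge0 // ltW.
have h1 : h <= 1.
  by apply: le_trans hB _; rewrite invf_le1 // lerDl.
have tauh : h ^+ 2 / 2 <= 3 * h by nra.
have hd1' : 0 < h <= d1 by rewrite h0.
have hd2' : 0 < h <= d2 by rewrite h0.
have hd3' : 0 < h <= d3 by rewrite h0.
set s := t + h ^+ 2 / 2 in tT *.
have s0T : 0 <= s <= T by rewrite tT andbT addr_ge0.
have t0T : 0 <= t <= T by rewrite t0 (le_trans _ tT) // lerDl.
have shift_le (x : 'rV[R]_d) j t' : `|t'| <= 3 * h -> `|x + t' *: ev R j - x| <= 3 * h.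
  by rewrite addrAC subrr add0r; apply: le_trans; apply: norm_ev.
have ss : `|s - s| <= 3 * h by rewrite subrr normr0 mulr_ge0 // ltW.
have hw := @walk_taylor w s b r h B eta y (ltW h0) B0 (ltW eta0) sw bB (ltW hhB)
  (fun i j x t' t'h => m1 i h hd1' _ _ _ _ s0T (shift_le x j t' t'h) ss)
  (fun i j x t' t'h => m2 i h hd2' _ _ _ _ s0T (shift_le x j t' t'h) ss).
rewrite (perm_big _ rP) /= big_enum /= in hw.
have sr : size r = d by rewrite (perm_size rP) size_enum_ord.
rewrite sr in hw.
have ht : exists2 xi : R, `|xi| <= `|h ^+ 2 / 2| & w (y, s) - w (y, t) = h ^+ 2 / 2 * 'D_(dt R d)
  w (y, t + xi).
  have dw z : derivable w z (dt R d) by exact: smooth_derivable.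
  have [xi xih E] := mvt_dir (y, t) (h ^+ 2 / 2) dw.
  by exists xi => //; rewrite !add_dt in E.
have [xi xih E] := ht; rewrite (ger0_norm tau0) in xih.
have yy : `|y - y| <= 3 * h by rewrite subrr normr0 mulr_ge0 // ltW.
have txi : `|t + xi - t| <= 3 * h by rewrite addrAC subrr add0r; apply: le_trans tauh.
have n0 := m3 h hd3' y t y (t + xi) t0T yy txi.
have nL : `|\sum_j generator w b s j y - \sum_j generator w b t j y| <= d%:R * ((1 + B) * eta).
  rewrite -sumrB; apply: le_trans (ler_norm_sum _ _ _) _.
  rewrite -[d in d%:R]card_ord mulr_natl -sumr_const; apply: ler_sum => j _.
  have st3 : `|s - t| <= 3 * h by rewrite /s addrAC subrr add0r ger0_norm.
  have n1 := m1 j h hd1' y t y s t0T yy st3; have n2 := m2 j h hd2' y t y s t0T yy st3.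
  rewrite /generator.
  move: ('D_(dx j) ('D_(dx j) w) (y, s)) ('D_(dx j) ('D_(dx j) w) (y, t)) n2 => u1 u2 n2.
  move: ('D_(dx j) w (y, s)) ('D_(dx j) w (y, t)) n1 => v1 v2 n1.
  have -> : u1 - b j * v1 - (u2 - b j * v2) = (u1 - u2) - b j * (v1 - v2) by ring.
  apply: le_trans (ler_normB _ _) _; rewrite [leRHS]mulrDl mul1r lerD // normrM.
  by apply: ler_pM.
move: hw; set W := walk _ _ _ _ _ => hw.
move: hw nL; set S1 := \sum_j generator w b s j y; set S2 := \sum_j generator w b t j y => hw nL.
have -> : W - w (y, t) - h ^+ 2 / 2 * ('D_(dt R d) w (y, t) + S2)
  = (W - w (y, s) - h ^+ 2 / 2 * S1) + h ^+ 2 / 2 * (S1 - S2)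
    + h ^+ 2 / 2 * ('D_(dt R d) w (y, t + xi) - 'D_(dt R d) w (y, t)).
  have -> : W - w (y, t) = W - w (y, s) + (w (y, s) - w (y, t)) by ring.
  by rewrite E; ring.
apply: le_trans (ler_normD _ _) _; apply: le_trans (lerD (ler_normD _ _) (lexx _)) _.
rewrite !(normrM (h ^+ 2 / 2)) (ger0_norm tau0).
apply: le_trans (lerD (lerD hw (ler_wpM2l tau0 nL)) (ler_wpM2l tau0 n0)) _.
rewrite -!mulrDr ler_wpM2l //.
have -> : d%:R ^+ 2 * ((1 + B) * eta) + d%:R * ((1 + B) * eta) + eta = Cd * eta by rewrite /Cd;
  ring.
by rewrite /eta mulrC divfK ?gt_eqF.
Qed.

End Consistency.

(** * The grid as a subset of the torus *)

Section Embedding.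
Variables (R : realType) (d k : nat).
Local Notation h := (step R k).
Implicit Types (G : 'rV[R]_d -> R) (x : grid d k).

Definition pos x : 'rV[R]_d := \row_j ((x 0 j : nat)%:R * h).

(** [b] tells whether the step wraps around the cycle; the position then falls back by exactly one
    period. *)
Lemma pos_add x i : exists b : bool, pos (x + unit_vec k i) + b%:R *: ev R i = pos x + h *: ev R i.
Proof.
exists ((x 0 i : nat).+1 == k.*2.+3); apply/rowP => j.
have xe : (x + unit_vec k i) 0 j = x 0 j + (j == i)%:R by rewrite mxE unit_vecE.
have -> : (pos (x + unit_vec k i) + ((x 0 i : nat).+1 == k.*2.+3)%:R *: ev R i) 0 j
  = (nat_of_ord (x 0 j + (j == i)%:R)%R)%:R * h + ((x 0 i : nat).+1 == k.*2.+3)%:R * (j == i)%:R.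
  by rewrite mxE [pos _ 0 j]mxE xe mxE evE.
have -> : (pos x + h *: ev R i) 0 j = (x 0 j : nat)%:R * h + h * (j == i)%:R.
  by rewrite mxE [pos _ 0 j]mxE mxE evE.
case: (eqVneq j i) => [->|ji] /=; last by rewrite !mulr0 !addr0 addn0 modn_small.
rewrite !mulr1; have xi := ltn_ord (x 0 i).
rewrite [(1 %% _)%N]modn_small // addn1.
case: eqVneq => [xN|xn].
  rewrite xN modnn mul0r add0r; transitivity (k.*2.+3%:R * h); first by rewrite mulfV // pnatr_eq0.
  have -> : (k.*2.+3%:R : R) = (x 0 i : nat)%:R + 1 by rewrite natr1 xN.
  by rewrite mulrDl mul1r.
by rewrite modn_small ?addr0 -?natr1 ?mulrDl ?mul1r //; lia.
Qed.

Lemma torus_pos_add G x i : torus_periodic G -> G (pos (x + unit_vec k i)) = G (pos x + h *: ev R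
  i).
Proof.
move=> pG; have [b <-] := pos_add x i; case: b; first by rewrite scale1r pG.
by rewrite scale0r addr0.
Qed.

Lemma torus_pos_sub G x i : torus_periodic G -> G (pos (x - unit_vec k i)) = G (pos x - h *: ev R
  i).
Proof.
move=> pG; have := @torus_pos_add (fun y => G (y - h *: ev R i)) (x - unit_vec k i) i _.
rewrite addrNK addrK => -> // y j; by rewrite addrAC pG.
Qed.

Lemma torus_avg (th : R) i G : torus_periodic G -> torus_periodic (avg th (h *: ev R i) G).
Proof. by move=> pG y j; rewrite /avg !(addrAC y (ev R j)) !pG. Qed.

Lemma walk_pos (th : 'I_d -> R) (r : seq 'I_d) G x : torus_periodic G ->
  (forall j, -1 <= th j <= 1) ->
  walk (@unit_vec d k) th r (fun y => G (pos y)) x = walk (fun j => h *: ev R j) th r G (pos x).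
Proof.
move=> pG th1; elim: r G pG => [|i r IH] G pG //=.
rewrite -IH; last exact: torus_avg.
apply: markov_ext; first exact: markov_walk.
by move=> y; rewrite /avg torus_pos_add // torus_pos_sub.
Qed.

Lemma dquo_pos i G x : torus_periodic G ->
  dquo (unit_vec k i + unit_vec k i) (2 * h) (fun y => G (pos y)) x
    = (G (pos x + (2 * h) *: ev R i) - G (pos x)) / (2 * h).
Proof.
move=> pG; rewrite /dquo; congr ((_ - _) / _).
rewrite addrA torus_pos_add // (@torus_pos_add (fun y => G (y + h *: ev R i))).
  by rewrite -addrA -scalerDl mulr_natl.
by move=> y j; rewrite addrAC pG.
Qed.

End Embedding.

Section MoreSmooth.
Variables (R : realType).

Lemma smooth_schwarz (V : normedModType R) (f : V -> R) a b : smooth f ->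
  'D_b ('D_a f) = 'D_a ('D_b f).
Proof.
move=> sf; have sa := smooth_derive a sf; have sb := smooth_derive b sf.
apply: schwarz; try by move=> y; apply: smooth_derivable.
  exact: smooth_continuous (smooth_derive _ _).
exact: smooth_continuous (smooth_derive _ _).
Qed.

Lemma smooth_schwarzE (V : normedModType R) (f : V -> R) a b z : smooth f ->
  'D_b ('D_a f) z = 'D_a ('D_b f) z.
Proof. by move=> /(smooth_schwarz a b) /(congr1 (fun F => F z)). Qed.

Lemma is_derive_of_line (V : normedModType R) (F : V -> R) z a l :
  is_derive (0 : R) (1 : R) (fun s : R => F (z + s *: a)) l -> is_derive z a F l.
Proof.
move=> /is_deriveP hl; apply/is_deriveP.
rewrite (_ : (fun s => _) = (fun s : R => s^-1 * (F (z + (0 + s *: (1 : R)) *: a) - F (z + 0 *: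
  a)))) //.
by apply/funext => s; rewrite scale0r addr0 add0r [s *: (1 : R)]mulr1.
Qed.

Lemma is_derive_increment (V : normedModType R) (F : V -> R) z a l :
  is_derive z a F l -> is_derive (0 : R) (1 : R) (fun s : R => F (z + s *: a) - F z) l.
Proof.
move=> dF; rewrite -[l]subr0; apply: is_deriveB.
by apply: is_derive_line; rewrite scale0r addr0.
Qed.

Lemma smooth_is_derive_schwarz (V : normedModType R) (f : V -> R) a b z : smooth f ->
  is_derive z a ('D_b f) ('D_b ('D_a f) z).
Proof.
move=> sf; rewrite (smooth_schwarzE a b z sf).
exact: smooth_is_derive (smooth_derive _ sf).
Qed.

Lemma continuous_bigsum (T : topologicalType) (V : normedModType R) (J : Type) (r : seq J) (f : J
  -> T -> V) :
  (forall j, continuous (f j)) -> continuous (fun z => \sum_(j <- r) f j z).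
Proof.
move=> cf; elim: r => [|j r IH] z.
  rewrite (_ : (fun z => _) = cst 0); first exact: cvg_cst.
  by apply/funext => y; rewrite big_nil.
rewrite (_ : (fun z => _) = (fun z => f j z + \sum_(i <- r) f i z)); last first.
  by apply/funext => y; rewrite big_cons.
by apply: cvgD; [exact: cf | exact: IH].
Qed.

Lemma continuous_row (T : topologicalType) (d : nat) (f : 'I_d -> T -> R) :
  (forall j, continuous (f j)) -> continuous (fun z => \row_j f j z).
Proof.
move=> cf; rewrite (_ : (fun z => _) = (fun z => \sum_j f j z *: ev R j)).
  by apply: continuous_bigsum => j z; apply: cvgZr_tmp; exact: cf.
by apply/funext => z; rewrite [LHS]row_sum_delta; apply: eq_bigr => j _; rewrite mxE.
Qed.

End MoreSmooth.

(** * The differentiated Hamilton-Jacobi equation *)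

Section Hamiltonian.
Variables (R : realType) (d : nat) (H : 'rV[R]_d * 'rV[R]_d -> R) (u : 'rV[R]_d * R -> R).
Hypotheses (sH : smooth H) (pH : periodic_H H) (su : smooth u) (pu : periodic_x u).
Local Notation dx := (@dx R d).
Implicit Types z : 'rV[R]_d * R.

Let su1 a : smooth ('D_a u) := smooth_derive a su.

(** For a solution this is the source on the time interval. Written through [u] and [H], it inherits
    continuity, periodicity and an x-derivative on all of space-time. *)
Definition hjb z : R := - 'D_(dt R d) u z - Lap u z + H (z.1, Dx u z).
Definition drift z j : R := DpH H z.1 (Dx u z) 0 j.
Definition hjb_x i z : R := - 'D_(dt R d) ('D_(dx i) u) z - Lap ('D_(dx i) u) z
  + (DxH H z.1 (Dx u z) 0 i + \sum_j drift z j * 'D_(dx j) ('D_(dx i) u) z).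

Lemma continuous_jet : continuous (fun z => (z.1, Dx u z)).
Proof.
move=> z; apply: (@cvg_pair _ _ _ _ (nbhs z.1) (nbhs (Dx u z))).
  exact: cvg_fst.
by apply: continuous_row => j; exact: smooth_continuous (su1 _).
Qed.

Lemma continuous_on_jet (G : 'rV[R]_d * 'rV[R]_d -> R) : continuous G ->
  continuous (fun z => G (z.1, Dx u z)).
Proof.
move=> cG z.
by apply: continuous_comp; [exact: continuous_jet | exact: cG].
Qed.

Lemma continuous_drift j : continuous (drift ^~ j).
Proof.
rewrite (_ : drift ^~ j = fun z => 'D_(dP R j) H (z.1, Dx u z)).
  exact: continuous_on_jet (smooth_continuous (smooth_derive _ sH)).
by apply/funext => z; rewrite /drift mxE.
Qed.

Lemma continuous_Lap (w : 'rV[R]_d * R -> R) : smooth w -> continuous (Lap w).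
Proof.
move=> sw; apply: continuous_bigsum => j.
exact: smooth_continuous (smooth_derive _ (smooth_derive _ sw)).
Qed.

Lemma continuous_hjb_x i : continuous (hjb_x i).
Proof.
have c1 : continuous ('D_(dt R d) ('D_(dx i) u)) := smooth_continuous (smooth_derive _ (su1 _)).
have c2 := continuous_Lap (su1 (dx i)).
have c3 : continuous (fun z => DxH H z.1 (Dx u z) 0 i).
  rewrite (_ : (fun z => _) = fun z => 'D_(dX R i) H (z.1, Dx u z)).
    exact: continuous_on_jet (smooth_continuous (smooth_derive _ sH)).
  by apply/funext => z; rewrite mxE.
have c4 : continuous (fun z => \sum_j drift z j * 'D_(dx j) ('D_(dx i) u) z).
  apply: continuous_bigsum => j z; apply: cvgM; first exact: continuous_drift.
  exact: smooth_continuous (smooth_derive _ (su1 _)) z.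
move=> z; apply: cvgD; first by apply: cvgB; [apply: cvgN; exact: c1 | exact: c2].
by apply: cvgD; [exact: c3 | exact: c4].
Qed.

Lemma continuous_hjb : continuous hjb.
Proof.
have c1 : continuous ('D_(dt R d) u) := smooth_continuous (su1 _).
have c2 := continuous_Lap su.
have c3 := continuous_on_jet (smooth_continuous sH).
by move=> z; apply: cvgD; [apply: cvgB; [apply: cvgN; exact: c1 | exact: c2] | exact: c3].
Qed.

Lemma Dx_periodic x t i : Dx u (x + ev R i, t) = Dx u (x, t).
Proof. by apply/rowP => j; rewrite !mxE (periodic_x_derive (dx j) pu). Qed.

Lemma periodic_H_derive v : periodic_H ('D_v H).
Proof.
move=> x p i; rewrite /derive.
rewrite (_ : (fun h : R => _) = (fun h => h^-1 *: ((H \o shift (x, p)) (h *: v) - H (x, p)))) //.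
apply/funext => h /=; rewrite pH; congr (_ *: (_ - _)).
rewrite /shift /=; case: (h *: v) => a b.
by rewrite -[RHS](pH _ _ i); congr (H (_, _)); rewrite /= addrA.
Qed.

Lemma Lap_periodic (w : 'rV[R]_d * R -> R) : periodic_x w -> periodic_x (Lap w).
Proof.
move=> pw x t i; apply: eq_bigr => j _.
by rewrite (periodic_x_derive (dx j) (periodic_x_derive (dx j) pw)).
Qed.

Lemma driftE z j : drift z j = 'D_(dP R j) H (z.1, Dx u z).
Proof. by rewrite /drift mxE. Qed.

Lemma DxHE z i : DxH H z.1 (Dx u z) 0 i = 'D_(dX R i) H (z.1, Dx u z).
Proof. by rewrite mxE. Qed.

Lemma periodic_on_jet (G : 'rV[R]_d * 'rV[R]_d -> R) : periodic_H G ->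
  periodic_x (fun z => G (z.1, Dx u z)).
Proof.
by move=> pG x t i; transitivity (G (x + ev R i, Dx u (x, t))); [rewrite Dx_periodic | exact: pG].
Qed.

Lemma drift_periodic j : periodic_x (drift ^~ j).
Proof.
move=> x t i; refine (etrans (driftE _ j) (etrans _ (esym (driftE _ j)))).
exact: (periodic_on_jet (periodic_H_derive (dP R j))).
Qed.

Lemma periodic_xD (f g : 'rV[R]_d * R -> R) : periodic_x f -> periodic_x g ->
  periodic_x (fun z => f z + g z).
Proof. by move=> pf pg x t i; rewrite pf pg. Qed.

Lemma periodic_xN (f : 'rV[R]_d * R -> R) : periodic_x f -> periodic_x (fun z => - f z).
Proof. by move=> pf x t i; rewrite pf. Qed.

Lemma hjb_periodic : periodic_x hjb.
Proof.
apply: periodic_xD (periodic_on_jet pH).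
apply: periodic_xD (periodic_xN (Lap_periodic pu)).
exact: periodic_xN (periodic_x_derive (dt R d) pu).
Qed.

Lemma hjb_x_periodic i : periodic_x (hjb_x i).
Proof.
have pi := @periodic_x_derive _ _ u (dx i) pu.
apply: periodic_xD.
  apply: periodic_xD (periodic_xN (Lap_periodic pi)).
  exact: periodic_xN (periodic_x_derive (dt R d) pi).
apply: periodic_xD => x t l.
  refine (etrans (DxHE _ i) (etrans _ (esym (DxHE _ i)))).
  exact: (periodic_on_jet (periodic_H_derive (dX R i))).
apply: eq_bigr => j _.
exact: (f_equal2 *%R (drift_periodic j x t l) (periodic_x_derive (dx j) pi x t l)).
Qed.

Lemma is_derive_hjb i z : is_derive z (dx i) hjb (hjb_x i z).
Proof.
have e1 : is_derive z (dx i) ('D_(dt R d) u) ('D_(dt R d) ('D_(dx i) u) z).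
  exact: smooth_is_derive_schwarz.
have e2 : is_derive z (dx i) (Lap u) (Lap ('D_(dx i) u) z).
  have -> : Lap u = \sum_j 'D_(dx j) ('D_(dx j) u).
    by apply/funext => y; rewrite fct_sumE.
  have -> : Lap ('D_(dx i) u) z = \sum_j 'D_(dx i) ('D_(dx j) ('D_(dx j) u)) z.
    apply: eq_bigr => j _.
    exact: (etrans (congr1 (fun F => 'D_(dx j) F z) (smooth_schwarz (dx i) (dx j) su))
                   (smooth_schwarzE (dx i) (dx j) z (su1 (dx j)))).
  apply: is_derive_sum => j; exact: smooth_is_derive (smooth_derive _ (su1 _)).
have e3 : is_derive z (dx i) (fun z => H (z.1, Dx u z))
    (DxH H z.1 (Dx u z) 0 i + \sum_j drift z j * 'D_(dx j) ('D_(dx i) u) z).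
  apply: is_derive_of_line.
  (* [None] is the direct dependence of [H] on x_i, and [Some j] its dependence through the j-th
     component of [Dx u]. *)
  pose a (o : option 'I_d) := if o is Some j then dP R j else dX R i.
  pose c (o : option 'I_d) (s : R) := if o is Some j then 'D_(dx j) u (z + s *: dx i) - 'D_(dx j)
    u z else s.
  pose c' (o : option 'I_d) := if o is Some j then 'D_(dx j) ('D_(dx i) u) z else 1.
  have dH o y : derivable H y (a o) by exact: smooth_derivable.
  have cH o : continuous ('D_(a o) H) := smooth_continuous (smooth_derive _ sH).
  have c0 o : c o 0 = 0 by case: o => [j|] //=; rewrite scale0r addr0 subrr.
  have dc o : is_derive (0 : R) (1 : R) (c o) (c' o).
    case: o => [j|] /=; last exact: is_derive_id.
    exact: is_derive_increment (smooth_is_derive_schwarz (dx i) (dx j) z su).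
  have key := is_derive_path_sum (None :: [seq Some j | j <- index_enum 'I_d]) (z.1, Dx u z) dH
    cH c0 dc.
  have el : DxH H z.1 (Dx u z) 0 i + \sum_j drift z j * 'D_(dx j) ('D_(dx i) u) z
    = \sum_(o <- None :: [seq Some j | j <- index_enum 'I_d]) c' o * 'D_(a o) H (z.1, Dx u z).
    rewrite big_cons big_map; congr (_ + _).
      by refine (etrans (DxHE z i) (esym (mul1r _))).
    apply: eq_bigr => j _; refine (etrans (congr1 (fun q => q * _) (driftE z j)) (mulrC _ _)).
  have eF : (fun s : R => H ((z + s *: dx i).1, Dx u (z + s *: dx i)))
     = (fun s : R => H ((z.1, Dx u z) + \sum_(o <- None :: [seq Some j | j <- index_enum 'I_d]) c
       o s *: a o)).
    apply/funext => s; congr H; rewrite big_cons big_map.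
    have -> : \sum_(j <- index_enum 'I_d) c (Some j) s *: a (Some j)
      = (0, \sum_j ('D_(dx j) u (z + s *: dx i) - 'D_(dx j) u z) *: ev R j).
      rewrite /c /a; elim: (index_enum _) => [|j q IH]; first by rewrite !big_nil.
      rewrite !big_cons IH /dP; congr (_, _); by rewrite /= scaler0 addr0.
    congr (_, _); first by rewrite /= addr0.
    apply/rowP => j; rewrite /= scaler0 add0r !mxE summxE (bigD1 j) //= big1 => [|l lj].
      by rewrite mxE evE eqxx mulr1 addr0 addrC subrK.
    by rewrite mxE evE eq_sym (negbTE lj) mulr0.
  exact: (eq_rect_r (fun F => is_derive (0 : R) (1 : R) F _) (eq_rect_r (fun l => is_derive (0 :
    R) (1 : R) _ l) key el) eF).
exact: (is_deriveD (is_deriveB (is_deriveN e1) e2) e3).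
Qed.

End Hamiltonian.

Section PowerNorm.
Variable R : realType.

Lemma continuous_norm_powR (p : R) : 0 < p -> continuous (fun a : R => `|a| `^ p).
Proof.
move=> p0 a; have [->|a0] := eqVneq a 0.
  apply/cvgrPdist_le => e e0; rewrite normr0 powR0 ?gt_eqF //.
  have ep : 0 < e `^ p^-1 by exact: powR_gt0.
  apply/nbhs_normP; exists (e `^ p^-1) => // b /=; rewrite !sub0r !normrN => be.
  rewrite ger0_norm ?powR_ge0 //.
  have -> : e = (e `^ p^-1) `^ p by rewrite -powRrM mulVf ?gt_eqF // powRr1 // ltW.
  by apply: ge0_ler_powR; rewrite ?nnegrE // ?ltW.
apply: (@continuous_comp _ _ _ (fun a : R => `|a|) (fun b => b `^ p)).
  exact: norm_continuous.
apply: differentiable_continuous; apply/derivable1_diffP.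
by apply: derivable_powR; rewrite in_itv /= andbT normr_gt0.
Qed.

(** Superadditivity of the power lets [G + 1] in place of [G] absorb a unit error of the Riemann
    sums. *)
Lemma powR_add1 (a p : R) : 0 <= a -> 1 <= p -> a `^ p + 1 <= (a + 1) `^ p.
Proof.
move=> a0 p1; have p0 : 0 < p by apply: lt_le_trans p1.
have q0 : 0 <= p - 1 by lra.
have a1 : 0 <= a + 1 by lra.
rewrite -(mulr_powRB1 a0 p0) -(mulr_powRB1 a1 p0) mulrDl mul1r lerD //.
  by rewrite ler_wpM2l // ge0_ler_powR ?nnegrE // lerDl.
apply: (@le_trans _ _ (1 `^ (p - 1))); first by rewrite powR1.
by rewrite ge0_ler_powR ?nnegrE // lerDr.
Qed.

End PowerNorm.

(** * Riemann sums of iterated integrals *)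

Section IteratedIntegral.
Variable R : realType.
Local Notation mu := (@lebesgue_measure R).

(** Uniform continuity survives both freezing a coordinate and integrating the others out, which
    keeps the inductions on the dimension going. *)
Definition ucont (V W : normedModType R) (F : V -> W) := forall e : R, 0 < e ->
  exists2 del : R, 0 < del & forall x y, `|x - y| <= del -> `|F x - F y| <= e.

Lemma ucont_continuous (V W : normedModType R) (F : V -> W) : ucont F -> continuous F.
Proof.
move=> uF x; apply/cvgrPdist_le => e e0; have [del del0 h] := uF e e0.
apply/nbhs_ballP; exists del => // y; rewrite -ball_normE /= => xy.
by apply: h; exact: ltW.
Qed.

Lemma unitIE : @unitI R = `[0, 1]%classic.
Proof. by apply/seteqP; split => x /=; rewrite in_itv. Qed.

Lemma measurable_unitI : measurable (@unitI R).
Proof. by rewrite unitIE; exact: measurable_itv. Qed.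

Lemma integrable_unitI (f : R -> R) : continuous f -> mu.-integrable (@unitI R) (EFin \o f).
Proof.
move=> cf; rewrite unitIE; apply: continuous_compact_integrable; first exact: segment_compact.
exact: continuous_subspaceT.
Qed.

Lemma Rintegral_unitI_cst (c : R) : Rintegral mu (@unitI R) (fun=> c) = c.
Proof.
rewrite Rintegral_cst; last exact: measurable_unitI.
by rewrite unitIE /= lebesgue_measure_itv /= lte_fin ltr01 -EFinB subr0 mulr1.
Qed.

Lemma Rintegral_unitI_dist (f g : R -> R) (e : R) : continuous f -> continuous g ->
  (forall x, `|f x - g x| <= e) ->
  `|Rintegral mu (@unitI R) f - Rintegral mu (@unitI R) g| <= e.
Proof.
move=> cf cg fg; have mI := measurable_unitI.
have If := integrable_unitI cf; have Ig := integrable_unitI cg.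
have key (f1 g1 : R -> R) : continuous f1 -> continuous g1 -> (forall x, f1 x <= g1 x + e) ->
    Rintegral mu (@unitI R) f1 <= Rintegral mu (@unitI R) g1 + e.
  move=> c1 c2 h; rewrite -[e in leRHS]Rintegral_unitI_cst -RintegralD //.
  - apply: le_Rintegral => //; first exact: integrable_unitI.
    by apply: integrable_unitI => x; apply: cvgD; [exact: c2 | exact: cvg_cst].
  - exact: integrable_unitI.
  - apply: integrable_unitI; exact: cst_continuous.
rewrite ler_distl; apply/andP; split.
  rewrite lerBlDr; apply: key => // x; have := fg x; rewrite ler_distl; lra.
by apply: key => // x; have := fg x; rewrite ler_distl; lra.
Qed.

Definition row_cons n (t : R) (y : 'rV[R]_n) : 'rV[R]_n.+1 :=
  \row_(i < n.+1) match unlift ord0 i with Some j => y 0 j | None => t end.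

Lemma row_cons_dist n (t s : R) (y z : 'rV[R]_n) (e : R) :
  `|t - s| <= e -> `|y - z| <= e -> `|row_cons t y - row_cons s z| <= e.
Proof.
move=> ts yz; have e0 : 0 <= e by apply: le_trans ts.
rewrite [leLHS]/Num.norm /= mx_normrE; apply/bigmax_leP; split => // -[a i] _ /=.
rewrite !mxE; case: unliftP => [j _|_] //.
apply: le_trans yz; rewrite [leRHS]/Num.norm /= mx_normrE.
have := @le_bigmax _ _ _ 0 (fun i : 'I_1 * 'I_n => `|(y - z) i.1 i.2|) (0, j).
by rewrite /= !mxE.
Qed.

Lemma iintS n (F : 'rV[R]_n.+1 -> R) :
  iint (@unitI R) F = Rintegral mu (@unitI R) (fun t => iint (@unitI R) (fun y : 'rV[R]_n => F
    (row_cons t y))).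
Proof. by []. Qed.

Lemma ucont_row_cons n (F : 'rV[R]_n.+1 -> R) t : ucont F -> ucont (fun y => F (row_cons t y)).
Proof.
move=> uF e e0; have [del del0 h] := uF e e0; exists del => // x y xy; apply: h.
by apply: row_cons_dist => //; rewrite subrr normr0 ltW.
Qed.

Lemma iint_dist n (F G : 'rV[R]_n -> R) (e : R) : ucont F -> ucont G ->
  (forall x, `|F x - G x| <= e) -> `|iint (@unitI R) F - iint (@unitI R) G| <= e.
Proof.
elim: n F G e => [|n IH] F G e uF uG FG; first exact: FG.
have c H : ucont H -> continuous (fun t => iint (@unitI R) (fun y : 'rV[R]_n => H (row_cons t y))).
  move=> uH; apply: (@ucont_continuous R^o R^o) => r r0; have [del del0 h] := uH r r0.
  exists del => // t s ts; apply: IH; try exact: ucont_row_cons.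
  move=> y; apply: h; apply: row_cons_dist => //; by rewrite subrr normr0 ltW.
rewrite !iintS; apply: Rintegral_unitI_dist; try exact: c.
by move=> t; apply: IH; [exact: ucont_row_cons | exact: ucont_row_cons | move=> y; exact: FG].
Qed.

Lemma iint_continuous n (F : 'rV[R]_n.+1 -> R) : ucont F ->
  continuous (fun t => iint (@unitI R) (fun y : 'rV[R]_n => F (row_cons t y))).
Proof.
move=> uH; apply: (@ucont_continuous R^o R^o) => r r0; have [del del0 h] := uH r r0.
exists del => // t s ts; apply: iint_dist; try exact: ucont_row_cons.
move=> y; apply: h; apply: row_cons_dist => //; by rewrite subrr normr0 ltW.
Qed.

Lemma iint_cst n (c : R) : iint (@unitI R) (fun _ : 'rV[R]_n => c) = c.
Proof.
elim: n => // n IH; rewrite iintS (_ : (fun t => _) = fun=> c) ?Rintegral_unitI_cst //.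
by apply/funext => t.
Qed.

Lemma iint_ge0 (A : set R) n (F : 'rV[R]_n -> R) : (forall x, 0 <= F x) -> 0 <= iint A F.
Proof.
elim: n F => [|n IH] F F0; first exact: F0.
by apply: Rintegral_ge0 => t _; apply: IH.
Qed.

Lemma Rintegral_riemann N (f : R -> R) (e : R) : (0 < N)%N -> continuous f ->
  (forall x y, `|x - y| <= N%:R^-1 -> `|f x - f y| <= e) ->
  \sum_(j < N) f (j%:R / N%:R) <= N%:R * (Rintegral mu (@unitI R) f + e).
Proof.
move=> N0 cf fe; have N0' : 0 < N%:R :> R by rewrite ltr0n.
have If a b : mu.-integrable `[a, b]%classic (EFin \o f).
  by apply: continuous_compact_integrable; [exact: segment_compact | exact: continuous_subspaceT].
suff h m : (m <= N)%N -> \sum_(j < m) (f (j%:R / N%:R) - e)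
    <= N%:R * Rintegral mu `[0, m%:R / N%:R]%classic f.
  have := h N (leqnn N); rewrite divff ?gt_eqF // -unitIE => {}h.
  rewrite mulrDr -lerBlDr; apply: le_trans h.
  by rewrite sumrB sumr_const card_ord mulr_natl.
elim: m => [|m IH] mN.
  by rewrite big_ord0 mul0r set_itv1 Rintegral_set1 mulr0.
rewrite big_ord_recr /=; apply: le_trans (lerD (IH (ltnW mN)) (lexx _)) _.
rewrite -lerBrDl -mulrBr.
have mm : m%:R / N%:R <= m.+1%:R / N%:R :> R by rewrite ler_pM2r ?invr_gt0 // ler_nat.
rewrite (Rintegral_itvB (If _ _)) ?bnd_simp ?divr_ge0 ?ler0n //.
rewrite -ler_pdivrMl // mulrC.
have d1 : m.+1%:R / N%:R - m%:R / N%:R = N%:R^-1 :> R by rewrite -mulrBl -natr1 addrAC subrr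
  add0r mul1r.
have -> : (f (m%:R / N%:R) - e) / N%:R = Rintegral mu `]m%:R / N%:R, m.+1%:R / N%:R]%classic
  (fun=> f (m%:R / N%:R) - e).
  rewrite Rintegral_cst; last exact: measurable_itv.
  rewrite /= lebesgue_measure_itv /= lte_fin ltr_pM2r ?invr_gt0 // ltr_nat ltnSn /=.
  by rewrite d1.
have sub : `](m%:R / N%:R : R), m.+1%:R / N%:R]%classic `<=` `[(m%:R / N%:R : R), m.+1%:R /
  N%:R]%classic.
  by move=> x /=; rewrite !in_itv /= => /andP[/ltW -> ->].
have I2 g : mu.-integrable `[m%:R / N%:R, m.+1%:R / N%:R]%classic (EFin \o g) ->
    mu.-integrable `]m%:R / N%:R, m.+1%:R / N%:R]%classic (EFin \o g).
  by apply: integrableS => //; exact: measurable_itv.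
apply: le_Rintegral; first exact: measurable_itv.
- apply: I2; apply: continuous_compact_integrable; first exact: segment_compact.
  apply: continuous_subspaceT; exact: cst_continuous.
- exact: I2.
move=> x /=; rewrite in_itv /= => /andP[x1 x2].
have : `|f x - f (m%:R / N%:R)| <= e.
  apply: fe; rewrite ger0_norm ?subr_ge0 ?(ltW x1) //.
  by apply: le_trans (lerB x2 (lexx _)) _; rewrite d1.
by rewrite ler_distl; lra.
Qed.

(** Each coordinate costs one oscillation [e], which the partial integrals inherit from [F]. *)
Lemma iint_riemann n k (F : 'rV[R]_n -> R) (e : R) : ucont F ->
  (forall x y, `|x - y| <= k.+1%:R^-1 -> `|F x - F y| <= e) ->
  \sum_(z : 'rV['I_k.+1]_n) F (\row_j ((z 0 j : nat)%:R / k.+1%:R))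
    <= k.+1%:R ^+ n * (iint (@unitI R) F + n%:R * e).
Proof.
elim: n F => [|n IH] F uF Fe.
  rewrite expr0 mul1r mul0r addr0 (big_pred1 0) => [|z].
    by rewrite (_ : \row_j _ = 0) //; apply/rowP => -[].
  by apply/esym/eqP/rowP => -[].
have e0 : 0 <= e.
  by apply: le_trans (Fe 0 0 _); rewrite ?subrr ?normr0 // invr_ge0.
pose I t := iint (@unitI R) (fun y : 'rV[R]_n => F (row_cons t y)).
have dI x y : `|x - y| <= k.+1%:R^-1 -> `|I x - I y| <= e.
  move=> xy; apply: iint_dist; try exact: ucont_row_cons.
  by move=> z; apply: Fe; apply: row_cons_dist => //; rewrite subrr normr0 invr_ge0.
pose up (p : 'I_k.+1 * 'rV['I_k.+1]_n) : 'rV['I_k.+1]_n.+1 :=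
  \row_i match unlift ord0 i with Some j => p.2 0 j | None => p.1 end.
pose dn (z : 'rV['I_k.+1]_n.+1) : 'I_k.+1 * 'rV['I_k.+1]_n := (z 0 ord0, \row_j z 0 (lift ord0 j)).
have updn : cancel dn up.
  by move=> z; apply/rowP => i; rewrite mxE /=; case: unliftP => [j ->|->] //; rewrite mxE.
have dnup : cancel up dn.
  move=> [a z]; rewrite /dn mxE unlift_none; congr (_, _).
  by apply/rowP => j; rewrite !mxE liftK.
rewrite (reindex up); last by exists dn => z _; [exact: dnup | exact: updn].
have -> : \sum_p F (\row_j ((up p 0 j : nat)%:R / k.+1%:R))
  = \sum_(a < k.+1) \sum_(z : 'rV['I_k.+1]_n) F (row_cons ((a : nat)%:R / k.+1%:R) (\row_j ((z 0
    j : nat)%:R / k.+1%:R))).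
  rewrite pair_bigA /=; apply: eq_bigr => -[a z] _; congr F; apply/rowP => i.
  by rewrite !mxE /=; case: unliftP => [j _|_] //; rewrite mxE.
apply: (@le_trans _ _ (\sum_(a < k.+1) k.+1%:R ^+ n * (I ((a : nat)%:R / k.+1%:R) + n%:R * e))).
  apply: ler_sum => a _; apply: IH; first exact: ucont_row_cons.
  move=> x y xy; apply: Fe; apply: row_cons_dist => //; by rewrite subrr normr0 invr_ge0.
rewrite iintS -/I -mulr_sumr (exprSr _ n) -mulrA ler_wpM2l ?exprn_ge0 //.
have -> : \sum_(a < k.+1) (I ((a : nat)%:R / k.+1%:R) + n%:R * e)
   = \sum_(a < k.+1) I ((a : nat)%:R / k.+1%:R) + k.+1%:R * (n%:R * e).
  by rewrite big_split /= sumr_const card_ord; congr (_ + _); rewrite [RHS]mulr_natl.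
have h := @Rintegral_riemann k.+1 I e isT (iint_continuous uF) dI.
apply: le_trans (lerD h (lexx _)) _.
by rewrite -mulrDr ler_wpM2l // -natr1 mulrDl mul1r -!addrA lerD2l addrC.
Qed.

End IteratedIntegral.

(** * Estimates for the solution *)

Section Sampling.
Variables (R : realType) (d : nat).

Lemma step_small (del : R) : 0 < del -> exists k, step R k <= del.
Proof.
move=> del0; exists (Num.trunc del^-1); rewrite /step.
have h : del^-1 < (Num.trunc del^-1).+1%:R by exact: truncnS_gt.
rewrite -[leRHS]invrK lef_pV2 ?posrE ?ltr0n ?invr_gt0 //.
apply: le_trans (ltW h) _; rewrite ler_nat ltnS -addnn.
by apply: leq_trans (leq_addr _ _) _; rewrite leqW // leqW.
Qed.

Lemma step_le1 k : step R k <= 1.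
Proof. by rewrite invf_le1 ?ltr0n // ler1n. Qed.

Lemma dtime_le_step k : dtime R k <= step R k.
Proof. by rewrite /dtime; have := step_gt0 R k; have := step_le1 k; nra. Qed.

Lemma pos_dense k (x : 'rV[R]_d) : cube x -> exists z : grid d k, `|x - pos R z| <= step R k.
Proof.
move=> xc; have h0 := step_gt0 R k.
have N0 : 0 < k.*2.+3%:R :> R by rewrite ltr0n.
(* The minimum matters only for a coordinate equal to 1, whose truncation would be one past the last
   index. *)
exists (\row_j inord (minn (Num.trunc (x 0 j * k.*2.+3%:R)) k.*2.+2)).
rewrite [leLHS]/Num.norm /= mx_normrE; apply/bigmax_leP; split; first exact: ltW.
move=> -[a j] _ /=; rewrite !mxE ord1 inordK; last by rewrite ltnS geq_minr.
have /andP[x0 x1] := xc j; set m := Num.trunc _.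
have xN0 : 0 <= x 0 j * k.*2.+3%:R by rewrite mulr_ge0 // ltW.
have /andP[m1 m2] := truncn_itv xN0; rewrite -/m in m1 m2.
have xE : x 0 j = (x 0 j * k.*2.+3%:R) * step R k by rewrite /step mulfK ?gt_eqF.
rewrite xE -mulrBl normrM (gtr0_norm h0) ler_piMl ?(ltW h0) //.
have xN : x 0 j * k.*2.+3%:R <= k.*2.+3%:R by rewrite ler_piMl // ltW.
case: (ltnP k.*2.+2 m) => mk; last first.
  by rewrite ger0_norm ?subr_ge0 // lerBlDl natr1 ltW.
have mk' : k.*2.+3%:R <= m%:R :> R by rewrite ler_nat.
have e : k.*2.+3%:R = k.*2.+2%:R + 1 :> R by rewrite natr1.
move: xN mk' m1; rewrite e => xN mk' m1.
by rewrite ger0_norm; lra.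
Qed.

End Sampling.

Lemma coord_enorm (R : realType) d (x : 'rV[R]_d) i : `|x 0 i| <= enorm x.
Proof.
rewrite -sqrtr_sqr ler_sqrt; last by apply: sumr_ge0 => j _; rewrite sqr_ge0.
by rewrite (bigD1 i) //= lerDl sumr_ge0 // => j _; rewrite sqr_ge0.
Qed.

Lemma DxE (R : realType) d (u : 'rV[R]_d * R -> R) z j : Dx u z 0 j = 'D_(dx R j) u z.
Proof. by rewrite mxE. Qed.

Lemma supersolution_step (R : realFieldType) (tau W u X f : R) : 0 <= tau -> 1 <= X ->
  - (tau * 2^-1) <= W - u - tau * (X - f) -> u <= W + tau * (f + 1).
Proof.
move=> tau0 X1 h; have : 0 <= tau * (X - 1) by rewrite mulr_ge0 ?subr_ge0.
lra.
Qed.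

(* Applied with [sg = 1] and [sg = -1], to bound a derivative of [u] on both sides. *)
Lemma sign_step (R : realFieldType) (sg tau W v X f q Y : R) : `|sg| = 1 -> 0 <= tau ->
  `|X| <= Y -> `|q - f| <= 2^-1 -> `|W - v - tau * (X - f)| <= tau * 2^-1 ->
  sg * v <= sg * W + tau * (sg * q + Y + 1).
Proof.
move=> s1 tau0 h1 h2 h3.
have e1 : - (sg * X) <= Y by apply: le_trans (ler_norm _) _; rewrite normrN normrM s1 mul1r.
have e2 : - (sg * (q - f)) <= 2^-1 by apply: le_trans (ler_norm _) _; rewrite normrN normrM s1
  mul1r.
have e3 : - (sg * (W - v - tau * (X - f))) <= tau * 2^-1.
  by apply: le_trans (ler_norm _) _; rewrite normrN normrM s1 mul1r.
have e4 : 0 <= tau * (Y + sg * X) by rewrite mulr_ge0 // -lerBlDr sub0r.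
have e5 : 0 <= tau * (2^-1 + sg * (q - f)) by rewrite mulr_ge0 // -lerBlDr sub0r.
have -> : sg * W + tau * (sg * q + Y + 1) = sg * v + (sg * (W - v - tau * (X - f)) + tau * 2^-1)
   + tau * (Y + sg * X) + tau * (2^-1 + sg * (q - f)) by field.
have e6 : 0 <= sg * (W - v - tau * (X - f)) + tau * 2^-1 by rewrite -lerBlDl sub0r.
by rewrite -2!addrA lerDl addr_ge0 // addr_ge0.
Qed.

Section Estimates.
Variables (R : realType) (d : nat) (T p : R) (K0 : R).
Hypotheses (T0 : 0 < T) (p2 : 2 <= p) (d0 : (0 < d)%N) (dp : d%:R < p)
  (K01 : 1 <= K0) (HK : kernel_spec d T p K0).
Variables (H : 'rV[R]_d * 'rV[R]_d -> R) (u : 'rV[R]_d * R -> R).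
Hypotheses (sH : smooth H) (pH : periodic_H H) (su : smooth u) (pu : periodic_x u).
Local Notation dx := (@dx R d).
Local Notation F := (hjb H u).
Variables (c C3 C5 C8 G K U Bu mu : R).
Hypotheses (c0 : 0 < c) (C30 : 0 <= C3) (C50 : 0 <= C5) (C80 : 0 <= C8)
  (G0 : 0 <= G) (mu0 : 0 <= mu)
  (H1 : forall x q, 1 <= H (x, q))
  (hL : forall x q, c * H (x, q) - C3 <= Lhat H x q)
  (hX : forall x q, enorm (DxH H x q) <= C5 * H (x, q) + C5)
  (hP : forall x q, enorm (DpH H x q) ^+ 2 <= C8 * enorm q `^ mu * H (x, q) + C8)
  (F0 : forall x t, 0 <= t <= T -> 0 <= F (x, t))
  (FG : forall t, 0 <= t <= T -> iint (@unitI R) (fun x => `|F (x, t)| `^ p) <= G `^ p)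
  (uK : forall x t, 0 <= t <= T -> enorm (Dx u (x, t)) <= K)
  (uU : forall x t, 0 <= t <= T -> `|u (x, t)| <= U)
  (uB : forall x, `|u (x, T)| <= Bu)
  (vB : forall x i, `|'D_(dx i) u (x, T)| <= Bu).

Let gam := G + 1.
Let gam0 : 0 < gam. Proof. by rewrite ltr_wpDl. Qed.
Let p0 : 0 < p. Proof. exact: lt_le_trans p2. Qed.
Let p1 : 1 <= p. Proof. by apply: le_trans p2; rewrite ler1n. Qed.

(** The oscillation is [1 / d] because [d] coordinates are summed: the Riemann sums are then off by
    at most 1, which [gam = G + 1] takes up. *)
Lemma norm_F_ucont : exists2 del : R, 0 < del & forall t, 0 <= t <= T ->
  ucont (fun x => `|F (x, t)| `^ p) /\
  (forall x y, `|x - y| <= del -> `| `|F (x, t)| `^ p - `|F (y, t)| `^ p | <= d%:R^-1).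
Proof.
pose Fp z := `|F z| `^ p.
have cF : continuous Fp.
  move=> z; apply: (@continuous_comp _ _ _ F (fun a : R => `|a| `^ p)).
    exact: continuous_hjb.
  exact: continuous_norm_powR.
have pF : periodic_x Fp by move=> x t i; rewrite /Fp hjb_periodic.
have d1 : 0 < d%:R^-1 :> R by rewrite invr_gt0 ltr0n.
have [del del0 hd] := periodic_unif T cF pF d1.
exists del => // t tT; split=> [e e0|x y xy].
  have [del' del'0 hd'] := periodic_unif T cF pF e0.
  exists del' => // x y xy; apply: (hd' y t x t) => //.
  by rewrite subrr normr0 ltW.
by apply: (hd y t x t) => //; rewrite subrr normr0 ltW.
Qed.

Variable i : 'I_d.
(** The direction of differentiation is placed at the head of the list, the average applied first to
    the function; the variance and kernel bounds for [D] expect it there. *)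
Let r := rem i (enum 'I_d).
Let rP : perm_eq (i :: r) (enum 'I_d).
Proof. by rewrite perm_sym perm_to_rem // mem_enum. Qed.

Let v := 'D_(dx i) u.
Let sv : smooth v := smooth_derive (dx i) su.
Let pv : periodic_x v := periodic_x_derive (dx i) pu.
Let Fx := hjb_x H u i.
Let lam := (20 * K0 * gam)^-1.

(** All that is asked of the mesh: positive transition weights, consistency errors of at most 1/2
    per unit of time, smallness of [tau * Q] and [tau * Q^2], and oscillations that make grid values
    representative. *)
Record fine (B Q : R) (k : nat) : Prop := Fine {
  fine_drift : step R k / 2 * B < 1;
  fine_walk : forall w, w = u \/ w = v ->
    forall y t (b : 'I_d -> R), 0 <= t -> t + dtime R k <= T -> (forall j, `|b j| <= B) ->
    `|walk (fun j => step R k *: ev R j) (fun j => - (step R k / 2) * b j) (i :: r)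
        (fun x => w (x, t + dtime R k)) y
       - w (y, t) - dtime R k * ('D_(dt R d) w (y, t) + \sum_j generator w b t j y)|
     <= dtime R k * 2^-1;
  fine_dquo : forall y t, 0 <= t <= T ->
    `|(F (y + (2 * step R k) *: ev R i, t) - F (y, t)) / (2 * step R k) - Fx (y, t)| <= 2^-1;
  fine_time : 9 * T * (dtime R k * Q ^+ 2) <= 1 /\ dtime R k * Q <= 2^-1;
  fine_norm : forall x y t, 0 <= t <= T -> `|x - y| <= step R k ->
    `| `|F (x, t)| `^ p - `|F (y, t)| `^ p | <= d%:R^-1;
  fine_near : forall w, w = u \/ w = v -> forall x t y s, 0 <= t <= T ->
    `|y - x| <= step R k -> `|s - t| <= dtime R k -> `|w (y, s) - w (x, t)| <= 1 }.

Lemma exists_fine (B Q : R) : 0 <= B -> 0 <= Q -> exists k, fine B Q k.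
Proof.
move=> B0 Q0.
have i2 : 0 < 2^-1 :> R by rewrite invr_gt0.
have [h1 h10 hh1] := @walk_consistency R d u T B _ su pu B0 i2.
have [h2 h20 hh2] := @walk_consistency R d v T B _ sv pv B0 i2.
have cx : continuous Fx by exact: continuous_hjb_x.
have px : periodic_x Fx by exact: hjb_x_periodic.
have [h3 h30 hh3] := periodic_unif T cx px i2.
have [h4 h40 hh4] := norm_F_ucont.
have [h5 h50 hh5] := periodic_unif T (smooth_continuous su) pu ltr01.
have [h6 h60 hh6] := periodic_unif T (smooth_continuous sv) pv ltr01.
pose h7 := (9 * T * Q ^+ 2 + 1)^-1; pose h8 := (2 * Q + 1)^-1.
have q7 : 0 <= 9 * T * Q ^+ 2 by rewrite mulr_ge0 ?exprn_ge0 // mulr_ge0 // ltW.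
have h70 : 0 < h7 by rewrite invr_gt0 ltr_wpDl.
have h80 : 0 < h8 by rewrite invr_gt0 ltr_wpDl // mulr_ge0.
have m0 : 0 < Num.min (Num.min (Num.min h1 h2) (Num.min (h3 / 2) h4)) (Num.min (Num.min h5 h6)
  (Num.min h7 h8)).
  by rewrite !lt_min h10 h20 h40 h50 h60 h70 h80 divr_gt0.
have [k] := step_small m0.
rewrite !le_min => /andP[/andP[/andP[k1 k2] /andP[k3 k4]] /andP[/andP[k5 k6] /andP[k7 k8]]].
have s0 := step_gt0 R k; have tau0 := dtime_gt0 R k; have taus := dtime_le_step R k.
have k1' : 0 < step R k <= h1 by rewrite s0.
have k2' : 0 < step R k <= h2 by rewrite s0.
exists k; split.
- by have [] := hh1 _ k1'.
- move=> w [->|->] y t b t0 tT bB.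
    by have [_ h] := hh1 _ k1'; apply: h.
  by have [_ h] := hh2 _ k2'; apply: h.
- move=> y t tT.
  have dF z : derivable F z (dx i).
    by have := @is_derive_hjb _ _ H u sH su i z; case.
  have [xi xih E] := mvt_dir (y, t) (2 * step R k) dF.
  rewrite !add_dx in E; rewrite E mulrAC divff ?mul1r ?gt_eqF ?mulr_gt0 //.
  have -> : 'D_(dx i) F (y + xi *: ev R i, t) = Fx (y + xi *: ev R i, t).
    exact: (@derive_val _ _ _ _ _ _ _ (@is_derive_hjb _ _ H u sH su i _)).
  apply: hh3 => //; last by rewrite subrr normr0 ltW.
  rewrite addrAC subrr add0r; apply: le_trans (norm_ev _ _) _; apply: le_trans xih _.
  by rewrite ger0_norm ?mulr_ge0 ?(ltW s0) // mulrC -ler_pdivlMr.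
- have q1 : (9 * T * Q ^+ 2 + 1) * dtime R k <= 1.
    rewrite -ler_pdivlMl ?mulr1 ?ltr_wpDl //; exact: le_trans k7.
  have q2 : (2 * Q + 1) * dtime R k <= 1.
    rewrite -ler_pdivlMl ?mulr1 ?ltr_wpDl ?mulr_ge0 //; exact: le_trans k8.
  split; [rewrite mulrA (mulrAC (9 * T))|].
    by apply: le_trans q1; rewrite ler_wpM2r ?(ltW tau0) // lerDl.
  by move: q2 tau0; rewrite mulrDl mul1r -mulrA (mulrC Q); move: (dtime R k * Q) (dtime R k) => a
    b; lra.
- move=> x y t tT xy; have [_ h] := hh4 t tT; apply: h; exact: le_trans k4.
- move=> w [->|->] x t y s tT yx st; [apply: hh5|apply: hh6] => //.
  + exact: le_trans k5.
  + exact: le_trans st (le_trans taus k5).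
  + exact: le_trans k6.
  + exact: le_trans st (le_trans taus k6).
Qed.

Section Grid.
Variables (B Q : R) (k : nat).
Hypotheses (B0 : 0 <= B) (Q0 : 0 <= Q) (hk : fine B Q k)
  (hB : forall z t j, 0 <= t <= T -> `|drift H u (z, t) j| <= B)
  (hQ : forall y t, 0 <= t <= T -> lam * (`|Fx (y, t)| + 2^-1) <= Q).
Local Notation h := (step R k).
Local Notation tau := (dtime R k).
Let M := Num.trunc (T / tau).
(** Time runs backwards from the terminal condition. The last node [tn M] may stop short of 0 by
    less than one step, within the reach of [fine_near]. *)
Let tn n : R := T - n%:R * tau.
Let h0 : 0 < h := step_gt0 R k.
Let tau0 : 0 < tau := dtime_gt0 R k.

Let MT : M%:R * tau <= T.
Proof.
have T1 : 0 <= T / tau by rewrite divr_ge0 ?ltW.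
by have /andP[m1 _] := truncn_itv T1; rewrite -ler_pdivlMr.
Qed.

Let tnT n : (n <= M)%N -> 0 <= tn n <= T.
Proof.
move=> nM; have : n%:R * tau <= M%:R * tau by rewrite ler_wpM2r ?(ltW tau0) // ler_nat.
have : 0 <= n%:R * tau by rewrite mulr_ge0 // ltW.
by rewrite /tn; move: MT; lra.
Qed.

Let tnS n : (0 < n)%N -> tn n + tau = tn n.-1.
Proof. by case: n => // n _; rewrite /tn -natr1 -pred_Sn; ring. Qed.

Let near_grid w : w = u \/ w = v -> periodic_x w -> forall Cw : R,
  (forall n (z : grid d k), (n <= M)%N -> `|w (pos R z, tn n)| <= Cw) ->
  forall x t, 0 <= t <= T -> `|w (x, t)| <= Cw + 1.
Proof.
move=> wuv pw Cw hw x t /andP[t0 tT].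
have [n hn] := cube_repr x; rewrite -(periodic_x_int x t n pw).
set y := x + _ in hn *; have [z yz] := pos_dense k hn.
pose m := Num.trunc ((T - t) / tau).
have q0 : 0 <= (T - t) / tau by rewrite divr_ge0 ?(ltW tau0) // subr_ge0.
have /andP[m1 m2] := truncn_itv q0; rewrite -/m in m1 m2.
rewrite ler_pdivlMr // in m1; rewrite ltr_pdivrMr // -natr1 mulrDl mul1r in m2.
have mM : (m <= M)%N.
  have T1 : 0 <= T / tau by rewrite divr_ge0 ?ltW.
  rewrite /M truncn_ge_nat // ler_pdivlMr //; apply: le_trans m1 _; lra.
have dt1 : `|t - tn m| <= tau.
  by rewrite /tn ler_norml; apply/andP; split; lra.
have := fine_near hk wuv (tnT mM) yz dt1; have := hw m z mM.
move: (w (y, t)) (w (pos R z, tn m)) => a b; rewrite !ler_norml => /andP[? ?] /andP[? ?].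
by apply/andP; split; lra.
Qed.

Let fd n (z : grid d k) := F (pos R z, tn n).

Let fd_norm j : (0 < j <= M)%N -> \sum_z `|fd j z| `^ p <= k.*2.+3%:R ^+ d * gam `^ p.
Proof.
move=> /andP[j0 jM]; have tT := tnT jM.
have [del del0 hd] := norm_F_ucont; have [uc _] := hd _ tT.
have := @iint_riemann R d k.*2.+2 (fun x => `|F (x, tn j)| `^ p) d%:R^-1 uc _.
move=> /(_ (fun x y xy => fine_norm hk tT xy)) => h1.
apply: le_trans h1 _; rewrite ler_wpM2l ?exprn_ge0 // divff ?gt_eqF ?ltr0n //.
apply: le_trans (powR_add1 G0 p1); rewrite lerD2r; exact: FG.
Qed.

Let b n (z : grid d k) j := drift H u (pos R z, tn n) j.
Let Hv n (z : grid d k) := H (pos R z, Dx u (pos R z, tn n)).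

Let bB n z j : (n <= M)%N -> `|b n z j| <= B.
Proof. by move=> nM; apply: hB; apply: tnT. Qed.

Let th1 n z j : (0 < n <= M)%N -> -1 < - (h / 2) * b n z j < 1.
Proof.
move=> /andP[_ nM]; rewrite -ltr_norml mulNr normrN normrM ger0_norm ?divr_ge0 ?(ltW h0) //.
by apply: le_lt_trans (fine_drift hk); rewrite ler_wpM2l ?divr_ge0 ?(ltW h0) // bB.
Qed.

Let consistent w n z (b' : 'I_d -> R) : w = u \/ w = v -> periodic_x w -> (0 < n <= M)%N ->
  (forall j, `|b' j| <= B) ->
  `|walk (@unit_vec d k) (fun j => - (h / 2) * b' j) (i :: r) (fun y => w (pos R y, tn n.-1)) z
    - w (pos R z, tn n) - tau * ('D_(dt R d) w (pos R z, tn n) + \sum_j generator w b' (tn n) j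
      (pos R z))|
  <= tau * 2^-1.
Proof.
move=> wuv pw /andP[n0 nM] hb'.
have /andP[t0 tT] := tnT nM.
have tT' : tn n + tau <= T by rewrite tnS //; have /andP[] := tnT (leq_trans (leq_pred n) nM).
have := fine_walk hk wuv (pos R z) t0 tT' hb'; rewrite tnS //.
rewrite (@walk_pos R d k (fun j => - (h / 2) * b' j) (i :: r) (fun y => w (y, tn n.-1)) z) //.
move=> j; rewrite -ler_norml mulNr normrN normrM ger0_norm ?divr_ge0 ?(ltW h0) //.
by apply: le_trans (ltW (fine_drift hk)); rewrite ler_wpM2l ?divr_ge0 ?(ltW h0).
Qed.

Let u_step n z : (0 < n <= M)%N ->
  walk (@unit_vec d k) (fun j => - (h / 2) * b n z j) (i :: r) (fun y => u (pos R y, tn n.-1)) z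
    + tau * (c * Hv n z - C3 - 1) <= u (pos R z, tn n).
Proof.
move=> nM; have /andP[n0 nM'] := nM; have tT := tnT nM'.
have := consistent z (or_introl erefl) pu nM (fun j => bB z j nM').
(* By the definition of [F] the time derivative plus the Laplacian is [H - F], while b . Du is
   [Lhat + H]. *)
have e : 'D_(dt R d) u (pos R z, tn n) + \sum_j generator u (b n z) (tn n) j (pos R z)
   = - Lhat H (pos R z) (Dx u (pos R z, tn n)) - F (pos R z, tn n).
  have -> : \sum_j generator u (b n z) (tn n) j (pos R z) = Lap u (pos R z, tn n) - dotv (DpH H
    (pos R z) (Dx u (pos R z, tn n))) (Dx u (pos R z, tn n)).
    rewrite /Lap /dotv -sumrB; apply: eq_bigr => j _.
    exact: (congr1 (fun q => _ - _ * q) (esym (DxE u (pos R z, tn n) j))).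
  by rewrite /hjb /Lhat /=; ring.
rewrite e; have := hL (pos R z) (Dx u (pos R z, tn n)); have := F0 (pos R z) tT.
rewrite /Hv; move: (Lhat _ _ _) (F _) (u _) (H _) (walk _ _ _ _ _) => L f u1 H' W f0 L1.
rewrite ler_norml => /andP[_ h1].
have : tau * (c * H' - C3) <= tau * L by rewrite ler_wpM2l // ltW.
have : 0 <= tau * f by rewrite mulr_ge0 // ltW.
move: tau0; lra.
Qed.

Let mW n z : (0 < n <= M)%N -> markov (walk (@unit_vec d k) (fun j => - (h / 2) * b n z j) (i ::
  r)).
Proof. by move=> nM; apply: markov_walk => j; have /andP[? ?] := th1 z j nM; rewrite !ltW. Qed.

Let u_upper n z : (0 < n <= M)%N ->
  u (pos R z, tn n) <= walk (@unit_vec d k) (fun=> 0) (i :: r) (fun y => u (pos R y, tn n.-1)) z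
    + tau * (fd n z + 1).
Proof.
move=> nM; have b00 (j : 'I_d) : `|(fun=> 0 : R) j| <= B by rewrite normr0.
have := consistent z (or_introl erefl) pu nM b00.
have -> : (fun j : 'I_d => - (h / 2) * (fun=> 0 : R) j) = (fun=> 0) by apply/funext => j; rewrite
  mulr0.
have e : 'D_(dt R d) u (pos R z, tn n) + \sum_j generator u (fun=> 0) (tn n) j (pos R z)
   = Hv n z - fd n z.
  have -> : \sum_j generator u (fun=> 0) (tn n) j (pos R z) = Lap u (pos R z, tn n).
    by apply: eq_bigr => j _; rewrite /generator mul0r subr0.
  by rewrite /fd /hjb /Hv /=; ring.
rewrite e; have : 1 <= Hv n z by exact: H1.
by rewrite ler_norml => HH /andP[h1 _]; exact: supersolution_step (ltW tau0) HH h1.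
Qed.

Let dquo_fd n z : (0 < n <= M)%N ->
  `|dquo (unit_vec k i + unit_vec k i) (2 * h) (fd n) z - Fx (pos R z, tn n)| <= 2^-1.
Proof.
move=> /andP[_ nM]; have pF : torus_periodic (fun x => F (x, tn n)).
  by move=> x j; apply: hjb_periodic.
by rewrite (dquo_pos (k := k) i z pF); apply: (fine_dquo hk); exact: tnT.
Qed.

Let dquoZ (a : R) (g : grid d k -> R) z :
  dquo (unit_vec k i + unit_vec k i) (2 * h) (fun y => a * g y) z
  = a * dquo (unit_vec k i + unit_vec k i) (2 * h) g z.
Proof. by rewrite /dquo -mulrBr mulrA. Qed.

Let v_step (sg : R) n z : `|sg| = 1 -> (0 < n <= M)%N ->
  sg * v (pos R z, tn n)
  <= walk (@unit_vec d k) (fun j => - (h / 2) * b n z j) (i :: r) (fun y => sg * v (pos R y, tn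
    n.-1)) z
    + tau * (dquo (unit_vec k i + unit_vec k i) (2 * h) (fun y => sg * fd n y) z
             + (C5 * Hv n z + C5) + 1).
Proof.
move=> sg1 nM; have /andP[n0 nM'] := nM.
have := consistent z (or_intror erefl) pv nM (fun j => bB z j nM').
have e : 'D_(dt R d) v (pos R z, tn n) + \sum_j generator v (b n z) (tn n) j (pos R z)
   = DxH H (pos R z) (Dx u (pos R z, tn n)) 0 i - Fx (pos R z, tn n).
  by rewrite /generator sumrB /Fx /hjb_x /Lap /b /v /=; ring.
rewrite e (markovZ (mW z nM) sg) dquoZ.
have := dquo_fd z nM.
have : `|DxH H (pos R z) (Dx u (pos R z, tn n)) 0 i| <= C5 * Hv n z + C5.
  by apply: le_trans (hX _ _); exact: coord_enorm.
move: (DxH _ _ _ _ _) (Fx _) (dquo _ _ _ _) (v _) (walk _ _ _ _ _) (C5 * _ + C5) => X f q v1 W Y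
  h1 h2 h3.
have := @sign_step _ sg tau W v1 X f q Y sg1 (ltW tau0) h1 h2 h3.
by [].
Qed.

Let b_sqr n z : (0 < n <= M)%N -> \sum_j b n z j ^+ 2 <= C8 * K `^ mu * Hv n z + C8.
Proof.
move=> /andP[_ nM]; have -> : \sum_j b n z j ^+ 2 = enorm (DpH H (pos R z) (Dx u (pos R z, tn
  n))) ^+ 2.
  by rewrite sqr_sqrtr // sumr_ge0 // => j _; rewrite sqr_ge0.
apply: le_trans (hP _ _) _; rewrite lerD2r ler_wpM2r //; first by apply: le_trans (H1 _ _).
rewrite ler_wpM2l // ge0_ler_powR ?nnegrE ?sqrtr_ge0 //; last by apply: uK; exact: tnT.
by apply: le_trans (uK (pos R z) (tnT nM)); rewrite sqrtr_ge0.
Qed.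

Let sfd_norm (sg : R) j : `|sg| = 1 -> (0 < j <= M)%N ->
  \sum_z `|sg * fd j z| `^ p <= k.*2.+3%:R ^+ d * gam `^ p.
Proof. by move=> s1 jM; under eq_bigr => z _ do rewrite normrM s1 mul1r; exact: fd_norm. Qed.

Let sfd_Q (sg : R) j z : `|sg| = 1 -> (0 < j <= M)%N ->
  `|dquo (unit_vec k i + unit_vec k i) (2 * h) (fun y => lam * (sg * fd j y)) z| <= Q.
Proof.
move=> s1 jM.
have l0 : 0 < lam by rewrite invr_gt0 !mulr_gt0 // (lt_le_trans ltr01 K01).
have /andP[_ jM'] := jM; apply: le_trans (hQ (pos R z) (tnT jM')).
have h1 := le_trans (lerB_dist _ _) (dquo_fd z jM).
have -> : dquo (unit_vec k i + unit_vec k i) (2 * h) (fun y => lam * (sg * fd j y)) z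
    = lam * (sg * dquo (unit_vec k i + unit_vec k i) (2 * h) (fd j) z) by rewrite !dquoZ.
by rewrite normrM normrM s1 mul1r (gtr0_norm l0) ler_wpM2l ?(ltW l0) // -lerBlDl.
Qed.

Let tn0 : tn 0 = T. Proof. by rewrite /tn mul0r subr0. Qed.

Let u_hU n (z : grid d k) : (n <= M)%N -> `|u (pos R z, tn n)| <= U.
Proof. by move=> nM; apply: uU; exact: tnT. Qed.

(** A bound on [u] by the norm of the source alone; it later removes the powers of [U] that stand
    without a factor [G]. *)
Lemma grid_value x t : 0 <= t <= T ->
  `|u (x, t)| <= Bu + (T + K0) * gam + T + T * (C3 + 1) + 1.
Proof.
apply: near_grid => //; first by left.
have gK : 0 <= (T + K0) * gam by rewrite mulr_ge0 ?addr_ge0 ?(ltW T0) ?(ltW gam0) // (le_trans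
  ler01 K01).
have g3 : 0 <= T * (C3 + 1) by rewrite mulr_ge0 ?(ltW T0) ?addr_ge0.
move=> n z nM; rewrite ler_norml; apply/andP; split.
  have h1 (y : grid d k) : - Bu <= u (pos R y, tn 0).
    by have := uB (pos R y); rewrite tn0 ler_norml => /andP[].
  have h2 (j : nat) (y : grid d k) : 0 <= Hv j y by apply: le_trans (H1 _ _).
  have := lower_value MT th1 c0 C30 u_step h2 h1 z nM.
  by move: T0; move: (u _) => u1; lra.
have h1 (y : grid d k) : u (pos R y, tn 0) <= Bu.
  by have := uB (pos R y); rewrite tn0 ler_norml => /andP[].
have := upper_value HK rP MT gam0 fd_norm h1 u_upper z nM.
by move: T0; move: (u _) => u1; lra.
Qed.

Lemma grid_gradient A x t : A = (C5 + C8 * K `^ mu / (2 * lam)) / c -> 0 <= t <= T ->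
  `|v (x, t)| <= Bu + lam^-1 + 2 * A * U
     + T * (C5 + 1 + lam^-1 * (2 / (9 * T) + C8 / 2) + A * (C3 + 1)) + 1.
Proof.
move=> AE; apply: near_grid => //; first by right.
have key (sg : R) : `|sg| = 1 -> forall n (z : grid d k), (n <= M)%N -> sg * v (pos R z, tn n) <=
   Bu + lam^-1 + 2 * A * U + T * (C5 + 1 + lam^-1 * (2 / (9 * T) + C8 / 2) + A * (C3 + 1)).
  move=> s1; rewrite AE; have [q1 q2] := fine_time hk.
  have v0 (z : grid d k) : sg * v (pos R z, tn 0) <= Bu.
    rewrite tn0; apply: le_trans (ler_norm _) _; rewrite normrM s1 mul1r; exact: vB.
  have B10 : 0 <= C8 * K `^ mu by rewrite mulr_ge0 ?powR_ge0.
  have HC := @discrete_comparison R d T p T0 p2 K0 K01 HK k M i r rP MT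
    (fun j z => sg * fd j z) gam gam0 (fun j jM => sfd_norm s1 jM) Q
    (fun j z jM => sfd_Q z s1 jM) q1 q2 b Hv th1 (fun n z => u (pos R z, tn n)) c C3 c0 C30 u_step
    (fun n z => sg * v (pos R z, tn n)) C5 (C8 * K `^ mu) C8 Bu U C50 B10 C80
    (fun n z nM => v_step z s1 nM) b_sqr v0 u_hU.
  exact: HC.
move=> n z nM; rewrite ler_norml; apply/andP; split.
  by have := key (-1) (normrN1 _) n z nM; rewrite mulN1r lerNl.
by have := key 1 (normr1 _) n z nM; rewrite mul1r.
Qed.

End Grid.

(** The bounds on the drift and on the x-derivative of the source depend on the solution in an
    uncontrolled way. They only select a mesh, and neither they nor the mesh occur in the
    conclusion. *)
Theorem solution_bounds A x t : A = (C5 + C8 * K `^ mu / (2 * lam)) / c -> 0 <= t <= T ->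
  `|u (x, t)| <= Bu + (T + K0) * gam + T + T * (C3 + 1) + 1 /\
  `|v (x, t)| <= Bu + lam^-1 + 2 * A * U
     + T * (C5 + 1 + lam^-1 * (2 / (9 * T) + C8 / 2) + A * (C3 + 1)) + 1.
Proof.
move=> AE tT.
have hb j : exists B, 0 <= B /\ forall z s, 0 <= s <= T -> `|drift H u (z, s) j| <= B.
  have [B B0 hB] := periodic_bounded T (@continuous_drift _ _ H u sH su j) (@drift_periodic _ _ H
    u pH pu j).
  by exists B.
have [f hf] := choice hb.
have [X X0 hX'] := periodic_bounded T (@continuous_hjb_x _ _ H u sH su i) (@hjb_x_periodic _ _ H
  u pH pu i).
have l0 : 0 < lam by rewrite invr_gt0 !mulr_gt0 // (lt_le_trans ltr01 K01).
have B0 : 0 <= \sum_j f j by apply: sumr_ge0 => j _; have [] := hf j.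
have Q0 : 0 <= lam * (X + 2^-1) by rewrite mulr_ge0 ?(ltW l0) // addr_ge0.
have [k hk] := exists_fine B0 Q0.
have hB z s j : 0 <= s <= T -> `|drift H u (z, s) j| <= \sum_j f j.
  move=> sT; have [_ h] := hf j; apply: le_trans (h z s sT) _.
  by rewrite (bigD1 j) //= lerDl sumr_ge0 // => l _; have [] := hf l.
have hQ y s : 0 <= s <= T -> lam * (`|Fx (y, s)| + 2^-1) <= lam * (X + 2^-1).
  by move=> sT; rewrite ler_wpM2l ?(ltW l0) // lerD2r hX'.
split; first exact: grid_value hk hB x t tT.
exact: (grid_gradient hk hB hQ x AE tT).
Qed.

End Estimates.

(** * Absorption of the superlinear term *)

Section Absorption.
Variables (R : realType).
Implicit Types a b x K q mu G U : R.

(* Either [b K^mu <= K / 2], or [K^(1 - mu) < 2 b]. *)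
Lemma absorb_power b K mu : 0 <= K -> 0 <= b -> 0 < mu < 1 ->
  K <= b * (1 + K `^ mu) -> K <= 2 * b + (2 * b) `^ (1 - mu)^-1.
Proof.
move=> K0 b0 /andP[mu0 mu1] h; have q0 : 0 < 1 - mu by rewrite subr_gt0.
have p0 : 0 <= (2 * b) `^ (1 - mu)^-1 by exact: powR_ge0.
have [h1|h1] := leP (b * K `^ mu) (K / 2); first by move: h p0 h1; move: (_ `^ _) (_ `^ _) => s
  w; lra.
have Kp : 0 < K.
  rewrite lt_neqAle K0 andbT eq_sym; apply/eqP => Kz; move: h1.
  by rewrite Kz powR0 ?gt_eqF // mulr0 mul0r ltxx.
have s0 : 0 < K `^ mu by exact: powR_gt0.
have e : K = K `^ (1 - mu) * K `^ mu by rewrite -powRD ?subrK ?powRr1 ?gt_eqF ?implybT.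
have h2 : K `^ (1 - mu) <= 2 * b.
  rewrite -(ler_pM2r s0) -e -mulrA; move: h1; move: (b * _) => w; lra.
have -> : K = (K `^ (1 - mu)) `^ (1 - mu)^-1 by rewrite -powRrM mulfV ?powRr1 ?gt_eqF.
apply: le_trans (_ : (2 * b) `^ (1 - mu)^-1 <= _); last by rewrite lerDr mulr_ge0.
by apply: ge0_ler_powR; rewrite ?nnegrE ?powR_ge0 ?mulr_ge0 ?invr_ge0 // ltW.
Qed.

Lemma powR1D_le x q : 0 <= x -> 0 <= q -> (1 + x) `^ q <= 2 `^ q * (1 + x `^ q).
Proof.
move=> x0 q0; have x1 : 0 <= 1 + x by rewrite addr_ge0.
have e0 : 0 <= 2 `^ q :> R by exact: powR_ge0.
have xq0 : 0 <= x `^ q by exact: powR_ge0.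
have [h|h] := leP x 1.
  apply: le_trans (_ : 2 `^ q <= _); last by rewrite ler_peMr // lerDl.
  by apply: ge0_ler_powR; rewrite ?nnegrE //; lra.
apply: le_trans (_ : (2 * x) `^ q <= _).
  by apply: ge0_ler_powR; rewrite ?nnegrE ?mulr_ge0 //; lra.
by rewrite powRM // ler_wpM2l // lerDr.
Qed.

Lemma le_powR1D x q : 0 <= x -> 1 <= q -> x <= 1 + x `^ q.
Proof.
move=> x0 q1; have xq0 : 0 <= x `^ q by exact: powR_ge0.
have [h|h] := leP x 1; first by lra.
by apply: le_trans (le1r_powR (ltW h) q1) _; rewrite lerDr.
Qed.

Lemma combine_factors (P e w g y z : R) : 0 <= P -> 0 <= e -> 0 <= g -> 0 <= w ->
  0 <= y -> 0 <= z -> y <= e * (1 + g) -> z <= e * (1 + w) ->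
  forall A, 0 <= A -> w <= A * (1 + g) ->
  1 + 2 * (P * (y * z)) <= (1 + 2 * P * e ^+ 2 * (1 + A)) * (1 + g + g * w).
Proof.
move=> P0 e0 g0 w0 y0 z0 hy hz A A0 hw.
have h1 : y * z <= (e * (1 + g)) * (e * (1 + w)) by exact: ler_pM.
have gw : 0 <= g * w by exact: mulr_ge0.
have h2 : (1 + g) * (1 + w) <= (1 + A) * (1 + g + g * w).
  have : 0 <= A * (g * w) by exact: mulr_ge0.
  by move: hw; lra.
have h3 : y * z <= e ^+ 2 * ((1 + A) * (1 + g + g * w)).
  apply: le_trans h1 _; rewrite mulrACA -expr2 ler_wpM2l // exprn_ge0 //.
have h4 : P * (y * z) <= P * (e ^+ 2 * ((1 + A) * (1 + g + g * w))) by rewrite ler_wpM2l.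
have -> : (1 + 2 * P * e ^+ 2 * (1 + A)) * (1 + g + g * w) =
  (1 + g + g * w) + 2 * (P * (e ^+ 2 * ((1 + A) * (1 + g + g * w)))) by ring.
by lra.
Qed.

(** Expanding (1 + G)^q (1 + U)^q leaves a term U^q without the factor G^q. The hypothesis
    [U <= a * (1 + G)] converts it into a multiple of 1 + G^q. *)
Lemma gradient_absorption a mu : 0 <= a -> 0 < mu < 1 ->
  exists C : R, forall G U K, 0 <= G -> 0 <= U -> 0 <= K -> U <= a * (1 + G) ->
    K <= a * ((1 + G) * (1 + U)) * (1 + K `^ mu) ->
    K <= C + C * G `^ (1 - mu)^-1 + C * G `^ (1 - mu)^-1 * U `^ (1 - mu)^-1.
Proof.
move=> a0 mu01; have /andP[mu0 mu1] := mu01; set q := (1 - mu)^-1.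
have q1 : 1 <= q by rewrite invf_ge1 ?subr_gt0 //; lra.
have q0 : 0 <= q by apply: le_trans q1.
exists (1 + 2 * (2 * a) `^ q * (2 `^ q) ^+ 2 * (1 + a `^ q * 2 `^ q)) => G U K G0 U0 K0 hU hK.
have G1 : 0 <= 1 + G by rewrite addr_ge0.
have U1 : 0 <= 1 + U by rewrite addr_ge0.
have b0 : 0 <= a * ((1 + G) * (1 + U)) by rewrite !mulr_ge0.
have h1 := absorb_power K0 b0 mu01 hK; rewrite -/q in h1.
have b20 : 0 <= 2 * (a * ((1 + G) * (1 + U))) by rewrite mulr_ge0.
have h2 := le_powR1D b20 q1.
have e : (2 * (a * ((1 + G) * (1 + U)))) `^ q = (2 * a) `^ q * ((1 + G) `^ q * (1 + U) `^ q).
  rewrite mulrA powRM; [|by rewrite mulr_ge0|by rewrite mulr_ge0].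
  by congr (_ * _); exact: powRM.
have hw : U `^ q <= a `^ q * 2 `^ q * (1 + G `^ q).
  apply: le_trans (_ : (a * (1 + G)) `^ q <= _).
    by apply: ge0_ler_powR; rewrite ?nnegrE ?mulr_ge0 ?addr_ge0.
  by rewrite powRM ?addr_ge0 // -mulrA ler_wpM2l ?powR_ge0 ?powR1D_le.
have h3 := @combine_factors ((2 * a) `^ q) (2 `^ q) (U `^ q) (G `^ q) ((1 + G) `^ q) ((1 + U) `^ q)
  (powR_ge0 _ _) (powR_ge0 _ _) (powR_ge0 _ _) (powR_ge0 _ _) (powR_ge0 _ _) (powR_ge0 _ _)
  (powR1D_le G0 q0) (powR1D_le U0 q0) _ (mulr_ge0 (powR_ge0 _ _) (powR_ge0 _ _)) hw.
rewrite -e in h3; set D := (1 + 2 * _ * _ * _) in h3 *.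
have -> : D + D * G `^ q + D * G `^ q * U `^ q = D * (1 + G `^ q + G `^ q * U `^ q) by ring.
apply: le_trans h3; apply: le_trans h1 _; move: h2; move: (_ `^ q) => w; lra.
Qed.

(** Since [1 <= g], each summand is at most a constant times [g * (1 + U) * (1 + s)]; all three
    factors meet in [A * U]. The 10 is half of the 20 in [lam]. *)
Lemma slope_bound (Bu K0 c C3 C5 C8 T g s U A kap : R) :
  0 <= Bu -> 0 <= K0 -> 0 < c -> 0 <= C3 -> 0 <= C5 -> 0 <= C8 -> 0 <= T -> 0 <= kap ->
  1 <= g -> 0 <= s -> 0 <= U ->
  A = (C5 + C8 * s / (2 * (20 * K0 * g)^-1)) / c ->
  forall a0, a0 = (C5 + 10 * C8 * K0) / c ->
  Bu + (20 * K0 * g)^-1^-1 + 2 * A * U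
     + T * (C5 + 1 + (20 * K0 * g)^-1^-1 * kap + A * (C3 + 1)) + 1
  <= (Bu + 20 * K0 + 2 * a0 + T * (C5 + 1 + 20 * K0 * kap + a0 * (C3 + 1)) + 1)
     * (g * (1 + U)) * (1 + s).
Proof.
move=> Bu0 K00 c0 C30 C50 C80 T0 kap0 g1 s0 U0 AE a0 a0E; rewrite invrK.
have g0 : 0 <= g by lra.
have a00 : 0 <= a0 by rewrite a0E divr_ge0 ?(ltW c0) // addr_ge0 // !mulr_ge0.
set X := g * (1 + U) * (1 + s).
have hX : 1 <= X.
  by rewrite /X -[leLHS]mulr1 ler_pM ?ler01 // ?lerDl // -[leLHS]mulr1 ler_pM ?lerDl.
have gX : g <= X.
  rewrite /X -mulrA ler_peMr // -[leLHS]mulr1 ler_pM ?lerDl //.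
have hA : A <= a0 * (g * (1 + s)).
  rewrite AE a0E [leRHS]mulrAC ler_wpM2r ?invr_ge0 ?(ltW c0) // invfM invrK.
  have : C5 <= C5 * (g * (1 + s)).
    by rewrite ler_peMr // -[leLHS]mulr1 ler_pM ?lerDl.
  have : 10 * C8 * K0 * (g * s) <= 10 * C8 * K0 * (g * (1 + s)).
    by rewrite ler_wpM2l ?mulr_ge0 // ler_wpM2l // lerDr.
  have -> : C8 * s * (2^-1 * (20 * K0 * g)) = 10 * C8 * K0 * (g * s) by field.
  by rewrite mulrDl; lra.
have gs0 : 0 <= g * (1 + s) by rewrite mulr_ge0 // addr_ge0.
have XE : X = g * (1 + s) * (1 + U) by rewrite /X; ring.
have hAX : A <= a0 * X.
  by apply: le_trans hA _; rewrite ler_wpM2l // XE ler_peMr // lerDl.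
have hAU : A * U <= a0 * X.
  apply: le_trans (_ : a0 * (g * (1 + s)) * U <= _); first by rewrite ler_wpM2r.
  by rewrite -[leLHS]mulrA ler_wpM2l // XE ler_wpM2l // lerDr.
have r1 : Bu <= Bu * X by rewrite ler_peMr.
have r2 : 20 * K0 * g <= 20 * K0 * X by rewrite ler_wpM2l // mulr_ge0.
have r3 : T * (C5 + 1 + 20 * K0 * g * kap + A * (C3 + 1))
   <= T * ((C5 + 1 + 20 * K0 * kap + a0 * (C3 + 1)) * X).
  rewrite ler_wpM2l //.
  have t1 : C5 + 1 <= (C5 + 1) * X by rewrite ler_peMr // addr_ge0.
  have t2 : 20 * K0 * g * kap <= 20 * K0 * kap * X.
    by rewrite mulrAC ler_wpM2l // !mulr_ge0.
  have t3 : A * (C3 + 1) <= a0 * (C3 + 1) * X.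
    by rewrite mulrAC ler_wpM2r // addr_ge0.
  by rewrite 2!mulrDl; lra.
have -> : (Bu + 20 * K0 + 2 * a0 + T * (C5 + 1 + 20 * K0 * kap + a0 * (C3 + 1)) + 1)
    * (g * (1 + U)) * (1 + s) = Bu * X + 20 * K0 * X + 2 * (a0 * X)
     + T * ((C5 + 1 + 20 * K0 * kap + a0 * (C3 + 1)) * X) + X by rewrite /X; ring.
rewrite -[2 * A * U]mulrA.
have arith (t1 t2 k1 k2 au ax bx x bu : R) : bu <= bx -> k2 <= k1 -> t1 <= t2 -> au <= ax ->
  1 <= x -> bu + k2 + 2 * au + t1 + 1 <= bx + k1 + 2 * ax + t2 + x by lra.
exact: arith.
Qed.

End Absorption.

(** * The norms of the statement as attained bounds on the solution *)

Section Suprema.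
Variables (R : realType) (d : nat) (T : R).
Hypothesis T0 : 0 < T.
Let TT : 0 <= T <= T. Proof. by rewrite (ltW T0) lexx. Qed.

Lemma enorm_le_sum (x : 'rV[R]_d) : enorm x <= \sum_i `|x 0 i|.
Proof.
have s0 : 0 <= \sum_i `|x 0 i| by apply: sumr_ge0 => i _; exact: normr_ge0.
rewrite -[leRHS]ger0_norm // -sqrtr_sqr ler_sqrt ?sqr_ge0 // expr2 mulr_suml.
apply: ler_sum => i _; rewrite -[x 0 i ^+ 2]ger0_norm ?sqr_ge0 // expr2 normrM.
by rewrite ler_wpM2l // (bigD1 i) //= lerDl sumr_ge0.
Qed.

(** [sup] dominates its set only when the set has an upper bound; a rough bound with no uniformity
    is enough to secure this. *)
Lemma sup_bounds (E : set R) (B : R) : E !=set0 -> (forall r, E r -> 0 <= r <= B) ->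
  0 <= sup E /\ forall r, E r -> r <= sup E.
Proof.
move=> [r0 Er0] h; have uE : has_ubound E by exists B => r /h /andP[].
have hs r : E r -> r <= sup E by exact: ub_le_sup.
by split=> //; apply: le_trans (hs _ Er0); have /andP[] := h _ Er0.
Qed.

Lemma sup_norm_spec (u : 'rV[R]_d * R -> R) : continuous u -> periodic_x u ->
  [/\ 0 <= sup_norm T u, forall x t, 0 <= t <= T -> `|u (x, t)| <= sup_norm T u
    & forall M, (forall x t, 0 <= t <= T -> `|u (x, t)| <= M) -> sup_norm T u <= M].
Proof.
move=> cu pu; have [B B0 hB] := periodic_bounded T cu pu.
have ne : [set r | exists x t, 0 <= t <= T /\ r = `|u (x, t)|] !=set0.
  by exists `|u (0, T)|; exists 0, T.
have [||h1 h2] := @sup_bounds [set r | exists x t, 0 <= t <= T /\ r = `|u (x, t)|] B.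
- exact: ne.
- by move=> r [x [t [tT ->]]]; rewrite normr_ge0 hB.
split=> // [x t tT|M hM]; first by apply: h2; exists x, t.
by apply: ge_sup => // r [x [t [tT ->]]]; exact: hM.
Qed.

Lemma grad_sup_spec (u : 'rV[R]_d * R -> R) : smooth u -> periodic_x u ->
  [/\ 0 <= grad_sup T u, forall x t, 0 <= t <= T -> enorm (Dx u (x, t)) <= grad_sup T u
    & forall M, (forall x t, 0 <= t <= T -> enorm (Dx u (x, t)) <= M) -> grad_sup T u <= M].
Proof.
move=> su pu.
have hb j : exists B, 0 <= B /\ forall x t, 0 <= t <= T -> `|'D_(dx R j) u (x, t)| <= B.
  have [B B0 hB] := periodic_bounded T (smooth_continuous (smooth_derive (dx R j) su))
    (periodic_x_derive (dx R j) pu).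
  by exists B.
have [f hf] := choice hb.
have ne : [set r | exists x t, 0 <= t <= T /\ r = enorm (Dx u (x, t))] !=set0.
  by exists (enorm (Dx u (0, T))); exists 0, T.
have [||h1 h2] := @sup_bounds [set r | exists x t, 0 <= t <= T /\ r = enorm (Dx u (x, t))]
  (\sum_j f j).
- exact: ne.
- move=> r [x [t [tT ->]]]; rewrite sqrtr_ge0 /=; apply: le_trans (enorm_le_sum _) _.
  by apply: ler_sum => j _; have [_ h] := hf j; apply: le_trans (h x t tT); rewrite DxE.
split=> // [x t tT|M hM]; first by apply: h2; exists x, t.
by apply: ge_sup => // r [x [t [tT ->]]]; exact: hM.
Qed.

(** The norm only sees [f] on the time interval, so it can be computed with the continuous periodic
    [F], which makes the supremum finite. *)
Lemma LinfLp_spec (p : R) (f F : 'rV[R]_d * R -> R) : 0 < p -> continuous F -> periodic_x F ->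
  (forall x t, 0 <= t <= T -> f (x, t) = F (x, t)) ->
  0 <= LinfLp T p f /\
  forall t, 0 <= t <= T -> iint (@unitI R) (fun x => `|F (x, t)| `^ p) <= LinfLp T p f `^ p.
Proof.
move=> p0 cF pF fF; have [B B0 hB] := periodic_bounded T cF pF.
pose I t := iint (@unitI R) (fun x => `|F (x, t)| `^ p).
have I0 t : 0 <= I t by apply: iint_ge0 => x; exact: powR_ge0.
have IB t : 0 <= t <= T -> I t <= B `^ p.
  move=> tT; pose Fp z := `|F z| `^ p.
  have cFp : continuous Fp.
    move=> z; apply: (@continuous_comp _ _ _ F (fun a : R => `|a| `^ p)); first exact: cF.
    exact: continuous_norm_powR.
  have pFp : periodic_x Fp by move=> x s i; rewrite /Fp pF.
  have uF : ucont (fun x => Fp (x, t)).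
    move=> e e0; have [del del0 hd] := periodic_unif T cFp pFp e0.
    by exists del => // x y xy; apply: (hd y t x t) => //; rewrite subrr normr0 ltW.
  have u0 : ucont (fun _ : 'rV[R]_d => 0 : R).
    by move=> e e0; exists 1 => // x y _; rewrite subrr normr0 ltW.
  have := @iint_dist R d (fun x => Fp (x, t)) (fun=> 0) (B `^ p) uF u0.
  rewrite iint_cst subr0 => h; apply: le_trans (ler_norm _) (h _) => x.
  rewrite subr0 ger0_norm ?powR_ge0 //; apply: ge0_ler_powR; rewrite ?nnegrE ?(ltW p0) //.
  exact: hB.
have If t : 0 <= t <= T -> iint (@unitI R) (fun x => `|f (x, t)| `^ p) = I t.
  by move=> tT; congr iint; apply/funext => x; rewrite fF.
have [||h1 h2] := @sup_bounds [set r | exists t, 0 <= t <= T /\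
     r = (iint (@unitI R) (fun x => `|f (x, t)| `^ p)) `^ p^-1] ((B `^ p) `^ p^-1).
- by exists ((iint (@unitI R) (fun x => `|f (x, T)| `^ p)) `^ p^-1); exists T.
- move=> r [t [tT ->]]; rewrite powR_ge0 /= If //.
  apply: ge0_ler_powR; rewrite ?nnegrE ?invr_ge0 ?powR_ge0 ?(ltW p0) //; exact: IB.
split=> // t tT.
have -> : iint (@unitI R) (fun x => `|F (x, t)| `^ p) = (I t `^ p^-1) `^ p.
  by rewrite -powRrM mulVf ?powRr1 ?gt_eqF.
apply: ge0_ler_powR; rewrite ?nnegrE ?powR_ge0 ?(ltW p0) //.
apply: h2; exists t; split; first exact: tT.
exact: (congr1 (fun a => a `^ p^-1) (esym (If t tT))).
Qed.

End Suprema.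

(** * Terminal data, sign of the source, dimension *)

Section Data.
Variables (R : realType) (d : nat).

Lemma torus_bounded (w : 'rV[R]_d -> R) : continuous w -> torus_periodic w ->
  exists2 B : R, 0 <= B & forall x, `|w x| <= B.
Proof.
move=> cw pw; have cF : continuous (fun z : 'rV[R]_d * R => w z.1).
  by move=> z; apply: continuous_comp; [exact: cvg_fst | exact: cw].
have pF : periodic_x (fun z : 'rV[R]_d * R => w z.1) by move=> x t i; exact: pw.
have [B B0 hB] := periodic_bounded 0 cF pF.
by exists B => // x; have := hB x 0; rewrite lexx; apply.
Qed.

Lemma torus_periodic_derive (w : 'rV[R]_d -> R) v : torus_periodic w -> torus_periodic ('D_v w).
Proof.
move=> pw x i; rewrite /derive.
rewrite (_ : (fun h : R => _) = (fun h => h^-1 *: ((w \o shift x) (h *: v) - w x))) //.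
by apply/funext => h /=; rewrite pw /shift /= addrA pw.
Qed.

Lemma derive_slice (u : 'rV[R]_d * R -> R) (w : 'rV[R]_d -> R) t x i :
  (forall y, u (y, t) = w y) -> 'D_(dx R i) u (x, t) = 'D_(ev R i) w x.
Proof.
move=> uw; rewrite /derive.
rewrite (_ : (fun h : R => _) = (fun h => h^-1 *: ((w \o shift x) (h *: ev R i) - w x))) //.
apply/funext => h /=; congr (_ *: (_ - _)); last exact: uw.
by rewrite -uw /shift /=; congr (u (_, _)); rewrite /= scaler0 add0r.
Qed.

Lemma geps_ge0 (eta : 'rV[R]_d -> R) alpha eps m z : 0 < eps -> (forall x, 0 <= eta x) ->
  0 <= geps eta alpha eps m z.
Proof.
move=> e0 eta0; apply: iint_ge0 => y; apply: mulr_ge0; last exact: powR_ge0.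
by apply: mulr_ge0 => //; rewrite invr_ge0 exprn_ge0 // ltW.
Qed.

(* For [d = 1] the denominator in (A10) is negative. *)
Lemma dimension_ge2 (alpha mu : R) : (0 < d)%N -> 0 < alpha -> mu < 1 ->
  alpha < 2 / (d%:R * (1 + mu) - 2) -> (2 <= d)%N.
Proof.
move=> d0 a0 mu1 h; case: (ltnP 1 d) => // d1.
have d1' : d%:R = 1 :> R by have -> : d = 1%N by apply/eqP; rewrite eqn_leq d1.
move: h; rewrite d1' mul1r => h.
have : 2 / (1 + mu - 2) < 0 :> R by rewrite pmulr_rlt0 // invr_lt0; lra.
lra.
Qed.

End Data.

Lemma data_bound (R : realType) (d : nat) (uT : 'rV[R]_d -> R) : smooth uT -> torus_periodic uT ->
  exists2 Bu : R, 0 <= Bu & forall x, `|uT x| <= Bu /\ forall i, `|'D_(ev R i) uT x| <= Bu.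
Proof.
move=> suT puT.
have [B B0 hB] := torus_bounded (smooth_continuous suT) puT.
have hb (j : 'I_d) : exists B, 0 <= B /\ forall x, `|'D_(ev R j) uT x| <= B.
  have [B' B'0 hB'] := torus_bounded (smooth_continuous (smooth_derive (ev R j) suT))
    (torus_periodic_derive (ev R j) puT).
  by exists B'.
have [f hf] := choice hb.
have f0 : 0 <= \sum_j f j by apply: sumr_ge0 => j _; have [] := hf j.
exists (B + \sum_j f j); first by rewrite addr_ge0.
move=> x; split=> [|i]; first by apply: le_trans (hB x) _; rewrite lerDl.
have [fi h] := hf i; apply: le_trans (h x) _; rewrite (bigD1 i) //= addrCA lerDl addr_ge0 //
  sumr_ge0 // => j _.
by have [] := hf j.
Qed.

(** [C] is chosen before [u] and [f]. Only the sign of the source, the equation and the bounds on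
    the terminal data connect them to the constant, whence its independence of [eps]. *)
Theorem gradient_estimate (R : realType) (d : nat) (T c C3 C5 C8 mu p Bu : R)
  (H : 'rV[R]_d * 'rV[R]_d -> R) :
  (0 < d)%N -> 0 < T -> 2 <= p -> d%:R < p -> smooth H -> periodic_H H -> (forall x q, 1 <= H (x,
    q)) ->
  0 < c -> 0 <= C3 -> 0 <= C5 -> 0 <= C8 -> 0 <= Bu -> 0 < mu < 1 ->
  (forall x q, c * H (x, q) - C3 <= Lhat H x q) ->
  (forall x q, enorm (DxH H x q) <= C5 * H (x, q) + C5) ->
  (forall x q, enorm (DpH H x q) ^+ 2 <= C8 * enorm q `^ mu * H (x, q) + C8) ->
  exists C : R, forall u f : 'rV[R]_d * R -> R, smooth u -> periodic_x u ->
    (forall x t, 0 <= t <= T -> f (x, t) = hjb H u (x, t)) ->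
    (forall x t, 0 <= t <= T -> 0 <= f (x, t)) ->
    (forall x, `|u (x, T)| <= Bu) -> (forall x i, `|'D_(dx R i) u (x, T)| <= Bu) ->
    grad_sup T u <= C + C * LinfLp T p f `^ (1 - mu)^-1
      + C * LinfLp T p f `^ (1 - mu)^-1 * sup_norm T u `^ (1 - mu)^-1.
Proof.
move=> d0 T0 p2 dp sH pH H1 c0 C30 C50 C80 Bu0 mu01 hL hX hP.
have /andP[mu0 _] := mu01.
have [K0 K01 HK] := kernel_specP T0 p2 d0 dp.
have K00 : 0 <= K0 by apply: le_trans K01.
have T00 : 0 <= T by exact: ltW.
pose kap := 2 / (9 * T) + C8 / 2; pose a0 := (C5 + 10 * C8 * K0) / c.
have kap0 : 0 <= kap by rewrite addr_ge0 ?divr_ge0 ?mulr_ge0.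
have a00 : 0 <= a0 by rewrite divr_ge0 ?(ltW c0) // addr_ge0 // !mulr_ge0.
pose a1 := Bu + 20 * K0 + 2 * a0 + T * (C5 + 1 + 20 * K0 * kap + a0 * (C3 + 1)) + 1.
have a10 : 0 <= a1 by do ![done | apply: addr_ge0 | apply: mulr_ge0].
pose a2 := Bu + T + K0 + T + T * (C3 + 1) + 1.
have a20 : 0 <= a2 by do ![done | apply: addr_ge0 | apply: mulr_ge0].
(* One constant serves both hypotheses of the absorption: [a2] bounds the value, and [d * a1] the
   sum of the components of the gradient. *)
pose a3 := d%:R * a1 + a2.
have da1 : 0 <= d%:R * a1 by rewrite mulr_ge0.
have a30 : 0 <= a3 by rewrite addr_ge0.
have [C hC] := gradient_absorption a30 mu01.
exists C => u f su pu fE f0 uB vB.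
have [U0 uU Ule] := sup_norm_spec T0 (smooth_continuous su) pu.
have [Kp0 uK Kle] := grad_sup_spec T0 su pu.
have p0 : 0 < p by apply: lt_le_trans p2.
have [G0 FG] := LinfLp_spec T0 p0 (continuous_hjb sH su) (hjb_periodic pH pu) fE.
move: (sup_norm T u) (grad_sup T u) (LinfLp T p f) U0 uU Ule Kp0 uK Kle G0 FG => U K G U0 uU Ule
  Kp0 uK Kle G0 FG.
have F0 x t : 0 <= t <= T -> 0 <= hjb H u (x, t) by move=> tT; rewrite -fE ?f0.
have main i x t := @solution_bounds R d T p K0 T0 p2 d0 K01 HK H u sH pH su pu
  c C3 C5 C8 G K U Bu mu c0 C30 C50 C80 G0 (ltW mu0) H1 hL hX hP F0 FG uK uU uB vB i _ x t erefl.
have G1 : 1 <= G + 1 by rewrite lerDr.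
have s0 : 0 <= K `^ mu by exact: powR_ge0.
have X0 : 0 <= (G + 1) * (1 + U) * (1 + K `^ mu).
  by rewrite !mulr_ge0 ?addr_ge0.
apply: hC => //.
  apply: Ule => x t tT; have [h _] := main (Ordinal d0) x t tT; apply: le_trans h _.
  apply: le_trans (_ : a2 * (1 + G) <= _); last by rewrite ler_wpM2r ?addr_ge0 // lerDr.
  have : 0 <= (Bu + T + T * (C3 + 1) + 1) * G by rewrite mulr_ge0 //; do ![done | apply: addr_ge0
    | apply: mulr_ge0].
  by rewrite /a2; lra.
rewrite (addrC 1 G); apply: Kle => x t tT; apply: le_trans (enorm_le_sum _) _.
apply: le_trans (_ : d%:R * a1 * ((G + 1) * (1 + U) * (1 + K `^ mu)) <= _); last first.
  by rewrite -[leRHS]mulrA ler_wpM2r // lerDl.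
rewrite -mulrA mulr_natl -[d in _ *+ d]card_ord -sumr_const; apply: ler_sum => i _.
rewrite DxE; have [_ h] := main i x t tT; apply: le_trans h _; rewrite [leRHS]mulrA.
exact: (slope_bound Bu0 K00 c0 C30 C50 C80 T00 kap0 G1 s0 U0 erefl erefl).
Qed.

Unset Implicit Arguments.

Theorem theorem3 (R : realType) (d : nat) (T : R)
  (H : 'rV[R]_d * 'rV[R]_d -> R) (alpha mu kappa0 : R)
  (uT m0 : 'rV[R]_d -> R) (eta : 'rV[R]_d -> R) :
  (0 < d)%N -> 0 < T ->
  (* (A1) *)
  smooth H -> periodic_H H ->
  (forall x p q lam, p != q -> 0 < lam < 1 ->
     H (x, lam *: p + (1 - lam) *: q) < lam * H (x, p) + (1 - lam) * H (x, q)) ->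
  (forall x (M : R), exists r : R, forall p, r < enorm p -> M * enorm p <= H (x, p)) ->
  (forall x p, 1 <= H (x, p)) ->
  (* (A2) *)
  smooth uT -> torus_periodic uT -> smooth m0 -> torus_periodic m0 ->
  (forall x, 0 <= m0 x) -> iint (@unitI R) m0 = 1 ->
  (* (A3) *)
  (exists c C : R, 0 < c /\ 0 < C /\ forall x p, Lhat H x p >= c * H (x, p) - C) ->
  (* (A4) g(z) = z^alpha, built into [gpow] *)
  0 < alpha ->
  (* (A5) *)
  (exists C : R, forall x p,
     enorm (DxH H x p) <= C * H (x, p) + C /\ fnorm (DxxH H x p) <= C * H (x, p) + C) ->
  (forall delta : R, 0 < delta -> exists Cd : R, forall (M : 'M[R]_d) x p, M^T = M ->
     \tr (DpxH H x p *m M) <= delta * \tr (DppH H x p *m (M *m M)) + Cd * H (x, p)) ->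
  (* (A6) *)
  0 < kappa0 -> (forall x, kappa0 <= m0 x) ->
  (* (A7) *)
  0 < mu < 1 ->
  (exists c1 C1 c2 C2 : R, 0 <= c1 /\ 0 <= C1 /\ 0 <= c2 /\ 0 <= C2 /\
     forall x p, c1 * enorm p `^ (2 + mu) + C1 <= H (x, p) /\
                 H (x, p) <= c2 * enorm p `^ (2 + mu) + C2) ->
  (* (A8) *)
  (exists C : R, forall x p,
     enorm (DpH H x p) ^+ 2 <= C * enorm p `^ mu * H (x, p) + C) ->
  (* (A9) *)
  (exists C : R, forall x p,
     fnorm (DxpH H x p) ^+ 2 <= C * H (x, p) `^ ((2 + 2 * mu) / (2 + mu)) /\
     forall M : 'M[R]_d, M^T = M ->
       fnorm (DppH H x p *m M) ^+ 2
       <= C * H (x, p) `^ (mu / (2 + mu)) * \tr (DppH H x p *m M *m M)) ->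
  (* (A10) *)
  alpha < 2 / (d%:R * (1 + mu) - 2) ->
  (* mollifier *)
  mollifier eta ->
  forall p : R, d%:R < p ->
  exists C : R, forall (eps : R) (u m : 'rV[R]_d * R -> R), 0 < eps ->
    reg_solution H eta alpha eps T uT m0 u m ->
    grad_sup T u <=
      C + C * LinfLp T p (geps eta alpha eps m) `^ (1 - mu)^-1
        + C * LinfLp T p (geps eta alpha eps m) `^ (1 - mu)^-1
            * sup_norm T u `^ (1 - mu)^-1.
Proof.
move=> d0 T0 sH pH _ _ H1 suT puT _ _ _ _ [c [C3 [c0 [C30 hL]]]] alpha0 [C5 hX] _ _ _.
move=> mu01 _ [C8 hP] _ ha [_ [eta0 _]] p dp; have /andP[mu0 mu1] := mu01.
have d2 := dimension_ge2 d0 alpha0 mu1 ha.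
(* This is what places the square of the source in L^(p/2) with exponent at least 1. *)
have p2 : 2 <= p by apply: le_trans (ltW dp); rewrite ler_nat.
have [Bu Bu0 hBu] := data_bound suT puT.
(* These two constants come without a sign; since [H] is positive they may be replaced by their
   positive parts. *)
have C5' : 0 <= Num.max C5 0 by rewrite le_max lexx orbT.
have C8' : 0 <= Num.max C8 0 by rewrite le_max lexx orbT.
have H0 x q : 0 <= H (x, q) by apply: le_trans (H1 x q).
have hX' x q : enorm (DxH H x q) <= Num.max C5 0 * H (x, q) + Num.max C5 0.
  have [h _] := hX x q; apply: le_trans h _.
  by rewrite lerD ?ler_wpM2r // le_max lexx.
have hP' x q : enorm (DpH H x q) ^+ 2 <= Num.max C8 0 * enorm q `^ mu * H (x, q) + Num.max C8 0.
  apply: le_trans (hP x q) _.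
  by rewrite lerD ?ler_wpM2r ?powR_ge0 // le_max lexx.
have [C hC] := gradient_estimate d0 T0 p2 dp sH pH H1 c0 (ltW C30) C5' C8' Bu0 mu01 hL hX' hP'.
exists C => eps u m eps0 [su [_ [pu [_ [eqn [_ [uTE _]]]]]]].
apply: hC => //.
- move=> x t tT; have := eqn x t tT; rewrite /hjb /=.
  by move: (geps _ _ _ _ _) (Lap _ _) ('D_ _ _ _) (H _) => *; lra.
- by move=> x t _; exact: geps_ge0.
- by move=> x; rewrite uTE; have [] := hBu x.
- by move=> x i; have [_ h] := hBu x; rewrite (derive_slice x i uTE).
Qed.
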